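(* Let $X$ be a UMD space, let $1<p<\infty$, and let $A$ be the generator of an analytic semigroup on $X$ that has maximal $L^p$-regularity. Let $k=2$ and let $\delta_0=\tfrac32$, $\delta_1=-2$, $\delta_2=\tfrac12$ be the coefficients of the two-step backward difference formula. Then there is a constant $C_{p,X}$ (which may depend on $p$, $X$ and $A$) such that for every stepsize $\tau>0$, every integer $N\ge k$ and all $f_k,\dots,f_N\in X$, the numerical solution $(u_n)_{n=k}^N$ of $$\frac1\tau\sum_{j=0}^k\delta_j u_{n-j}=Au_n+f_n,\qquad k\le n\le N,\qquad u_0=\dots=u_{k-1}=0,$$ satisfies, with $\dot u_n=\frac1\tau\sum_{j=0}^k\delta_j u_{n-j}$, $$\big\|(\dot u_n)_{n=k}^N\big\|_{\ell^p(X)}+\big\|(Au_n)_{n=k}^N\big\|_{\ell^p(X)}\le C_{p,X}\,\big\|(f_n)_{n=k}^N\big\|_{\ell^p(X)} .$$ In particular the constant is independent of $N$ and $\tau$.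
   Context: A (complex) Banach space $X$ is a UMD space if the Hilbert transform $Hf(t)=\mathrm{P.V.}\int_{\mathbb R}\frac{1}{t-s}f(s)\,ds$ is bounded on $L^p(\mathbb R;X)$ for all $1<p<\infty$. A generator $A$ of an analytic semigroup on $X$ has maximal $L^p$-regularity if there is a constant $C$ such that for every $f\in L^p(\mathbb R_+;X)$ the solution $u$ of $u'(t)=Au(t)+f(t)$, $t>0$, $u(0)=0$, satisfies $\|u'\|_{L^p(\mathbb R_+;X)}+\|Au\|_{L^p(\mathbb R_+;X)}\le C\|f\|_{L^p(\mathbb R_+;X)}$. (This property for some $p\in(1,\infty)$ is equivalent to it for all $p\in(1,\infty)$.) The coefficients of the $k$-step BDF method are given by $\delta(\zeta)=\sum_{j=0}^k\delta_j\zeta^j=\sum_{\ell=1}^k\frac1\ell(1-\zeta)^\ell$. For a finite sequence $(v_n)$ in $X$, $\|(v_n)\|_{\ell^p(X)}=\big(\sum_n\|v_n\|_X^p\big)^{1/p}$. *)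

(* Defs.v *)
From HB Require Import structures.
From mathcomp Require Import all_boot all_order all_algebra.
From mathcomp Require Import all_classical all_reals all_analysis.
From mathcomp Require Import complex ring.

Set Implicit Arguments.
Unset Strict Implicit.
Unset Printing Implicit Defensive.

Import Order.TTheory GRing.Theory Num.Theory.
Import numFieldNormedType.Exports.

Local Open Scope classical_set_scope.
Local Open Scope complex_scope.
Local Open Scope ring_scope.

(* A complex Banach space is a [completeNormedModType R[i]] with R : realType.
   Its norm takes values in R[i]; [rnorm] is the same number, read in R. *)
Definition rnorm (R : realType) (X : completeNormedModType R[i]) (x : X) : R :=
  complex.Re `|x|.

(* [patch] with an explicit 0: the default value [point] used by the notation
   [f \_ D] is not known to be 0 in an abstract normed module. *)
Definition ext0 (R : realType) (X : completeNormedModType R[i])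
  (D : set R) (f : R -> X) : R -> X := patch (fun=> 0) D f.

Section BochnerSpaces.
Context {R : realType} {X : completeNormedModType R[i]}.
Local Notation mu := (@lebesgue_measure R).

Definition simple (g : R -> X) : Prop :=
  finite_set (range g) /\
  forall x, measurable (g @^-1` [set x]) /\
            (x != 0 -> (mu (g @^-1` [set x]) < +oo)%E).

(* The value 0 may be taken on a set of infinite measure; [fine] sends +oo to
   0, and the corresponding term vanishes anyway. *)
Definition simple_integral (g : R -> X) : X :=
  \sum_(x \in range g) ((fine (mu (g @^-1` [set x])))%:C *: x).

Definition strongly_measurable (f : R -> X) : Prop :=
  exists g : nat -> R -> X, (forall n, simple (g n)) /\
    {ae mu, forall t, g n t @[n --> \oo] --> f t}.

(* f is Bochner integrable over the real line, with integral v *)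
Definition is_bochner (f : R -> X) (v : X) : Prop :=
  strongly_measurable f /\
  exists g : nat -> R -> X,
    [/\ forall n, simple (g n),
        (\int[mu]_t (rnorm (f t - g n t))%:E)%E @[n --> \oo] --> 0%E &
        simple_integral (g n) @[n --> \oo] --> v].

Definition Lpnorm (p : R) (f : R -> X) : \bar R :=
  'N[mu]_(p%:E)[EFin \o (@rnorm R X) \o f].

Definition in_Lp (p : R) (f : R -> X) : Prop :=
  strongly_measurable f /\ (Lpnorm p f < +oo)%E.

(* (Hf)(t) = y: the truncated integrals over |t - s| > e exist and tend to y *)
Definition is_hilbert (f : R -> X) (t : R) (y : X) : Prop :=
  exists h : R -> X,
    (forall e : R, 0 < e ->
       is_bochner (ext0 [set s | e < `|t - s|]
                        (fun s => ((t - s)^-1)%:C *: f s)) (h e)) /\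
    h e @[e --> 0^'+] --> y.

End BochnerSpaces.

(* Boundedness of H on every L^p: the principal value exists almost everywhere
   and defines a function of L^p whose norm is controlled by that of f. *)
Definition UMD (R : realType) (X : completeNormedModType R[i]) : Prop :=
  forall p : R, 1 < p ->
  exists C : R, forall f : R -> X, in_Lp p f ->
  exists Hf : R -> X,
    [/\ {ae (@lebesgue_measure R), forall t, is_hilbert f t (Hf t)},
        in_Lp p Hf &
        (Lpnorm p Hf <= C%:E * Lpnorm p f)%E].

(* the open sector |arg z| < theta, z <> 0 *)
Definition sector (R : realType) (theta : R) : set R[i]^o :=
  [set z | exists r a : R,
     [/\ 0 < r, `|a| < theta & z = (r * cos a) +i* (r * sin a)]].

(* Values of T outside the sector and 0 are irrelevant.  Since X is a complex
   space, [derivable] in the parameter z is complex differentiability. *)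
Definition analytic_semigroup (R : realType) (X : completeNormedModType R[i])
    (theta : R) (T : R[i]^o -> {linear X -> X}) : Prop :=
  [/\ forall x, T 0 x = x,
      forall z w, sector theta z -> sector theta w ->
        forall x, T (z + w) x = T z (T w x),
      forall z, sector theta z -> continuous (T z),
      forall z, sector theta z ->
        forall x, derivable (fun w : R[i]^o => T w x : X) z 1 &
      forall x,
        T z x @[z --> within (sector theta) (nbhs (0 : R[i]^o))] --> x].

(* An unbounded operator is given by its domain DA and a function A, of which
   only the values on DA matter. *)
Definition generates (R : realType) (X : completeNormedModType R[i])
    (T : R[i]^o -> {linear X -> X}) (DA : set X) (A : X -> X) : Prop :=
  forall x y, (DA x /\ A x = y) <->
    (t^-1)%:C *: (T t%:C x - x) @[t --> (0 : R)^'+] --> y.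

Definition generates_analytic (R : realType)
    (X : completeNormedModType R[i]) (DA : set X) (A : X -> X) : Prop :=
  exists (theta : R) (T : R[i]^o -> {linear X -> X}),
    [/\ 0 < theta <= pi / 2, analytic_semigroup theta T & generates T DA A].

Definition is_deriv (R : realType) (X : completeNormedModType R[i])
    (u : R -> X) (t : R) (v : X) : Prop :=
  (h^-1)%:C *: (u (t + h) - u t) @[h --> (0 : R)^'] --> v.

(* u is a strong solution of u' = A u + f on t > 0, u(0) = 0, and u' = du:
   u is the integral of its almost everywhere derivative du (that is, u is
   locally absolutely continuous) and the equation holds for almost every t. *)
Definition strong_solution (R : realType) (X : completeNormedModType R[i])
    (DA : set X) (A : X -> X) (f u du : R -> X) : Prop :=
  [/\ u 0 = 0,
      forall t, 0 <= t -> is_bochner (ext0 [set s | 0 <= s <= t] du) (u t) &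
      {ae (@lebesgue_measure R), forall t, 0 < t ->
        [/\ is_deriv u t (du t), DA (u t) & du t = A (u t) + f t]}].

Definition maximal_regularity (R : realType) (X : completeNormedModType R[i])
    (p : R) (DA : set X) (A : X -> X) : Prop :=
  let Rplus : set R := [set t | 0 <= t] in
  exists C : R, forall f : R -> X, in_Lp p (ext0 Rplus f) ->
    (exists u du : R -> X, strong_solution DA A f u du) /\
    forall u du : R -> X, strong_solution DA A f u du ->
      (Lpnorm p (ext0 Rplus du) + Lpnorm p (ext0 Rplus (A \o u))
         <= C%:E * Lpnorm p (ext0 Rplus f))%E.

(* the norm in l^p of the finite sequence v_m, ..., v_N *)
Definition seq_lpnorm (R : realType) (X : completeNormedModType R[i])
    (p : R) (m N : nat) (v : nat -> X) : R :=
  (\sum_(m <= n < N.+1) rnorm (v n) `^ p) `^ p^-1.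

Definition bdf_poly (R : realType) (k : nat) : {poly R} :=
  \sum_(1 <= l < k.+1) (l%:R^-1 : R) *: (1 - 'X) ^+ l.

Definition bdf2_coef (R : realType) (j : nat) : R :=
  [:: 3 / 2; - 2; 1 / 2]`_j.

Lemma bdf2_coefE (R : realType) (j : nat) :
  bdf2_coef R j = (bdf_poly R 2)`_j.
Proof.
rewrite /bdf2_coef /bdf_poly big_nat_recr //= big_nat1 invr1 scale1r expr1.
rewrite sqrrB expr1n !mul1r !(coefD, coefN, coefZ, coefMn, coef1, coefX, coefXn).
case: j => [|[|[|j]]] /=; rewrite ?nth_nil; by field.
Qed.

(* (1 / tau) * sum_(0 <= j <= k) delta_j u_(n - j), for n >= k *)
Definition bdf_diff (R : realType) (X : completeNormedModType R[i])
    (delta : nat -> R) (k : nat) (tau : R) (u : nat -> X) (n : nat) : X :=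
  (tau^-1)%:C *: \sum_(j < k.+1) (delta j)%:C *: u (n - j)%N.

Definition bdf_solution (R : realType) (X : completeNormedModType R[i])
    (DA : set X) (A : X -> X) (delta : nat -> R) (k : nat) (tau : R) (N : nat)
    (f u : nat -> X) : Prop :=
  (forall n, (n < k)%N -> u n = 0) /\
  (forall n, (k <= n <= N)%N ->
     DA (u n) /\ bdf_diff delta k tau u n = A (u n) + f n).

(* Main.v *)
(* Maximal regularity enters through a discrete a priori estimate: if y_0 = 0 and
   the difference quotient (y_(n+1) - y_n) / h differs from A y_n and from
   A y_(n+1) by at most e_n, then (A y_n) is bounded in l^p by a multiple of
   (e_n), uniformly in h.  Indeed the piecewise linear interpolant of y, continued
   by the semigroup orbit of its last value, is a strong solution whose
   inhomogeneity is at most e_n on the n-th cell and vanishes after the last one.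

   For y_n = (1 + z h)^n y the estimate gives |A y| <= C |z y - A y| whenever
   Re z > 0, hence the resolvent bound |z| |(z - A)^-1| <= M on the right half
   plane, which also holds for tau A.  For |zeta| < 1 the BDF2 polynomial satisfies
   Re delta(zeta) > 0 and |delta(zeta)| >= |1 - zeta|, so that the third derivative
   of (1 - zeta)^2 (delta(zeta) - tau A)^-1 is O(|1 - zeta|^-2).  Averaging over
   the circle of radius 1 - 1/(2 (n + 1)), the n-th coefficient of this function is
   O(n^-2), uniformly in tau.  By Young's inequality, the second differences of the
   numerical solution are bounded in l^p by tau f.  They measure how far
   the numerical solution is from one of Euler's methods, and the discrete a priori
   estimate applies with e_n of the size of |f_n| + |f_(n+1)| plus the second
   differences over tau. *)
Require Import Defs.
From HB Require Import structures.
From mathcomp Require Import all_boot all_order all_algebra.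
From mathcomp Require Import all_classical all_reals all_analysis.
From mathcomp Require Import measurable_realfun complex ring lra.
Set Implicit Arguments.
Unset Strict Implicit.
Unset Printing Implicit Defensive.
Import Order.TTheory GRing.Theory Num.Theory.
Import numFieldNormedType.Exports.
Local Open Scope classical_set_scope.
Local Open Scope complex_scope.
Local Open Scope ring_scope.

(** Second differences are estimated by a kernel, rather than first differences or [A u] itself,
    because the resolvent bound only gives coefficients O(1/n) for the latter two, which is not
    summable. That singular part is left to the continuous problem; what remains is a perturbation
    with an absolutely summable kernel. The second derivative of (1 - z)^2 (delta(z) - tau A)^-1
    would lead to the mean of 1/|1 - z|, which is logarithmic; the third leads to 1/|1 - z|^2, whose
    mean over a circle is explicit through the Poisson kernel. No contour integral of a
    vector-valued function is formed: the resolvent is encoded by the equation it solves, a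
    generating function by its partial sums, and a mean over a circle by an average over roots of
    unity whose number tends to infinity. The a priori estimate alone makes z - A injective with
    closed range. Surjectivity is started at a large real point, from a truncated and discretised
    Laplace transform of the semigroup, and is then carried along segments in the half plane. *)

(** * Identities between linear combinations *)

(* A reflexive procedure for identities between linear combinations: they are
   reduced to the equality of the coefficients of each atom. *)
Inductive lincomb (K : Type) : Type :=
  | LVar of nat
  | LZero
  | LAdd of lincomb K & lincomb K
  | LOpp of lincomb K
  | LScale of K & lincomb K.
Arguments LVar {K}.
Arguments LZero {K}.

Fixpoint lin_eval (K : comPzRingType) (V : lmodType K) (env : seq V) (e : lincomb K) : V :=
  match e with
  | LVar n => nth 0 env n
  | LZero => 0
  | LAdd a b => lin_eval env a + lin_eval env b
  | LOpp a => - lin_eval env a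
  | LScale c a => c *: lin_eval env a
  end.

Fixpoint lin_coef (K : comPzRingType) (e : lincomb K) (i : nat) : K :=
  match e with
  | LVar n => if Nat.eqb n i then 1 else 0
  | LZero => 0
  | LAdd a b => lin_coef a i + lin_coef b i
  | LOpp a => - lin_coef a i
  | LScale c a => c * lin_coef a i
  end.

Fixpoint lin_wf (K : Type) (n : nat) (e : lincomb K) : bool :=
  match e with
  | LVar m => (m < n)%N
  | LZero => true
  | LAdd a b => lin_wf n a && lin_wf n b
  | LOpp a => lin_wf n a
  | LScale _ a => lin_wf n a
  end.

(** A conjunction rather than a boolean test: the coefficients are expressions in variables, and
    each equality is left to [ring] or [field]. *)
Fixpoint lin_same (K : comPzRingType) (n : nat) (e f : lincomb K) : Prop :=
  match n with
  | 0%N => True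
  | S m => lin_coef e m = lin_coef f m /\ lin_same m e f
  end.

Lemma lin_evalE (K : comPzRingType) (V : lmodType K) (env : seq V) (e : lincomb K) :
  lin_wf (size env) e ->
  lin_eval env e = \sum_(i < size env) lin_coef e i *: nth 0 env i.
Proof.
elim: e => [n ns||a IHa b IHb /= /andP[/IHa -> /IHb ->]|a IHa /IHa /= ->|c a IHa /IHa /= ->] /=.
- rewrite (bigD1 (Ordinal ns)) //= PeanoNat.Nat.eqb_refl scale1r big1 ?addr0 // => i ni.
  case: (PeanoNat.Nat.eqb_spec n i) => [E|_]; last by rewrite scale0r.
  by case/eqP: ni; apply/val_inj.
- by rewrite big1 // => i _; rewrite scale0r.
- by rewrite -big_split; apply: eq_bigr => i _; rewrite scalerDl.
- by rewrite -sumrN; apply: eq_bigr => i _; rewrite scaleNr.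
- by rewrite scaler_sumr; apply: eq_bigr => i _; rewrite scalerA.
Qed.

Lemma lin_sameP (K : comPzRingType) (V : lmodType K) (env : seq V) (e f : lincomb K) :
  lin_wf (size env) e && lin_wf (size env) f -> lin_same (size env) e f ->
  lin_eval env e = lin_eval env f.
Proof.
case/andP => we wf same; rewrite !lin_evalE //; apply: eq_bigr => i _; congr (_ *: _).
have := ltn_ord i; move: same (nat_of_ord i); elim: (size env) => //= n IH [En Sn] j.
by rewrite ltnS leq_eqVlt => /orP[/eqP -> //|]; apply: IH.
Qed.

Ltac lin_mem x l :=
  lazymatch l with
  | nil => constr:(false)
  | x :: _ => constr:(true)
  | _ :: ?t => lin_mem x t
  end.
Ltac lin_index x l :=
  lazymatch l with
  | x :: _ => constr:(O)
  | _ :: ?t => let n := lin_index x t in constr:(S n)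
  end.
Ltac lin_atoms e l :=
  lazymatch e with
  | (?a + ?b)%R => let l1 := lin_atoms a l in lin_atoms b l1
  | (- ?a)%R => lin_atoms a l
  | (_ *: ?a)%R => lin_atoms a l
  | 0%R => l
  | _ => lazymatch lin_mem e l with true => l | false => constr:(e :: l) end
  end.
Ltac lin_reify K e l :=
  lazymatch e with
  | (?a + ?b)%R =>
      let a' := lin_reify K a l in let b' := lin_reify K b l in constr:(@LAdd K a' b')
  | (- ?a)%R => let a' := lin_reify K a l in constr:(@LOpp K a')
  | (?c *: ?a)%R => let a' := lin_reify K a l in constr:(@LScale K c a')
  | 0%R => constr:(@LZero K)
  | _ => let n := lin_index e l in constr:(@LVar K n)
  end.
Ltac lin_split tac :=
  lazymatch goal with
  | |- True => exact I
  | |- _ /\ _ => split; [tac | lin_split tac]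
  end.
Ltac linear_with K V tac :=
  lazymatch goal with
  | |- ?x = ?y =>
      let l1 := lin_atoms x (@nil V) in
      let l := lin_atoms y l1 in
      let e := lin_reify K x l in
      let f := lin_reify K y l in
      refine (@lin_sameP _ _ l e f _ _);
      [exact: isT | cbv [size lin_same lin_coef Nat.eqb]; lin_split tac]
  end.

(** * Moduli and norms *)

Definition cabs (R : realType) (z : R[i]) : R := complex.Re `|z|.

Section ComplexModulus.
Context {R : realType}.
Implicit Types (z w : R[i]) (r : R).

Lemma ge0_complexE z : 0 <= z -> z = (complex.Re z)%:C.
Proof. by case: z => a b; rewrite lecE => /andP[/eqP /= ->]. Qed.

Lemma cabsE z : `|z| = (cabs z)%:C.
Proof. exact: ge0_complexE. Qed.

Lemma cabs_ge0 z : 0 <= cabs z.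
Proof. by rewrite -ler0c -cabsE normr_ge0. Qed.

Lemma cabsC r : cabs r%:C = `|r|.
Proof. by apply: complexI; rewrite -cabsE normc_def /= expr0n addr0 sqrtr_sqr. Qed.

Lemma cabsM z w : cabs (z * w) = cabs z * cabs w.
Proof. by apply: complexI; rewrite rmorphM /= -!cabsE normrM. Qed.

Lemma cabs1 : cabs (1 : R[i]) = 1.
Proof. by apply: complexI; rewrite -cabsE normr1. Qed.

Lemma cabs0 : cabs (0 : R[i]) = 0.
Proof. by apply: complexI; rewrite -cabsE normr0. Qed.

Lemma cabsX z n : cabs (z ^+ n) = cabs z ^+ n.
Proof. by elim: n => [|n IH]; rewrite ?expr0 ?cabs1// !exprS cabsM IH. Qed.

Lemma cabsV z : cabs z^-1 = (cabs z)^-1.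
Proof. by apply: complexI; rewrite -cabsE normfV cabsE fmorphV. Qed.

Lemma cabsN z : cabs (- z) = cabs z.
Proof. by rewrite /cabs normrN. Qed.

Lemma cabsD z w : cabs (z + w) <= cabs z + cabs w.
Proof. by rewrite -lecR rmorphD /= -!cabsE ler_normD. Qed.

Lemma cabsB z w : cabs z - cabs w <= cabs (z - w).
Proof. by rewrite lerBlDr -{1}(subrK w z) cabsD. Qed.

Lemma cabs_gt0 z : (0 < cabs z) = (z != 0).
Proof. by rewrite -normr_gt0 cabsE ltcR. Qed.

Lemma cabs_sqr z : cabs z ^+ 2 = complex.Re z ^+ 2 + complex.Im z ^+ 2.
Proof.
rewrite /cabs normc_def /= sqr_sqrtr //.
by apply: addr_ge0; apply: sqr_ge0.
Qed.

Lemma Re_le_cabs z : complex.Re z <= cabs z.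
Proof.
apply: le_trans (ler_norm _) _.
rewrite -(ler_pXn2r (n := 2)) ?nnegrE ?cabs_ge0 //.
by rewrite cabs_sqr real_normK ?num_real // lerDl sqr_ge0.
Qed.

End ComplexModulus.

Section RealNorm.
Context {R : realType} {X : completeNormedModType R[i]}.
Implicit Types (x y : X) (c : R[i]).

Lemma rnormE x : `|x| = (rnorm x)%:C.
Proof. exact: ge0_complexE. Qed.

Lemma rnorm_ge0 x : 0 <= rnorm x.
Proof. by rewrite -ler0c -rnormE normr_ge0. Qed.

Lemma rnorm0 : rnorm (0 : X) = 0.
Proof. by rewrite /rnorm normr0. Qed.

Lemma rnorm_eq0 x : rnorm x = 0 -> x = 0.
Proof. by move=> x0; apply/eqP; rewrite -normr_eq0 rnormE x0. Qed.

Lemma rnormN x : rnorm (- x) = rnorm x.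
Proof. by rewrite /rnorm normrN. Qed.

Lemma rdistC x y : rnorm (x - y) = rnorm (y - x).
Proof. by rewrite -rnormN opprB. Qed.

Lemma rnormD x y : rnorm (x + y) <= rnorm x + rnorm y.
Proof. by rewrite -lecR rmorphD /= -!rnormE ler_normD. Qed.

Lemma rnorm_triB x y : rnorm (x - y) <= rnorm x + rnorm y.
Proof. by rewrite -(rnormN y) rnormD. Qed.

Lemma rnormB x y : rnorm x - rnorm y <= rnorm (x - y).
Proof. by rewrite lerBlDr -{1}(subrK y x) rnormD. Qed.

Lemma rnorm_tri y x z : rnorm (x - z) <= rnorm (x - y) + rnorm (y - z).
Proof. by rewrite -{1}(subrK y x) -addrA rnormD. Qed.

Lemma rnormZ c x : rnorm (c *: x) = cabs c * rnorm x.
Proof. by apply: complexI; rewrite rmorphM /= -rnormE -cabsE normrZ rnormE. Qed.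

Lemma rnormZr (r : R) x : rnorm (r%:C *: x) = `|r| * rnorm x.
Proof. by rewrite rnormZ cabsC. Qed.

Lemma rnorm_sum (I : Type) (s : seq I) (P : pred I) (F : I -> X) :
  rnorm (\sum_(i <- s | P i) F i) <= \sum_(i <- s | P i) rnorm (F i).
Proof.
elim/big_rec2: _ => [|i x r _ xr]; first by rewrite rnorm0.
by apply: le_trans (rnormD _ _) _; rewrite lerD2l.
Qed.

Lemma cvg_rnormP (T : Type) (F : set_system T) (FF : Filter F) (f : T -> X) (l : X) :
  f @ F --> l <-> forall e : R, 0 < e -> \forall t \near F, rnorm (f t - l) < e.
Proof.
split=> [fl e e0|H].
  have := (@cvgr_distC_lt _ _ _ F FF f l) fl e%:C.
  rewrite ltcR => /(_ e0); apply: filterS => t.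
  by rewrite rnormE ltcR.
apply/cvgrPdistC_lt => e e0.
have eE : e = (complex.Re e)%:C by apply: ge0_complexE; apply: ltW.
have /H : 0 < complex.Re e by rewrite -ltcR -eE.
by apply: filterS => t; rewrite rnormE eE ltcR.
Qed.

Lemma cvg_seq_rnormP (u : nat -> X) (l : X) :
  u n @[n --> \oo] --> l <->
  forall e : R, 0 < e -> exists N, forall n, (N <= n)%N -> rnorm (u n - l) < e.
Proof.
split=> [/cvg_rnormP H e /H [N _ HN]|H]; first by exists N => n; apply: HN.
apply/cvg_rnormP => e /H[N HN]; exists N => // n; exact: HN.
Qed.

Lemma cauchy_rnorm (u : nat -> X) :
  (forall e : R, 0 < e -> exists N, forall m n, (N <= m)%N -> (N <= n)%N ->
     rnorm (u m - u n) < e) ->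
  exists l : X, u n @[n --> \oo] --> l.
Proof.
move=> H; suff c : cvg (u @ \oo) by exists (lim (u @ \oo)).
apply: cauchy_cvg; apply/cauchy_ballP => e e0.
have eE : e = (complex.Re e)%:C by apply: ge0_complexE; apply: ltW.
have /H[N HN] : 0 < complex.Re e by rewrite -ltcR -eE.
exists ([set u n | n in [set n | (N <= n)%N]], [set u n | n in [set n | (N <= n)%N]]).
  by split; exists N => // n Nn /=; exists n.
move=> [a b] /= [[m Nm <-] [n Nn <-]].
by rewrite -ball_normE /= rnormE eE ltcR HN.
Qed.

End RealNorm.

(** * Roots of unity and circular means *)

Section RootsOfUnity.
Context {R : realType}.
Implicit Types (t : R).

Definition cis t : R[i] := cos t +i* sin t.

Lemma cisD t s : cis (t + s) = cis t * cis s.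
Proof. by rewrite /cis cosD sinD; apply/eqP; rewrite eq_complex /= !eqxx/= addrC mulrC eqxx. Qed.

Lemma cisX t n : cis t ^+ n = cis (t *+ n).
Proof.
elim: n => [|n IH]; first by rewrite expr0 mulr0n /cis cos0 sin0.
by rewrite exprS mulrS cisD IH.
Qed.

Lemma cabs_cis t : cabs (cis t) = 1.
Proof.
apply/eqP; rewrite -(eqrXn2 (n := 2)) ?cabs_ge0 //.
by rewrite cabs_sqr /= cos2Dsin2 expr1n.
Qed.

Lemma cabs_cisB1 t : cabs (cis (t *+ 2) - 1) ^+ 2 = (2 * sin t) ^+ 2.
Proof.
rewrite cabs_sqr /= subr0 sin_mulr2n cos_mulr2n.
by have := cos2Dsin2 t; set c := cos t; set s := sin t => cs; nra.
Qed.

Lemma sin_le_id t : 0 <= t -> sin t <= t.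
Proof.
move=> t0.
have [|c _] := @MVT_segment R (fun x => x - sin x) (fun x => 1 - cos x) 0 t t0.
  apply: continuous_subspaceT => x; apply: cvgB; first exact: cvg_id.
  exact: continuous_sin.
rewrite sin0 !subr0 => E; rewrite -subr_ge0 E mulr_ge0 // subr_ge0 cos_le1.
Qed.

(** The angle is kept as a doubled one, the form in which [cabs_cisB1] gives the length of the chord
    from 1. *)
Definition unity (L : nat) : R[i] := cis ((pi / L%:R) *+ 2).

Lemma unityX (L : nat) : (0 < L)%N -> unity L ^+ L = 1.
Proof.
move=> L0; rewrite cisX -mulrnA mulnC mulrnA -mulrnAr.
rewrite -(mulr_natr _^-1) mulVf ?pnatr_eq0 -?lt0n //.
by rewrite mulr1 /cis cos2pi sin2pi.
Qed.

Lemma cabs_unity L : cabs (unity L) = 1.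
Proof. exact: cabs_cis. Qed.

Lemma unityX_neq1 (L k : nat) : (0 < k < L)%N -> unity L ^+ k != 1.
Proof.
move=> /andP[k0 kL]; have L0 : (0 < L)%N by apply: leq_trans kL.
rewrite -subr_eq0 -cabs_gt0 -(ltr_pXn2r (n := 2)) ?nnegrE ?cabs_ge0 //.
rewrite expr0n cisX -mulrnA mulnC mulrnA cabs_cisB1 exprn_gt0 // mulr_gt0 //.
apply: sin_gt0_pi; rewrite -mulrnAr -mulr_natr mulrC.
rewrite !mulr_gt0 ?invr_gt0 ?ltr0n ?pi_gt0 //=.
rewrite gtr_pMl ?pi_gt0 // mulrC ltr_pdivrMr ?ltr0n // mul1r.
by rewrite ltr_nat.
Qed.

Lemma cabs_unityB1 (L : nat) : (0 < L)%N -> cabs (unity L - 1) <= 2 * pi / L%:R.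
Proof.
move=> L0; rewrite -(ler_pXn2r (n := 2)) ?nnegrE ?cabs_ge0 //; last first.
  by rewrite divr_ge0 ?mulr_ge0 ?pi_ge0.
rewrite cabs_cisB1 -mulrA ler_pXn2r ?nnegrE //; first last.
- by rewrite mulr_ge0 // divr_ge0 ?pi_ge0.
- rewrite mulr_ge0 // sin_ge0_pi // divr_ge0 ?pi_ge0 //=.
  by rewrite ler_pdivrMr ?ltr0n // ler_peMr ?pi_ge0 // ler1n.
by rewrite ler_pM2l // sin_le_id // divr_ge0 ?pi_ge0.
Qed.

(** Orthogonality of the characters of Z/L: multiplied by w - 1, the geometric sum telescopes to w^L
    - 1 = 0. *)
Lemma sum_unityX (L k : nat) : (0 < L)%N ->
  \sum_(j < L) (unity L ^+ j) ^+ k = if (L %| k)%N then L%:R else 0.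
Proof.
move=> L0.
have E : unity L ^+ k = unity L ^+ (k %% L).
  by rewrite {1}(divn_eq k L) exprD mulnC exprM unityX // expr1n mul1r.
under eq_bigr do rewrite -exprM mulnC exprM E.
rewrite /dvdn; case: ifPn => [/eqP ->|k0].
  by under eq_bigr do rewrite expr0 expr1n; rewrite sumr_const card_ord.
set w := _ ^+ _; have w1 : w - 1 != 0.
  by rewrite subr_eq0 unityX_neq1 // ltn_mod L0 lt0n k0.
apply: (mulfI w1); rewrite mulr0 -subrX1 -exprM mulnC exprM unityX //.
by rewrite expr1n subrr.
Qed.

Lemma cabs_node (r : R) L j : 0 <= r -> cabs (r%:C * unity L ^+ j) = r.
Proof. by move=> r0; rewrite cabsM cabsC cabsX cabs_unity expr1n mulr1 ger0_norm. Qed.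

Lemma Re_sum (I : Type) (s : seq I) (F : I -> R[i]) :
  complex.Re (\sum_(i <- s) F i) = \sum_(i <- s) complex.Re (F i).
Proof. by apply: (big_morph (@complex.Re R)) => // -[a b] [c d]. Qed.

(* [1 / |1 - z|^2] is, up to the factor [1 - |z|^2], the Poisson kernel
   [Re ((1 + z) / (1 - z))], whose circular means are known. *)
Lemma sum_inv_sqr_dist (r : R) (L : nat) : 0 <= r < 1 -> (0 < L)%N -> r ^+ L <= 2^-1 ->
  \sum_(j < L) (cabs (1 - r%:C * unity L ^+ j) ^+ 2)^-1 <= 3 * L%:R / (1 - r).
Proof.
move=> /andP[r0 r1] L0 rL.
have z1 j : 1 - r%:C * unity L ^+ j != 0.
  rewrite -cabs_gt0; apply: lt_le_trans (cabsB _ _).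
  by rewrite cabs1 cabs_node // subr_gt0.
have rL1 : 1 - r%:C ^+ L != 0 :> R[i].
  rewrite -cabs_gt0; apply: lt_le_trans (cabsB _ _).
  rewrite cabs1 cabsX cabsC ger0_norm // subr_gt0; apply: le_lt_trans rL _.
  by rewrite invf_lt1 // ltr1n.
(* At every node z^L = r^L, so that the geometric series closes exactly after [L] terms. *)
have geo j : (1 - r%:C * unity L ^+ j)^-1 =
    (1 - r%:C ^+ L)^-1 * \sum_(k < L) (r%:C * unity L ^+ j) ^+ k.
  apply: (mulfI (z1 j)); rewrite divff // mulrCA -[X in X * \sum_(_ < _) _]opprB mulNr -subrX1 opprB.
  by rewrite exprMn -exprM mulnC exprM unityX // expr1n mulr1 mulVf.
have total : \sum_(j < L) (1 - r%:C * unity L ^+ j)^-1 = (L%:R / (1 - r ^+ L))%:C.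
  under eq_bigr do rewrite geo.
  rewrite -mulr_sumr exchange_big /=.
  under eq_bigr do under eq_bigr do rewrite exprMn.
  under eq_bigr do rewrite -mulr_sumr sum_unityX //.
  rewrite (bigD1 (Ordinal L0)) //= expr0 dvdn0 mul1r big1 ?addr0; last first.
    move=> i i0; rewrite /dvdn modn_small //.
    by case: eqP => [ii|]; rewrite ?mulr0 //; case/eqP: i0; apply/val_inj.
  by rewrite mulrC rmorphM fmorphV rmorphB rmorphXn rmorph_nat rmorph1.
have r21 : 0 < 1 - r ^+ 2 by rewrite subr_gt0 expr_lt1.
have poisson z : cabs z = r -> (cabs (1 - z) ^+ 2)^-1 =
    (1 - r ^+ 2)^-1 * (2 * complex.Re (1 - z)^-1 - 1).
  move=> zr; have : cabs z ^+ 2 = r ^+ 2 by rewrite zr.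
  have : cabs (1 - z) ^+ 2 != 0.
    rewrite expf_neq0 // gt_eqF //; apply: lt_le_trans (cabsB _ _).
    by rewrite cabs1 zr subr_gt0.
  rewrite !cabs_sqr; case: z {zr} => a b /= n0 E.
  move: n0 r21; rewrite -E !sub0r => n0 r21.
  by field; rewrite n0 gt_eqF.
under eq_bigr do rewrite poisson ?cabs_node //.
rewrite -mulr_sumr big_split /= sumr_const card_ord -mulr_sumr -Re_sum total /=.
(* Source of the constant 3: the real parts add up to at most 2 L, and twice this minus [L] is 3
   L. *)
have rL12 : (1 - r ^+ L)^-1 <= 2.
  by rewrite invf_ple ?posrE ?subr_gt0 ?(le_lt_trans rL) ?invf_lt1 ?ltr1n //; lra.
have Lr : 0 < L%:R :> R by rewrite ltr0n.
have qL : L%:R <= L%:R / (1 - r ^+ L) <= 2 * L%:R.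
  rewrite [X in _ <= _ <= X]mulrC ler_pM2l // rL12 andbT.
  rewrite ler_pdivlMr ?mul1r ?ger_pMr // ?gerBl ?exprn_ge0 //.
  by rewrite subr_gt0 (le_lt_trans rL) // invf_lt1 // ltr1n.
case/andP: qL => qL1 qL2; rewrite mulrC mulNrn; apply: ler_pM.
- by rewrite subr_ge0; lra.
- by rewrite invr_ge0 ltW.
- by lra.
rewrite lef_pV2 ?posrE //; last by rewrite subr_gt0.
by nra.
Qed.

End RootsOfUnity.

(** * Cauchy's formulas for Riemann sums *)

Section MeanValue.
Context {R : realType} {X : completeNormedModType R[i]}.

(** The exponent [L - n] plays the role of -n at an [L]-th root of unity. As all degrees are below
    [L], there is no aliasing and only m = n survives. *)
Lemma coef_mean (v : nat -> X) (r : R) (n Q L : nat) : (n < Q <= L)%N ->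
  \sum_(j < L) unity L ^+ j ^+ (L - n) *:
     (\sum_(m < Q) (r%:C * unity L ^+ j) ^+ m *: v m)
  = L%:R *: (r%:C ^+ n *: v n).
Proof.
move=> /andP[nQ QL]; have nL := leq_trans nQ QL.
have L0 : (0 < L)%N by apply: leq_ltn_trans nL.
under eq_bigr do rewrite scaler_sumr.
rewrite exchange_big /=.
under eq_bigr do under eq_bigr do rewrite exprMn scalerA mulrCA -exprD mulrC -scalerA.
under eq_bigr do rewrite -scaler_suml sum_unityX //.
rewrite (bigD1 (Ordinal nQ)) //= subnK ?dvdnn ?(ltnW nL) //.
rewrite big1 ?addr0 // => i ni; have -> : (L %| L - n + i)%N = false; last by rewrite scale0r.
apply/negP => /dvdnP[q]; have iQ := ltn_ord i.
have ni' : nat_of_ord i != n by apply: contra ni => /eqP ni; apply/eqP/val_inj.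
case: q => [|[|q]]; rewrite ?mulSn ?mul0n ?addn0 => Eq.
- by move/eqP: Eq; rewrite addn_eq0 subn_eq0 leqNgt nL.
- move/eqP: ni'; apply; apply/eqP; rewrite -(eqn_add2l (L - n)) Eq subnK //.
  exact: ltnW nL.
have : (L - n + i < L + (L + q * L))%N.
  by rewrite -addnS leq_add // ?leq_subr // (leq_trans iQ) // (leq_trans QL) // leq_addr.
by rewrite Eq ltnn.
Qed.

Lemma rnorm_coef_mean (v : nat -> X) (r : R) (n L : nat) : 0 <= r ->
  rnorm ((L%:R : R[i]) *: (r%:C ^+ n *: v n)) = L%:R * (r ^+ n * rnorm (v n)).
Proof.
move=> r0; rewrite !rnormZ cabsX cabsC (ger0_norm r0).
by rewrite -(rmorph_nat (real_complex R)) cabsC ger0_norm.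
Qed.

Lemma coef_le_mean (v : nat -> X) (r : R) (n Q L : nat) :
  0 <= r -> (n < Q <= L)%N ->
  L%:R * (r ^+ n * rnorm (v n)) <=
  \sum_(j < L) rnorm (\sum_(m < Q) (r%:C * unity L ^+ j) ^+ m *: v m).
Proof.
move=> r0 nQL; rewrite -rnorm_coef_mean // -(coef_mean _ _ nQL).
apply: le_trans (rnorm_sum _ _ _) _; apply: ler_sum => j _.
by rewrite rnormZ !cabsX cabs_unity !expr1n mul1r.
Qed.

(* Passing from the circle of radius [rho] to that of radius [rho - r / L]
   costs as much as a multiple of an angular step, and the latter telescopes
   around the circle: this is Cauchy's theorem for Riemann sums. *)
Lemma circle_mean (f f' : R[i] -> X) (r K : R) (L : nat) :
  0 < r -> (1 < L)%N ->
  (forall z z', cabs z <= r -> cabs z' <= r ->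
    rnorm (f z' - f z - (z' - z) *: f' z) <= K * cabs (z' - z) ^+ 2) ->
  rnorm (\sum_(j < L) f (r%:C * unity L ^+ j) - L%:R *: f 0)
    <= K * r ^+ 2 * (1 + 2 * pi).
Proof.
move=> r0 L1 H; have L0 : (0 < L)%N by apply: ltnW.
have LR0 : 0 < L%:R :> R by rewrite ltr0n.
have K0 : 0 <= K.
  have := H 0 r%:C; rewrite cabs0 cabsC gtr0_norm // subr0 cabsC => /(_ (ltW r0) (lexx _)).
  by move/(le_trans (rnorm_ge0 _)); rewrite pmulr_lge0 // exprn_gt0 // gtr0_norm.
pose rho k : R := r - k%:R * (r / L%:R).
pose S k := \sum_(j < L) f ((rho k)%:C * unity L ^+ j).
have w1 : unity L - 1 != 0 :> R[i] by rewrite subr_eq0 -[unity L]expr1 unityX_neq1.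
have step k : (k < L)%N ->
    rnorm (S k.+1 - S k) <= K * r ^+ 2 * (1 + 2 * pi) / L%:R.
  move=> kL.
  have rk0 : 0 < rho k.
    rewrite subr_gt0 mulrCA -[ltRHS]mulr1 ltr_pM2l // ltr_pdivrMr // mul1r.
    by rewrite ltr_nat.
  have rkr : rho k <= r by rewrite gerBl mulr_ge0 // divr_ge0 // ltW.
  have rkS : rho k.+1 = rho k - r / L%:R by rewrite /rho -natr1 mulrDl mul1r; lra.
  have rkS0 : 0 <= rho k.+1.
    rewrite subr_ge0 mulrCA -[leRHS]mulr1 ler_pM2l // ler_pdivrMr // mul1r.
    by rewrite ler_nat.
  have rkSr : rho k.+1 <= r by rewrite gerBl mulr_ge0 // divr_ge0 // ltW.
  (* To first order the radial increment of [f] at z is -[c] times the angular one. Adding [c] times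
     the angular increments, whose sum around the circle is 0, cancels the terms with f'(z). *)
  pose c : R[i] := (r / L%:R / rho k)%:C / (unity L - 1).
  have tel : \sum_(j < L) (f ((rho k)%:C * unity L ^+ j.+1) -
      f ((rho k)%:C * unity L ^+ j)) = 0.
    rewrite -(big_mkord xpredT (fun j => f ((rho k)%:C * unity L ^+ j.+1) -
      f ((rho k)%:C * unity L ^+ j))) telescope_sumr //.
    by rewrite unityX // expr0 subrr.
  have -> : S k.+1 - S k = \sum_(j < L) ((f ((rho k.+1)%:C * unity L ^+ j) -
      f ((rho k)%:C * unity L ^+ j)) + c *: (f ((rho k)%:C * unity L ^+ j.+1) -
      f ((rho k)%:C * unity L ^+ j))).
    by rewrite big_split /= -scaler_sumr tel scaler0 addr0 sumrB.
  apply: le_trans (rnorm_sum _ _ _) _.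
  (* There are L^2 pairs of a node and a radial step, each with an error of order L^-2; this makes
     the final bound independent of [L]. *)
  have -> : K * r ^+ 2 * (1 + 2 * pi) / L%:R =
     \sum_(j < L) (K * r ^+ 2 * (1 + 2 * pi) / L%:R ^+ 2).
    by rewrite sumr_const card_ord -[RHS]mulr_natr; field; rewrite gt_eqF.
  apply: ler_sum => j _; set z := (rho k)%:C * unity L ^+ j.
  have zr : cabs z = rho k by rewrite cabs_node // ltW.
  have H1 := H z ((rho k.+1)%:C * unity L ^+ j).
  have H2 := H z ((rho k)%:C * unity L ^+ j.+1).
  rewrite zr !cabs_node ?(ltW rk0) // in H1 H2.
  have {H1} := H1 rkr rkSr; have {H2} := H2 rkr rkr.
  have -> : (rho k)%:C * unity L ^+ j.+1 - z = (unity L - 1) * z.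
    by rewrite /z exprS; ring.
  have -> : (rho k.+1)%:C * unity L ^+ j - z = - ((r / L%:R / rho k)%:C * z).
    rewrite /z mulrA -rmorphM /= divfK ?gt_eqF // rkS rmorphB /=; ring.
  have nE : `|r / L%:R / rho k| * rho k = r / L%:R.
    by rewrite ger0_norm ?divfK ?gt_eqF // !divr_ge0 // ltW.
  rewrite cabsN !(cabsM _ z) zr cabsC nE.
  set E2 := (X in rnorm X <= _); set E1 := (X in _ -> rnorm X <= _ -> _) => H2 H1.
  have -> : f ((rho k.+1)%:C * unity L ^+ j) - f z +
     c *: (f ((rho k)%:C * unity L ^+ j.+1) - f z) = E1 + c *: E2.
    have -> : c *: E2 = c *: (f ((rho k)%:C * unity L ^+ j.+1) - f z) -
        ((r / L%:R / rho k)%:C * z) *: f' z.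
      rewrite [LHS]scalerBr scalerA; congr (_ - _ *: _).
      by rewrite mulrA divfK.
    by rewrite /E1 scaleNr opprK addrACA subrr addr0.
  apply: le_trans (rnormD _ _) _; rewrite rnormZ.
  have cE : cabs c = r / L%:R / rho k / cabs (unity L - 1).
    by rewrite cabsM cabsV cabsC ger0_norm // !divr_ge0 // ltW.
  have w0 : 0 < cabs (unity L - 1 : R[i]) by rewrite cabs_gt0.
  have w2 := cabs_unityB1 (R := R) L0.
  have -> : K * r ^+ 2 * (1 + 2 * pi) / L%:R ^+ 2 =
    K * (r / L%:R) ^+ 2 + r / L%:R * K * r * (2 * pi / L%:R).
    by field; rewrite gt_eqF.
  apply: lerD => //.
  apply: le_trans (ler_wpM2l (cabs_ge0 c) H2) _.
  have -> : cabs c * (K * (cabs (unity L - 1) * rho k) ^+ 2) =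
      r / L%:R * K * rho k * cabs (unity L - 1).
    by rewrite cE; field; rewrite ?gt_eqF.
  have rL0 : 0 <= r / L%:R by rewrite divr_ge0 // ltW.
  apply: ler_pM w2; [|exact: cabs_ge0|].
    by apply: mulr_ge0 (ltW rk0); apply: mulr_ge0.
  by rewrite ler_wpM2l // mulr_ge0.
have -> : \sum_(j < L) f (r%:C * unity L ^+ j) - L%:R *: f 0 = S 0%N - S L.
  rewrite /S /rho mul0r subr0; congr (_ - _).
  rewrite mulrCA divff ?gt_eqF // mulr1 subrr.
  by under eq_bigr do rewrite mul0r; rewrite sumr_const card_ord scaler_nat.
rewrite rdistC.
have : forall k, (k <= L)%N ->
   rnorm (S k - S 0%N) <= k%:R * (K * r ^+ 2 * (1 + 2 * pi) / L%:R).
  elim=> [|k IH] kL; first by rewrite subrr rnorm0 mul0r.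
  apply: le_trans (rnorm_tri (S k) _ _) _.
  by rewrite -natr1 mulrDl mul1r addrC lerD ?IH ?step // ltnW.
move=> /(_ L (leqnn _)) /le_trans; apply.
by rewrite mulrCA divff ?gt_eqF // mulr1.
Qed.

End MeanValue.

(** * The convolution kernel of the two-step method *)

(** The resolvent appears through the equation [z *: y - A y = x], so that no inverse operator has
    to be constructed. *)
Definition half_plane_resolvent (R : realType) (X : completeNormedModType R[i])
    (DA : set X) (A : X -> X) (M : R) : Prop :=
  [/\ forall (a b : R[i]) x y, DA x -> DA y ->
        DA (a *: x + b *: y) /\ A (a *: x + b *: y) = a *: A x + b *: A y,
      forall (z : R[i]) x, 0 < complex.Re z -> exists2 y, DA y & z *: y - A y = x &
      forall (z : R[i]) y, 0 < complex.Re z -> DA y ->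
        cabs z * rnorm y <= M * rnorm (z *: y - A y)].

Section BDF2Kernel.
Context {R : realType} {X : completeNormedModType R[i]}.
Context {DA : set X} {A : X -> X} {M : R}.
Context (res : half_plane_resolvent DA A M).
Context (M0 : 0 <= M).
Local Ltac lin := linear_with (R[i]) X ltac:(first [by ring | by field]).
Implicit Types (v g : nat -> X) (z : R[i]) (x y : X).

Lemma res_lin (a b : R[i]) x y : DA x -> DA y ->
  DA (a *: x + b *: y) /\ A (a *: x + b *: y) = a *: A x + b *: A y.
Proof. by case: res => H _ _; apply: H. Qed.

Lemma DA0 : DA 0 /\ A 0 = 0.
Proof.
have [y Dy _] : exists2 y, DA y & (1 : R[i]) *: y - A y = 0.
  by case: res => _ H _; apply: H; rewrite /= ltr01.
by have := res_lin 0 0 Dy Dy; rewrite !scale0r addr0.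
Qed.

Lemma DAD x y : DA x -> DA y -> DA (x + y) /\ A (x + y) = A x + A y.
Proof. by move=> Dx Dy; have := res_lin 1 1 Dx Dy; rewrite !scale1r. Qed.

Lemma DAZ (a : R[i]) x : DA x -> DA (a *: x) /\ A (a *: x) = a *: A x.
Proof. by move=> Dx; have := res_lin a 0 Dx Dx; rewrite !scale0r !addr0. Qed.

Lemma DAB x y : DA x -> DA y -> DA (x - y) /\ A (x - y) = A x - A y.
Proof. by move=> Dx Dy; have := res_lin 1 (-1) Dx Dy; rewrite !scale1r !scaleN1r. Qed.

Definition delta z : R[i] := 3 / 2 - 2 * z + z ^+ 2 / 2.

Lemma ReN z : complex.Re (- z) = - complex.Re z. Proof. by case: z. Qed.
Lemma ReD z w : complex.Re (z + w) = complex.Re z + complex.Re w.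
Proof. by case: z w => ? ? []. Qed.
Lemma ReZ (r : R) z : complex.Re (r%:C * z) = r * complex.Re z.
Proof. by case: z => a b /=; rewrite mul0r subr0. Qed.

(** A-stability: with z = a + i b, the real part is (1 - a)^2 + (1 - |z|^2) / 2. *)
Lemma Re_delta z : cabs z < 1 -> 0 < complex.Re (delta z).
Proof.
move=> z1; have : cabs z ^+ 2 < 1 by rewrite expr_lt1 ?cabs_ge0.
have -> : delta z = (3 / 2)%:C - 2%:C * z + 2^-1%:C * z ^+ 2.
  rewrite /delta !rmorphM fmorphV !rmorph_nat; by field.
rewrite cabs_sqr !ReD ReN !ReZ; case: z {z1} => a b /= z1.
have -> : 3 / 2 - 2 * a + 2^-1 * (a * a - b * b) =
  (1 - a) ^+ 2 + (1 - (a ^+ 2 + b ^+ 2)) / 2 by field.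
by rewrite ltr_wpDl ?sqr_ge0 // divr_gt0 // subr_gt0.
Qed.

(** The other root of the polynomial is 3, at distance at least 2 from the unit disc. *)
Lemma cabs_delta z : cabs z < 1 -> cabs (1 - z) <= cabs (delta z).
Proof.
move=> z1; have -> : delta z = (1 - z) * (2^-1%:C * (3%:C - z)).
  rewrite /delta fmorphV !rmorph_nat; by field.
rewrite cabsM cabsM cabsC ger0_norm // ler_peMr ?cabs_ge0 //.
have := cabsB 3%:C z; rewrite cabsC ger0_norm //.
by lra.
Qed.

Lemma cabs_1B z (r : R) : cabs z <= r -> 1 - r <= cabs (1 - z).
Proof. by move=> zr; apply: le_trans (cabsB _ _); rewrite cabs1 lerD2l lerN2. Qed.

Lemma res_le z y : cabs z < 1 -> DA y ->
  cabs (1 - z) * rnorm y <= M * rnorm (delta z *: y - A y).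
Proof.
move=> z1 Dy; case: res => _ _ /(_ (delta z) y (Re_delta z1) Dy); apply: le_trans.
by rewrite ler_wpM2r ?rnorm_ge0 ?cabs_delta.
Qed.

Lemma res_le_r z y (r : R) : cabs z <= r -> r < 1 -> DA y ->
  rnorm y <= M / (1 - r) * rnorm (delta z *: y - A y).
Proof.
move=> zr r1 Dy; have r0 : 0 < 1 - r by rewrite subr_gt0.
rewrite mulrAC ler_pdivlMr // mulrC; apply: le_trans (res_le (le_lt_trans zr r1) Dy).
by rewrite ler_wpM2r ?rnorm_ge0 ?cabs_1B.
Qed.

Definition solv z x : X := xget 0 [set y | DA y /\ delta z *: y - A y = x].

Lemma solvP z x : cabs z < 1 -> DA (solv z x) /\ delta z *: solv z x - A (solv z x) = x.
Proof.
move=> z1; case: res => _ H _; have [y Dy E] := H _ x (Re_delta z1).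
by rewrite /solv; case: xgetP => [y' _ //|/(_ y)[]].
Qed.

Lemma solv_uniq z x y : cabs z < 1 -> DA y -> delta z *: y - A y = x -> y = solv z x.
Proof.
move=> z1 Dy E; have [Ds Es] := solvP x z1; have [DB AB] := DAB Dy Ds.
apply/eqP; rewrite -subr_eq0; apply/eqP/rnorm_eq0/le_anti; rewrite rnorm_ge0 andbT.
have := res_le z1 DB.
have -> : delta z *: (y - solv z x) - A (y - solv z x) = 0.
  rewrite AB; transitivity ((delta z *: y - A y) - (delta z *: solv z x - A (solv z x))).
    by lin.
  by rewrite E Es subrr.
rewrite rnorm0 mulr0 pmulr_rle0 //; apply: lt_le_trans (cabs_1B (lexx _)).
by rewrite subr_gt0.
Qed.

(** * Generating functions of discrete solutions *)

Definition sh v : nat -> X := fun n => if n is m.+1 then v m else 0.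

(** The stepsize is absorbed into [A] and [g], and the values at negative indices are 0. In terms of
    generating functions, (delta z - A) V = G. *)
Definition bdf v g : Prop := forall n,
  DA (v n) /\ (3 / 2 : R[i]) *: v n - 2 *: sh v n + 2^-1 *: sh (sh v) n - A (v n) = g n.

Definition psum z v (Q : nat) : X := \sum_(m < Q) z ^+ m *: v m.

Lemma psumS z v Q : psum z v Q.+1 = psum z v Q + z ^+ Q *: v Q.
Proof. by rewrite /psum big_ord_recr. Qed.

Lemma psum_sh z v Q : psum z (sh v) Q.+1 = z *: psum z v Q.
Proof.
rewrite /psum big_ord_recl /= scaler0 add0r scaler_sumr; apply: eq_bigr => i _.
by rewrite /bump /= add1n scalerA exprS.
Qed.

(** What truncation after Q + 2 terms leaves behind: the products of delta with the last two
    coefficients that exceed the degree, divided by z^(Q + 2). *)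
Definition tail z v (Q : nat) : X :=
  2^-1 *: v Q - 2 *: v Q.+1 + z *: (2^-1 *: v Q.+1).

Lemma DA_psum z v g Q : bdf v g -> DA (psum z v Q) /\ A (psum z v Q) = psum z (A \o v) Q.
Proof.
move=> vg; elim: Q => [|Q [D E]]; first by rewrite /psum !big_ord0; apply: DA0.
have [D2 E2] := DAZ (z ^+ Q) (vg Q).1.
by have [] := DAD D D2; rewrite !psumS /= E E2.
Qed.

Lemma psum_bdf z v g Q : bdf v g -> delta z *: psum z v Q.+2 - A (psum z v Q.+2) =
  psum z g Q.+2 + z ^+ Q.+2 *: tail z v Q.
Proof.
move=> vg; have -> : psum z g Q.+2 = (3 / 2 : R[i]) *: psum z v Q.+2 -
    2 *: psum z (sh v) Q.+2 + 2^-1 *: psum z (sh (sh v)) Q.+2 - A (psum z v Q.+2).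
  rewrite (DA_psum _ _ vg).2 /psum !scaler_sumr -!sumrN -!big_split /=.
  apply: eq_bigr => i _; rewrite -(vg i).2.
  by lin.
rewrite !psum_sh !psumS /tail /delta !exprS.
by lin.
Qed.

Lemma bdf_uniq0 v g : bdf v g -> g 0%N = 0 -> v 0%N = 0.
Proof.
move=> /(_ 0%N) [D]; rewrite /= !scaler0 subr0 addr0 => E g0.
have z0 : cabs (0 : R[i]) < 1 by rewrite cabs0.
rewrite (@solv_uniq 0 0 (v 0%N)) //.
  by apply/esym/solv_uniq; rewrite ?DA0.2 ?scaler0 ?subr0 ?DA0.1 //; apply: DA0.1.
by rewrite -g0 -E /delta; congr (_ *: _ - _); field.
Qed.

Lemma bdf_exists g : exists v, bdf v g.
Proof.
(* The state holds the two latest values. Each stage operator is 3/2 - A, and 3/2 = delta 0, hence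
   [solv] at 0. *)
pose step (n : nat) (s : X * X) : X * X :=
  (solv 0 (g n + 2 *: s.1 - 2^-1 *: s.2), s.1).
pose st := fix st n := if n is m.+1 then step m (st m) else (0, 0).
exists (fun n => (st n.+1).1) => n.
have shE m : sh (fun n => (st n.+1).1) m = (st m).1 by case: m.
have shshE m : sh (sh (fun n => (st n.+1).1)) m = (st m).2 by case: m => [|[|m]].
have z0 : cabs (0 : R[i]) < 1 by rewrite cabs0.
have [D E] := solvP (g n + 2 *: (st n).1 - 2^-1 *: (st n).2) z0.
split=> //; rewrite shE shshE.
have -> : (st n.+1).1 = solv 0 (g n + 2 *: (st n).1 - 2^-1 *: (st n).2) by [].
move: E; set s := solv _ _ => E.
have -> : A s = delta 0 *: s - (g n + 2 *: (st n).1 - 2^-1 *: (st n).2).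
  by rewrite -E; lin.
by rewrite /delta; lin.
Qed.

Definition impulse x : nat -> X := fun n => if n is 0 then x else 0.

Lemma psum_impulse z x Q : psum z (impulse x) Q.+1 = x.
Proof. by rewrite /psum big_ord_recl /= scale1r big1 ?addr0 // => i _; rewrite scaler0. Qed.

Lemma nat_gt (a : R) : exists n : nat, a < n%:R.
Proof.
exists (Num.bound `|a|); apply: le_lt_trans (ler_norm a) _.
by rewrite archi_boundP.
Qed.

(** Division by [L] followed by L -> oo: the passage from Riemann sums to the circular mean. *)
Lemma le_of_linear (a b c : R) :
  (exists L0 : nat, forall L : nat, (L0 <= L)%N -> L%:R * a <= L%:R * b + c) -> a <= b.
Proof.
case=> L0 H; rewrite leNgt; apply/negP => ba.
have [n nc] := nat_gt (c / (a - b)).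
have := H (maxn L0 n) (leq_maxl _ _); apply/negP; rewrite -ltNge -ltrBrDl -mulrBr.
rewrite -ltr_pdivrMr ?subr_gt0 //; apply: lt_le_trans nc _.
by rewrite ler_nat leq_maxr.
Qed.

(** The summand is an analytic function of the node that vanishes at 0, so its mean over the circle
    is 0; by [circle_mean] the sum over [L] nodes then stays bounded as [L] grows. *)
Lemma tail_mean_bounded (r : R) (a b : X) : 0 < r -> r < 1 ->
  exists K, forall L, (1 < L)%N ->
    rnorm (\sum_(j < L) solv (r%:C * unity L ^+ j) ((r%:C * unity L ^+ j) ^+ 2 *:
       (a + (r%:C * unity L ^+ j) *: b))) <= K.
Proof.
move=> r0 r1; have r01 : 0 < 1 - r by rewrite subr_gt0.
pose h z : X := z ^+ 2 *: (a + z *: b).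
pose h' z : X := (2 * z) *: a + (3 * z ^+ 2) *: b.
pose f z := solv z (h z).
(* The derivative solves the differentiated equation (delta - A) f' = h' - delta' f, with delta'(z)
   = z - 2. *)
pose f' z := solv z (h' z - (z - 2) *: f z).
pose C := M / (1 - r).
pose G := rnorm a + rnorm b.
pose P := `|C| * (3 * G + 3 * (`|C| * (2 * G))).
pose K := `|C| * (3 * G + `|C| * (2 * G) + 4 * P).
have zlt z : cabs z <= r -> cabs z < 1 by move=> zr; apply: le_lt_trans r1.
have sol z x : cabs z <= r -> rnorm (solv z x) <= `|C| * rnorm x.
  move=> zr; have [D E] := solvP x (zlt _ zr); rewrite -{2}E.
  by apply: le_trans (res_le_r zr r1 D) _; rewrite ler_wpM2r ?rnorm_ge0 ?ler_norm.
have G0 : 0 <= G by rewrite addr_ge0 ?rnorm_ge0.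
have lt1X z n : cabs z <= r -> cabs (z ^+ n) <= 1.
  by move=> /zlt/ltW z1; rewrite cabsX exprn_ile1 ?cabs_ge0.
have comb (p q : R[i]) (k : R) : cabs p <= k -> cabs q <= k ->
    rnorm (p *: a + q *: b) <= k * G.
  move=> pk qk; apply: le_trans (rnormD _ _) _; rewrite !rnormZ mulrDr.
  by apply: lerD; rewrite ler_wpM2r ?rnorm_ge0.
have cnat (n : nat) : cabs (n%:R : R[i]) = n%:R.
  by rewrite -(rmorph_nat (real_complex R)) cabsC ger0_norm.
have hG z : cabs z <= r -> rnorm (h z) <= 2 * G.
  move=> zr; have -> : h z = z ^+ 2 *: a + z ^+ 3 *: b by rewrite /h; lin.
  by apply: comb; apply: le_trans (lt1X _ _ zr) _; rewrite ler1n.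
have h'G z : cabs z <= r -> rnorm (h' z) <= 3 * G.
  move=> zr; apply: comb; rewrite cabsM cnat.
    have := zlt _ zr; have := cabs_ge0 z; lra.
  by rewrite ler_piMr // lt1X.
have fG z : cabs z <= r -> rnorm (f z) <= `|C| * (2 * G).
  by move=> zr; apply: le_trans (sol _ _ zr) _; rewrite ler_wpM2l ?hG.
have f'G z : cabs z <= r -> rnorm (f' z) <= P.
  move=> zr; apply: le_trans (sol _ _ zr) _; rewrite ler_wpM2l //.
  apply: le_trans (rnorm_triB _ _) _; apply: lerD; first exact: h'G.
  rewrite rnormZ; apply: ler_pM (fG _ zr); rewrite ?cabs_ge0 ?rnorm_ge0 //.
  apply: le_trans (cabsD _ _) _; rewrite cabsN cnat.
  by have := zlt _ zr; lra.
exists (K * r ^+ 2 * (1 + 2 * pi)) => L L1.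
have f0 : f 0 = 0.
  have z0 : cabs (0 : R[i]) < 1 by rewrite cabs0.
  rewrite /f /h expr0n scale0r; apply/esym/solv_uniq => //; first exact: DA0.1.
  by rewrite DA0.2 scaler0 subr0.
have := @circle_mean R X f f' r K L r0 L1; rewrite f0 scaler0 subr0; apply.
move=> z z' zr z'r.
have [D E] := solvP (h z) (zlt _ zr); have [D' E'] := solvP (h z') (zlt _ z'r).
have [Dp Ep] := solvP (h' z - (z - 2) *: f z) (zlt _ zr).
rewrite -/(f z) in D E; rewrite -/(f z') in D' E'; rewrite -/(f' z) in Dp Ep.
have [DB AB] := DAB D' D; have [DZ AZ] := DAZ (z' - z) Dp.
have [DW AW] := DAB DB DZ.
apply: le_trans (res_le_r z'r r1 DW) _.
(* Applied to the Taylor remainder, delta(z') - A leaves the factor (z' - z)^2: the terms of order 0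
   and 1 cancel by the equations for [f z'], [f z] and [f' z]. *)
have -> : delta z' *: (f z' - f z - (z' - z) *: f' z) -
    A (f z' - f z - (z' - z) *: f' z) =
    (z' - z) ^+ 2 *: ((1 *: a + (z' + 2 * z) *: b) - 2^-1 *: f z -
      (z - 2 + (z' - z) / 2) *: f' z).
  rewrite AW AB AZ.
  have -> : A (f z') = delta z' *: f z' - h z' by rewrite -E'; lin.
  have -> : A (f z) = delta z *: f z - h z by rewrite -E; lin.
  have -> : A (f' z) = delta z *: f' z - (h' z - (z - 2) *: f z) by rewrite -Ep; lin.
  by rewrite /h /h' /delta; lin.
rewrite rnormZ cabsX mulrCA [leRHS]mulrC ler_wpM2l ?exprn_ge0 ?cabs_ge0 //.
have C0 : C <= `|C| := ler_norm C.
apply: le_trans (ler_wpM2r (rnorm_ge0 _) C0) _; rewrite ler_wpM2l //.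
have z1 := zlt _ zr; have z'1 := zlt _ z'r.
apply: le_trans (rnorm_triB _ _) _; apply: lerD.
  apply: le_trans (rnorm_triB _ _) _; apply: lerD.
    apply: comb; first by rewrite cabs1 ler1n.
    apply: le_trans (cabsD _ _) _; rewrite cabsM cnat; lra.
  rewrite rnormZ cabsV cnat; apply: le_trans (fG _ zr).
  by rewrite ler_piMl ?rnorm_ge0 // invf_le1 // ler1n.
rewrite rnormZ; apply: ler_pM (f'G _ zr); rewrite ?cabs_ge0 ?rnorm_ge0 //.
have -> : z - 2 + (z' - z) / 2 = 2^-1 * (z + z') - 2 by field.
apply: le_trans (cabsD _ _) _; rewrite cabsN cabsM cabsV !cnat.
by have := cabsD z z'; lra.
Qed.

(** Cauchy's estimate for the n-th coefficient. Nothing is known yet about the growth of [v], so the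
    sum is cut after n + 2 terms and the boundary term is removed by its vanishing mean instead of
    by smallness. *)
Lemma impulse_bound v x n (r : R) : bdf v (impulse x) -> 0 < r -> r < 1 ->
  r ^+ n * rnorm (v n) <= M / (1 - r) * rnorm x.
Proof.
move=> vx r0 r1; pose a := 2^-1 *: v n - 2 *: v n.+1; pose b := 2^-1 *: v n.+1.
have [K HK] := tail_mean_bounded a b r0 r1.
apply: (@le_of_linear _ _ (r ^+ n * K)); exists n.+2 => L nL; have L1 : (1 < L)%N by apply: leq_trans nL.
have L0 : (0 < L)%N by apply: ltnW.
have nQL : (n < n.+2 <= L)%N by rewrite nL andbT ltnW.
rewrite -rnorm_coef_mean ?(ltW r0) // -(coef_mean _ _ nQL).
pose w j := r%:C * unity L ^+ j : R[i].
have wr j : cabs (w j) = r by rewrite cabs_node // ltW.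
have w1 j : cabs (w j) < 1 by rewrite wr.
have split j : \sum_(m < n.+2) w j ^+ m *: v m =
    solv (w j) x + w j ^+ n *: solv (w j) (w j ^+ 2 *: (a + w j *: b)).
  have [D1 E1] := solvP x (w1 j).
  have [D2 E2] := solvP (w j ^+ 2 *: (a + w j *: b)) (w1 j).
  have [D3 E3] := DAZ (w j ^+ n) D2; have [D4 E4] := DAD D1 D3.
  rewrite -/(psum (w j) v n.+2).
  rewrite (solv_uniq (w1 j) (DA_psum (w j) n.+2 vx).1 (psum_bdf (w j) n vx)).
  apply/esym/solv_uniq => //; rewrite E4 E3 psum_impulse /tail -/a -/b.
  move: E1 E2; set s1 := solv _ _; set s2 := solv _ _ => E1 E2.
  have -> : w j ^+ n.+2 *: (a + w j *: b) = w j ^+ n *: (w j ^+ 2 *: (a + w j *: b)).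
    by rewrite scalerA -exprD addn2.
  by rewrite -E1 -E2; lin.
under eq_bigr do rewrite split scalerDr scalerA.
rewrite big_split /=; apply: le_trans (rnormD _ _) _; apply: lerD.
  apply: le_trans (rnorm_sum _ _ _) _; have -> : L%:R * (M / (1 - r) * rnorm x) = \sum_(j < L) (M / (1 - r) * rnorm x).
    by rewrite sumr_const card_ord mulr_natl.
  apply: ler_sum => j _.
  rewrite rnormZ !cabsX cabs_unity !expr1n mul1r.
  have [D E] := solvP x (w1 j); rewrite -{2}E; apply: res_le_r => //.
  by rewrite wr.
(* The weight cancels the angular part of w^n. What remains is r^n times a sum that stays bounded as
   [L] grows. *)
under eq_bigr => j _.
  have -> : unity L ^+ j ^+ (L - n) * w j ^+ n = r%:C ^+ n.
    rewrite exprMn mulrCA -exprD subnK ?(ltnW (leq_trans _ nL)) //.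
    by rewrite -exprM mulnC exprM unityX // expr1n mulr1.
  over.
rewrite -scaler_sumr rnormZ cabsX cabsC ger0_norm ?(ltW r0) //.
by rewrite ler_wpM2l ?exprn_ge0 ?(ltW r0) // HK.
Qed.

(** * Growth of coefficients and generating functions near 1 *)

Definition subexp v : Prop :=
  forall r : R, 0 < r -> r < 1 -> exists K, forall n, r ^+ n * rnorm (v n) <= K.

(* The coefficients of the derivative of the generating function of [v]. *)
Definition dseq v : nat -> X := fun n => (n.+1)%:R *: v n.+1.

Lemma cabs_1B_le2 z : cabs z <= 1 -> cabs (1 - z) <= 2.
Proof. by have := cabsD 1 (- z); rewrite cabs1 cabsN; lra. Qed.

Lemma natr_expr_le (q : R) n : 0 <= q -> q < 1 -> n.+1%:R * q ^+ n <= (1 - q)^-1.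
Proof.
move=> q0 q1; rewrite -[leRHS]mul1r ler_pdivlMr ?subr_gt0 //.
have -> : n.+1%:R * q ^+ n = \sum_(i < n.+1) q ^+ n by rewrite sumr_const card_ord mulr_natl.
apply: (@le_trans _ _ ((\sum_(i < n.+1) q ^+ i) * (1 - q))).
  rewrite ler_wpM2r ?subr_ge0 ?(ltW q1) //; apply: ler_sum => i _.
  by apply: ler_wiXn2l; rewrite ?(ltW q1) // -ltnS.
by rewrite mulrC -opprB mulNr -subrX1 opprB gerBl exprn_ge0.
Qed.

Lemma subexp_impulse v x : bdf v (impulse x) -> subexp v.
Proof. by move=> vx r r0 r1; exists (M / (1 - r) * rnorm x) => n; apply: impulse_bound. Qed.

Lemma middle (r : R) : 0 < r -> r < 1 ->
  [/\ 0 < (1 + r) / 2, (1 + r) / 2 < 1, 0 < r / ((1 + r) / 2) & r / ((1 + r) / 2) < 1].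
Proof.
move=> r0 r1; have m0 : 0 < (1 + r) / 2 by lra.
by split; rewrite ?divr_gt0 // ?ltr_pdivrMr //; lra.
Qed.

(** [subexp] expresses a radius of convergence of at least 1. The factor n + 1 is paid for by
    passing from r to the larger radius (1 + r) / 2. *)
Lemma subexp_dseq v : subexp v -> subexp (dseq v).
Proof.
move=> vs r r0 r1; have [m0 m1 q0 q1] := middle r0 r1.
set m := (1 + r) / 2 in m0 m1 q0 q1; set q := r / m in q0 q1.
have [K HK] := vs m m0 m1; exists ((1 - q)^-1 * (K / m)) => n.
rewrite /dseq rnormZ -(rmorph_nat (real_complex R)) cabsC ger0_norm //.
have -> : r ^+ n * (n.+1%:R * rnorm (v n.+1)) =
    (n.+1%:R * q ^+ n) * (m ^+ n.+1 * rnorm (v n.+1) / m).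
  have -> : r = q * m by rewrite divfK ?gt_eqF.
  by rewrite exprMn exprS; field; rewrite gt_eqF.
apply: ler_pM; rewrite ?natr_expr_le ?(ltW q0) //.
- by rewrite mulr_ge0 // exprn_ge0 // ltW.
- by rewrite divr_ge0 ?(ltW m0) // mulr_ge0 ?rnorm_ge0 // exprn_ge0 // ltW.
- by rewrite ler_pM2r ?invr_gt0.
Qed.

Lemma subexp_small v (r e : R) : subexp v -> 0 < r -> r < 1 -> 0 < e ->
  exists Q0, forall Q, (Q0 <= Q)%N -> r ^+ Q * rnorm (v Q) <= e.
Proof.
move=> vs r0 r1 e0; have [m0 m1 q0 q1] := middle r0 r1.
set m := (1 + r) / 2 in m0 m1 q0 q1; set q := r / m in q0 q1.
have [K HK] := vs m m0 m1.
have [n Hn] := nat_gt ((1 - q)^-1 * `|K| / e); exists n => Q nQ.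
have -> : r ^+ Q * rnorm (v Q) = q ^+ Q * (m ^+ Q * rnorm (v Q)).
  by rewrite mulrA -exprMn divfK ?gt_eqF.
have Q0 : 0 < Q.+1%:R :> R by [].
rewrite -(ler_pM2l Q0) [leLHS]mulrA; apply: (@le_trans _ _ ((1 - q)^-1 * `|K|)).
  apply: ler_pM; rewrite ?natr_expr_le ?(ltW q0) //.
  - by rewrite mulr_ge0 // exprn_ge0 // ltW.
  - by rewrite mulr_ge0 ?rnorm_ge0 ?exprn_ge0 // ltW.
  - exact: le_trans (HK Q) (ler_norm K).
rewrite -ler_pdivrMr //; apply: ltW; apply: lt_le_trans Hn _.
by rewrite ler_nat leqW.
Qed.

(* The limit over [Q] says that on the circle of radius [r] the generating
   function of [v] has norm at most [c / |1 - z| ^ k]. *)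
Definition genf_le (r : R) v (c : R) (k : nat) : Prop :=
  forall e : R, 0 < e -> exists Q0, forall Q, (Q0 <= Q)%N -> forall z, cabs z = r ->
    rnorm (psum z v Q) <= c / cabs (1 - z) ^+ k + e.

Section Circle.
Context {r : R}.
Context (r0 : 0 < r) (r1 : r < 1).

Lemma cabs_1B_gt0 z : cabs z = r -> 0 < cabs (1 - z).
Proof. by move=> zr; apply: lt_le_trans (cabs_1B (lexx _)); rewrite zr subr_gt0. Qed.

Lemma genf_ext v w c k : v =1 w -> genf_le r v c k -> genf_le r w c k.
Proof. by move=> /funext ->. Qed.

(** As |1 - z| <= 2, a bound of order k is also one of order k + 1; this brings the summands of
    [genf_lin] to a common order. *)
Lemma genf_raise v c k : 0 <= c -> genf_le r v c k -> genf_le r v (2 * c) k.+1.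
Proof.
move=> c0 H e /H [Q0 HQ]; exists Q0 => Q Q0Q z zr; apply: le_trans (HQ Q Q0Q z zr) _.
have z0 := cabs_1B_gt0 zr; rewrite lerD2r ler_pdivrMr ?exprn_gt0 //.
rewrite exprS; set s := cabs (1 - z) in z0 *.
have -> : 2 * c / (s * s ^+ k) * s ^+ k = c * (2 / s).
  by field; rewrite expf_neq0 gt_eqF.
rewrite ler_peMr // ler_pdivlMr // mul1r /s.
by rewrite cabs_1B_le2 // zr ltW.
Qed.

Lemma genf_lin (p q : R[i]) v w c d k : genf_le r v c k -> genf_le r w d k ->
  genf_le r (fun n => p *: v n + q *: w n) (cabs p * c + cabs q * d) k.
Proof.
move=> Hv Hw e e0; pose e' := e / (cabs p + cabs q + 1).
have pq : 0 < cabs p + cabs q + 1 by rewrite ltr_wpDl ?addr_ge0 ?cabs_ge0.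
have e'0 : 0 < e' by rewrite divr_gt0.
have [Q1 H1] := Hv e' e'0; have [Q2 H2] := Hw e' e'0.
exists (maxn Q1 Q2) => Q; rewrite geq_max => /andP[QQ1 QQ2] z zr.
have -> : psum z (fun n => p *: v n + q *: w n) Q = p *: psum z v Q + q *: psum z w Q.
  by rewrite /psum !scaler_sumr -big_split; apply: eq_bigr => i _; rewrite /=; lin.
apply: le_trans (rnormD _ _) _; rewrite !rnormZ.
have := ler_wpM2l (cabs_ge0 p) (H1 Q QQ1 z zr).
have := ler_wpM2l (cabs_ge0 q) (H2 Q QQ2 z zr).
have : cabs p * e' + cabs q * e' <= e.
  rewrite -mulrDl mulrCA -[leRHS]mulr1 ler_pM2l // ler_pdivrMr // mul1r; lra.
by rewrite mulrDl !mulrDr !mulrA; lra.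
Qed.

Lemma genf_sh v c k : genf_le r v c k -> genf_le r (sh v) c k.
Proof.
move=> H e /H [Q0 HQ]; exists Q0.+1 => -[//|Q] QQ z zr.
rewrite psum_sh rnormZ zr; apply: le_trans (HQ Q QQ z zr).
by rewrite ler_piMl ?rnorm_ge0 // ltW.
Qed.

(** Differencing multiplies the generating function by 1 - z and so gains one power; the boundary
    term is made small by [subexp]. *)
Lemma genf_diff v c k : subexp v -> genf_le r v c k.+1 ->
  genf_le r (fun n => v n - sh v n) c k.
Proof.
move=> vs H e e0; have e4 : 0 < e / 4 by rewrite divr_gt0.
have [Q1 H1] := H _ e4; have [Q2 H2] := subexp_small vs r0 r1 e4.
exists (maxn Q1 Q2).+1 => -[//|Q]; rewrite ltnS geq_max => /andP[QQ1 QQ2] z zr.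
have -> : psum z (fun n => v n - sh v n) Q.+1 =
    (1 - z) *: psum z v Q.+1 + z *: (z ^+ Q *: v Q).
  have -> : psum z (fun n => v n - sh v n) Q.+1 = psum z v Q.+1 - psum z (sh v) Q.+1.
    by rewrite /psum -sumrB; apply: eq_bigr => i _; rewrite scalerBr.
  by rewrite psum_sh psumS; lin.
apply: le_trans (rnormD _ _) _; rewrite !rnormZ cabsX zr.
have z0 := cabs_1B_gt0 zr.
have z2 : cabs (1 - z) <= 2 by rewrite cabs_1B_le2 // zr ltW.
have A1 := ler_wpM2l (ltW z0) (H1 Q.+1 (leqW QQ1) z zr).
have E : cabs (1 - z) * (c / cabs (1 - z) ^+ k.+1) = c / cabs (1 - z) ^+ k.
  by rewrite exprS; field; rewrite expf_neq0 gt_eqF.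
rewrite mulrDr E in A1.
have A2 : cabs (1 - z) * (e / 4) <= 2 * (e / 4) by rewrite ler_wpM2r // ltW.
have A3 := H2 Q QQ2.
have A4 : r * (r ^+ Q * rnorm (v Q)) <= 1 * (r ^+ Q * rnorm (v Q)).
  by rewrite ler_wpM2r ?(ltW r1) // mulr_ge0 ?rnorm_ge0 // exprn_ge0 // ltW.
by lra.
Qed.

(** Inverting delta z - A costs one power of |1 - z|, by [res_le]. *)
Lemma genf_solve v g c k : bdf v g -> subexp v -> genf_le r g c k ->
  genf_le r v (M * c) k.+1.
Proof.
move=> vg vs H e e0; have r01 : 0 < 1 - r by rewrite subr_gt0.
(* 5 = 1 + 4: one [e'] from [g] and four from the boundary term, whose two coefficients are at most
   1 and 3 in modulus. *)
pose e' := e / (5 * (M / (1 - r)) + 1).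
have C0 : 0 <= M / (1 - r) by rewrite divr_ge0 // ltW.
have C1 : 0 < 5 * (M / (1 - r)) + 1 by lra.
have e'0 : 0 < e' by rewrite divr_gt0.
have [Q1 H1] := H _ e'0; have [Q2 H2] := subexp_small vs r0 r1 e'0.
exists (maxn Q1 Q2).+2 => -[//|[//|Q]]; rewrite !ltnS geq_max => /andP[QQ1 QQ2] z zr.
have z0 := cabs_1B_gt0 zr; have z1 : cabs z < 1 by rewrite zr.
have := res_le z1 (DA_psum z Q.+2 vg).1; rewrite (psum_bdf z Q vg).
have tl : rnorm (z ^+ Q.+2 *: tail z v Q) <= 4 * e'.
  have A1 := H2 Q QQ2; have A2 := H2 Q.+1 (leqW QQ2).
  have -> : z ^+ Q.+2 *: tail z v Q = (z ^+ 2 / 2) *: (z ^+ Q *: v Q) +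
      (z * (z / 2 - 2)) *: (z ^+ Q.+1 *: v Q.+1).
    by rewrite /tail !exprS; lin.
  apply: le_trans (rnormD _ _) _; rewrite !rnormZ (cabsM (z ^+ 2)) (cabsM z) !cabsX cabsV.
  have -> : cabs (2 : R[i]) = 2.
    by rewrite -(rmorph_nat (real_complex R)) cabsC ger0_norm.
  rewrite zr.
  have c1 : r ^+ 2 / 2 <= 1 by have : r ^+ 2 <= 1; [rewrite exprn_ile1 // ltW|lra].
  have c2 : r * cabs (z / 2 - 2) <= 3.
    have : cabs (z / 2 - 2) <= r / 2 + 2.
      apply: le_trans (cabsD _ _) _; rewrite cabsN cabsM cabsV zr.
      by rewrite -(rmorph_nat (real_complex R)) cabsC ger0_norm.
    by have := cabs_ge0 (z / 2 - 2); move: r0 r1; nra.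
  have p1 : 0 <= r ^+ Q * rnorm (v Q) by rewrite mulr_ge0 ?rnorm_ge0 ?exprn_ge0 // ltW.
  have p2 : 0 <= r ^+ Q.+1 * rnorm (v Q.+1) by rewrite mulr_ge0 ?rnorm_ge0 ?exprn_ge0 // ltW.
  have := ler_wpM2r p1 c1; have := ler_wpM2r p2 c2; lra.
have A1 := H1 Q.+2 (leqW (leqW QQ1)) z zr.
rewrite -ler_pdivlMl // => /le_trans; apply.
have -> : M * c / cabs (1 - z) ^+ k.+1 = (cabs (1 - z))^-1 * (M * (c / cabs (1 - z) ^+ k)).
  by rewrite exprS; field; rewrite expf_neq0 gt_eqF.
have A2 : rnorm (psum z g Q.+2 + z ^+ Q.+2 *: tail z v Q) <=
    c / cabs (1 - z) ^+ k + 5 * e'.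
  by apply: le_trans (rnormD _ _) _; lra.
have zi0 : 0 <= (cabs (1 - z))^-1 by rewrite invr_ge0 ltW.
apply: le_trans (ler_wpM2l zi0 (ler_wpM2l M0 A2)) _.
rewrite !mulrDr lerD2l.
have zi1 : (cabs (1 - z))^-1 <= (1 - r)^-1.
  by rewrite lef_pV2 ?posrE //; apply: cabs_1B; rewrite zr.
apply: (@le_trans _ _ ((1 - r)^-1 * (M * (5 * e')))).
  have e5 : 0 <= 5 * e' by rewrite mulr_ge0 // ltW.
  by rewrite ler_wpM2r // mulr_ge0.
have -> : (1 - r)^-1 * (M * (5 * e')) = (5 * (M / (1 - r))) * e' by ring.
by rewrite /e' mulrCA -[leRHS]mulr1 ler_pM2l // ler_pdivrMr // mul1r; lra.
Qed.

(** The order 2 is the one at which [sum_inv_sqr_dist] bounds the circular mean, by 3 / (1 - r). *)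
Lemma genf_coef v c n : 0 <= c -> genf_le r v c 2 -> r ^+ n * rnorm (v n) <= 3 * c / (1 - r).
Proof.
move=> c0 H; apply/ler_addgt0Pr => e e0; apply: (@le_of_linear _ _ 0).
have [Q0 HQ] := H e e0; pose Q := maxn Q0 n.+1.
have [q Hq] : exists q, forall L, (q <= L)%N -> r ^+ L <= 2^-1.
  have [q hq] := nat_gt (2 * (1 - r)^-1); exists q => L qL.
  have L0 : 0 < L.+1%:R :> R by [].
  rewrite -(ler_pM2l L0); apply: le_trans (natr_expr_le L (ltW r0) r1) _.
  rewrite -ler_pdivrMr // invrK mulrC; apply: ltW; apply: lt_le_trans hq _.
  by rewrite ler_nat leqW.
exists (maxn Q q) => L; rewrite geq_max addr0 => /andP[QL qL].
have nQL : (n < Q <= L)%N by rewrite QL andbT leq_maxr.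
have L0 : (0 < L)%N by apply: leq_trans QL; apply: leq_ltn_trans (leq_maxr _ _).
apply: le_trans (coef_le_mean v (ltW r0) nQL) _.
apply: (@le_trans _ _ (\sum_(j < L) (c * (cabs (1 - r%:C * unity L ^+ j) ^+ 2)^-1 + e))).
  apply: ler_sum => j _; apply: HQ; first exact: leq_maxl.
  by rewrite cabs_node // ltW.
rewrite big_split /= -mulr_sumr sumr_const card_ord mulrDr (mulr_natl e L) lerD2r.
have -> : L%:R * (3 * c / (1 - r)) = c * (3 * L%:R / (1 - r)) by ring.
rewrite ler_wpM2l //; apply: sum_inv_sqr_dist => //; last exact: Hq.
by rewrite (ltW r0) r1.
Qed.

End Circle.

Lemma bdf_ext v g h : g =1 h -> bdf v g -> bdf v h.
Proof. by move=> /funext ->. Qed.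

Lemma dseq_sh v n : dseq (sh v) n = v n + sh (dseq v) n.
Proof.
case: n => [|n]; rewrite /dseq /=; first by lin.
by rewrite -(natr1 n.+1); lin.
Qed.

(** The derivative of (delta - A) V = G is (delta - A) V' = G' + (2 - z) V. *)
Lemma bdf_dseq v g : bdf v g ->
  bdf (dseq v) (fun n => dseq g n + 2 *: v n - sh v n).
Proof.
move=> vg n; have [D E] := vg n.+1; have [DZ AZ] := DAZ n.+1%:R D.
split=> //; rewrite {4}/dseq AZ.
have -> : dseq g n = (3 / 2 : R[i]) *: dseq v n - 2 *: dseq (sh v) n +
     2^-1 *: dseq (sh (sh v)) n - (n.+1)%:R *: A (v n.+1).
  by rewrite {1}/dseq -E /dseq; lin.
rewrite !dseq_sh.
have -> : sh (dseq (sh v)) n = sh v n + sh (sh (dseq v)) n.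
  by case: n {D E DZ AZ} => [|n] /=; rewrite ?addr0 // dseq_sh.
by lin.
Qed.

Definition diff2 v : nat -> X := fun n => v n - 2 *: sh v n + sh (sh v) n.

(** Leibniz' rule for [diff2], which is multiplication by (1 - z)^2: the third derivative is (1 -
    z)^2 V''' - 6 (1 - z) V'' + 6 V'. The coefficients 1 give it the shape of two nested uses of
    [genf_lin]. *)
Lemma dseq3_diff2 v n : let y1 := dseq v in let y2 := dseq y1 in let y3 := dseq y2 in
  dseq (dseq (dseq (diff2 v))) n =
  1 *: (1 *: diff2 y3 n + (-6) *: (y2 n - sh y2 n)) + 6 *: y1 n.
Proof.
rewrite /diff2 /dseq; case: n => [|[|n]] /=; [by lin|by lin|].
by rewrite -!natr1; lin.
Qed.

(** For an impulse of norm 1, the bounds for V, V', V'', V''' have orders 1, 2, 3, 4 and constants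
    M, 3 M^2, [c2] and M (9 c2 + 18 M^2); Leibniz' rule weighs V', V'', V''' by 6, 6 and 1. *)
Definition kernel_const : R :=
  let c2 := M * (18 * M ^+ 2 + 2 * M) in
  M * (9 * c2 + 18 * M ^+ 2) + 6 * c2 + 18 * M ^+ 2.

(* The radius at which the [n]-th coefficient is read off. *)
Lemma radiusP (n : nat) (r := 1 - (2 * n.+1%:R)^-1 : R) :
  [/\ 0 < r, r < 1 & 2^-1 <= r ^+ n].
Proof.
have n1 : 1 <= n.+1%:R :> R by rewrite ler1n.
have i1 : 0 < (2 * n.+1%:R)^-1 :> R by rewrite invr_gt0 mulr_gt0.
have i2 : (2 * n.+1%:R)^-1 <= 2^-1 :> R by rewrite lef_pV2 ?posrE ?mulr_gt0 // ler_peMr.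
have [r0 r1] : 0 < r /\ r < 1.
  by rewrite /r; move: i1 i2; set i := (2 * _)^-1; split; lra.
split=> //; have B : forall m, (m <= n)%N -> 1 - m%:R / (2 * n.+1%:R) <= r ^+ m.
  elim=> [|m IH] mn; first by rewrite mul0r subr0 expr0.
  rewrite exprS; apply: le_trans (ler_wpM2l (ltW r0) (IH (ltnW mn))).
  rewrite -natr1 mulrDl mul1r /r; set i := (2 * n.+1%:R)^-1.
  have : 0 <= m%:R * i * i by rewrite !mulr_ge0 // ltW.
  by rewrite -/i in i1 *; nra.
apply: le_trans (B n (leqnn n)).
have : n%:R / (2 * n.+1%:R) <= 2^-1 :> R; last by set t := n%:R / _; lra.
by rewrite invfM mulrCA ler_piMr // ler_pdivrMr // mul1r ler_nat.
Qed.

Lemma diff2_tail v x n : bdf v (impulse x) ->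
  rnorm (diff2 v n.+3) <= 12 * kernel_const * rnorm x / (n.+2%:R * n.+3%:R).
Proof.
move=> vx; set xx := rnorm x.
have xx0 : 0 <= xx by rewrite rnorm_ge0.
pose y1 := dseq v; pose y2 := dseq y1; pose y3 := dseq y2.
have s0 : subexp v by apply: subexp_impulse vx.
have s1 : subexp y1 by apply: subexp_dseq.
have s2 : subexp y2 by apply: subexp_dseq.
have s3 : subexp y3 by apply: subexp_dseq.
(* Successive differentiation of (delta - A) V = x: the right-hand sides are (2 - z) V, then 2 (2 -
   z) V' - V, then 3 (2 - z) V'' - 3 V'. *)
have b1 : bdf y1 (fun m => 2 *: v m + (-1) *: sh v m).
  by apply: bdf_ext (bdf_dseq vx) => m; rewrite {1}/dseq /=; lin.
have b2 : bdf y2 (fun m => 1 *: (4 *: y1 m + (-2) *: sh y1 m) + (-1) *: v m).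
  apply: bdf_ext (bdf_dseq b1) => m /=.
  have -> : dseq (fun m => 2 *: v m + -1 *: sh v m) m = 2 *: y1 m - dseq (sh v) m.
    by rewrite /y1 /dseq; lin.
  by rewrite dseq_sh -/y1; lin.
have b3 : bdf y3 (fun m => 1 *: (6 *: y2 m + (-3) *: sh y2 m) + (-3) *: y1 m).
  apply: bdf_ext (bdf_dseq b2) => m /=.
  have -> : dseq (fun m => 1 *: (4 *: y1 m + -2 *: sh y1 m) + -1 *: v m) m =
      4 *: y2 m - 2 *: dseq (sh y1) m - y1 m.
    by rewrite /y2 /y1 /dseq; lin.
  by rewrite dseq_sh -/y2; lin.
pose r : R := 1 - (2 * n.+1%:R)^-1.
have [r0 r1 rn] := radiusP n; rewrite -/r in r0 r1 rn.
have cnat (m : nat) : cabs (m%:R : R[i]) = m%:R.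
  by rewrite -(rmorph_nat (real_complex R)) cabsC ger0_norm.
have g0 : genf_le r (impulse x) xx 0.
  by move=> e e0; exists 1%N => -[//|Q] _ z _; rewrite psum_impulse divr1 lerDl ltW.
have h0 := genf_solve r0 r1 vx s0 g0.
have h1 := genf_solve r0 r1 b1 s1 (genf_lin _ _ h0 (genf_sh r1 h0)).
rewrite !cabsN cabs1 !cnat in h1.
have c1 : 0 <= M * xx by rewrite mulr_ge0.
have h2 := genf_solve r0 r1 b2 s2 (genf_lin _ _
  (genf_lin _ _ h1 (genf_sh r1 h1)) (genf_raise r1 c1 h0)).
rewrite !cabsN cabs1 !cnat in h2.
have c2 : 0 <= M * (2 * (M * xx) + 1 * (M * xx)) by rewrite !(mulr_ge0, addr_ge0).
have h3 := genf_solve r0 r1 b3 s3 (genf_lin _ _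
  (genf_lin _ _ h2 (genf_sh r1 h2)) (genf_raise r1 c2 h1)).
rewrite !cabsN cabs1 !cnat in h3.
have sd : subexp (fun n => y3 n - sh y3 n).
  move=> s s_0 s_1; have [K HK] := s3 s s_0 s_1; exists (2 * `|K|) => m.
  have H m' : s ^+ m' * rnorm (y3 m') <= `|K| by apply: le_trans (HK m') (ler_norm K).
  have Hs : s ^+ m * rnorm (sh y3 m) <= `|K|.
    case: m => [|m]; first by rewrite rnorm0 mulr0.
    rewrite exprS -mulrA; apply: le_trans (H m); rewrite ler_piMl ?(ltW s_1) //.
    by rewrite mulr_ge0 ?rnorm_ge0 // exprn_ge0 // ltW.
  have sm : 0 <= s ^+ m by rewrite exprn_ge0 // ltW.
  apply: le_trans (ler_wpM2l sm (rnorm_triB _ _)) _; rewrite mulrDr.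
  by have := H m; lra.
have dE : (fun m => y3 m - sh y3 m - sh (fun k => y3 k - sh y3 k) m) =1 diff2 y3.
  by rewrite /diff2 => -[|m] /=; lin.
have h3' := genf_ext dE (genf_diff r0 r1 sd (genf_diff r0 r1 s3 h3)).
have h4 := genf_lin 1 6 (genf_lin 1 (-6) h3' (genf_diff r0 r1 s2 h2)) h1.
rewrite !cabsN cabs1 !cnat in h4.
have {h4}h5 := genf_ext (fun m => esym (dseq3_diff2 v m)) h4.
move: h5; set c := (X in genf_le _ _ X _) => h5.
have cE : c = kernel_const * xx by rewrite /c /kernel_const; ring.
have k0 : 0 <= kernel_const.
  by rewrite /kernel_const; rewrite !(mulr_ge0, addr_ge0, exprn_ge0).
have c0 : 0 <= c by rewrite cE mulr_ge0.
(* The left side carries (n + 1)(n + 2)(n + 3), and 1 / (1 - r) = 2 (n + 1) cancels the first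
   factor. The constant is 12 = 3 * 2 * 2, the last 2 from r^n >= 1/2. *)
have := genf_coef r0 r1 n c0 h5.
have -> : 1 - r = (2 * n.+1%:R)^-1 by rewrite /r; ring.
rewrite invrK.
rewrite {1}/dseq rnormZ {1}/dseq rnormZ {1}/dseq rnormZ !cnat.
set t := rnorm _ => Ht.
have t0 : 0 <= t by rewrite rnorm_ge0.
have p3 : 0 < n.+1%:R * (n.+2%:R * n.+3%:R) :> R by rewrite !mulr_gt0.
rewrite ler_pdivlMr ?mulr_gt0 //.
have T : 2^-1 * (n.+1%:R * (n.+2%:R * (n.+3%:R * t))) <= 3 * c * (2 * n.+1%:R).
  by apply: le_trans Ht; rewrite ler_wpM2r // !mulr_ge0.
have nn : 0 < n.+1%:R :> R by [].
rewrite -(ler_pM2l nn) -(ler_pM2l (x := 2^-1)) ?invr_gt0 //.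
have -> : 2^-1 * (n.+1%:R * (12 * kernel_const * xx)) = 6 * (kernel_const * xx) * n.+1%:R.
  by field.
rewrite -cE.
have -> : 2^-1 * (n.+1%:R * (t * (n.+2%:R * n.+3%:R))) =
  2^-1 * (n.+1%:R * (n.+2%:R * (n.+3%:R * t))) by ring.
by apply: le_trans T _; lra.
Qed.

Lemma impulse_le v x n : bdf v (impulse x) -> rnorm (v n) <= 4 * M * n.+1%:R * rnorm x.
Proof.
move=> vx; have [r0 r1 rn] := radiusP n.
have := impulse_bound n vx r0 r1; rewrite subKr invrK => H.
rewrite -(ler_pM2l (x := 2^-1)) ?invr_gt0 //.
apply: (@le_trans _ _ (M * (2 * n.+1%:R) * rnorm x)).
  by apply: le_trans H; rewrite ler_wpM2r ?rnorm_ge0.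
have : 0 <= M * n.+1%:R * rnorm x by rewrite !mulr_ge0 ?rnorm_ge0.
by lra.
Qed.

(** The third derivative erases the first three coefficients, so these are bounded through
    [impulse_le]; 48 M covers the worst of them, 12 M + 16 M + 4 M at index 2. The others are
    multiples of 1 / (m + 2) - 1 / (m + 3), which telescopes. *)
Definition kernel_maj (n : nat) : R :=
  if n is m.+3 then 12 * kernel_const / (m.+2%:R * m.+3%:R) else 48 * M.

Lemma kernel_const_ge0 : 0 <= kernel_const.
Proof. by rewrite /kernel_const !(mulr_ge0, addr_ge0, exprn_ge0). Qed.

Lemma kernel_maj_ge0 n : 0 <= kernel_maj n.
Proof.
by case: n => [|[|[|n]]]; rewrite /kernel_maj ?divr_ge0 ?mulr_ge0 ?kernel_const_ge0.
Qed.

Lemma sum_kernel_maj N : \sum_(n < N) kernel_maj n <= 144 * M + 6 * kernel_const.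
Proof.
have k0 := kernel_const_ge0.
apply: (@le_trans _ _ (\sum_(n < N.+3) kernel_maj n)).
  rewrite -!(big_mkord xpredT kernel_maj).
  rewrite (@big_cat_nat _ _ _ N 0 N.+3) ?leqW //= lerDl sumr_ge0 // => i _.
  exact: kernel_maj_ge0.
have -> : \sum_(n < N.+3) kernel_maj n = 144 * M + 12 * kernel_const * (2^-1 - N.+2%:R^-1).
  rewrite !big_ord_recl /= /bump /=.
  have -> : \sum_(i < N) kernel_maj (1 + (1 + (1 + i))) =
      12 * kernel_const * (2^-1 - N.+2%:R^-1).
    elim: N => [|N IH]; first by rewrite big_ord0 subrr mulr0.
    rewrite big_ord_recr /= IH /kernel_maj /=; field.
    by rewrite !(addrC 3) !(addrC 2) -!natrD !pnatr_eq0 ?addn2 ?addn3.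
  by rewrite /kernel_maj; ring.
have : 0 <= kernel_const * N.+2%:R^-1 by rewrite mulr_ge0.
by set i := N.+2%:R^-1; lra.
Qed.

Lemma diff2_impulse v x n : bdf v (impulse x) ->
  rnorm (diff2 v n) <= kernel_maj n * rnorm x.
Proof.
move=> vx; case: n => [|[|[|n]]]; last first.
  by have := diff2_tail n vx; rewrite /kernel_maj mulrAC.
all: have v0 := impulse_le 0 vx; have v1 := impulse_le 1 vx; have v2 := impulse_le 2 vx.
all: have xM : 0 <= M * rnorm x by rewrite mulr_ge0 ?rnorm_ge0.
all: apply: le_trans (rnormD _ _) _; apply: le_trans (lerD (rnorm_triB _ _) (lexx _)) _.
all: rewrite rnormZ -(rmorph_nat (real_complex R)) cabsC ger0_norm //= ?rnorm0.
all: by lra.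
Qed.

(** Discrete Duhamel principle, by induction: the response to the impulse [g 0] is subtracted; the
    difference vanishes at 0 and, shifted by one index, solves the scheme for the shifted data. Only
    norms of impulse responses enter, no operator-valued kernel. *)
Lemma diff2_conv u g n : bdf u g ->
  rnorm (diff2 u n) <= \sum_(m < n.+1) kernel_maj (n - m) * rnorm (g m).
Proof.
elim: n u g => [|n IH] u g ug.
all: have [y yg] := bdf_exists (impulse (g 0%N)).
all: pose w k := u k - y k.
all: have wg : bdf w (fun k => g k - impulse (g 0%N) k).
1,3: move=> k; have [D E] := ug k; have [D' E'] := yg k; have [DB AB] := DAB D D'.
1,2: split=> //; rewrite -E -E' AB /w.
1,2: case: k {D E D' E' DB AB} => [|[|k]] /=; by lin.
all: have w0 : w 0%N = 0 by apply: (bdf_uniq0 wg); rewrite /= subrr.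
  rewrite big_ord1 subnn; have -> : diff2 u 0 = diff2 y 0 by rewrite /diff2 /= (subr0_eq w0).
  exact: diff2_impulse.
have w'g : bdf (fun k => w k.+1) (fun k => g k.+1).
  move=> k; have [D E] := wg k.+1; rewrite /= subr0 in E; split=> //.
  by rewrite -E; case: k {D E} => [|[|k]] /=; rewrite ?w0.
have -> : diff2 u n.+1 = diff2 y n.+1 + diff2 (fun k => w k.+1) n.
  have uE k : u k = y k + w k by rewrite /w addrC subrK.
  by rewrite /diff2; case: n {IH} => [|[|n]] /=; rewrite !uE ?w0; lin.
apply: le_trans (rnormD _ _) _; rewrite big_ord_recl /=; apply: lerD.
  exact: diff2_impulse.
apply: le_trans (IH _ _ w'g) _; apply: ler_sum => i _.
by rewrite /bump /= add1n subSS.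
Qed.

End BDF2Kernel.

(** * Semigroups and resolvents *)

Section UniformBoundedness.
Context {R : realType} {X : completeNormedModType R[i]}.
Local Ltac lin := linear_with (R[i]) X ltac:(first [by ring | by field]).

Definition linear_op (f : X -> X) : Prop :=
  forall (a b : R[i]) x y, f (a *: x + b *: y) = a *: f x + b *: f y.

Lemma linear_opB f x y : linear_op f -> f (x - y) = f x - f y.
Proof. by move=> lf; have := lf 1 (-1) x y; rewrite !scale1r !scaleN1r. Qed.

Lemma linear_opZ f (a : R[i]) x : linear_op f -> f (a *: x) = a *: f x.
Proof. by move=> lf; have := lf a 0 x x; rewrite !scale0r !addr0. Qed.

Lemma linear_op0 f : linear_op f -> f 0 = 0.
Proof. by move=> lf; have := linear_opZ 0 0 lf; rewrite !scale0r. Qed.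

Lemma opnorm_exists (f : X -> X) (K : R) : linear_op f ->
  (forall x, rnorm (f x) <= K * rnorm x) ->
  exists o : R, [/\ 0 <= o, forall x, rnorm (f x) <= o * rnorm x &
    exists2 v, rnorm v <= 1 & 2 / 3 * o <= rnorm (f v)].
Proof.
move=> lf fK; pose E := [set rnorm (f v) | v in [set v | rnorm v <= 1]].
have E0 : E 0 by exists 0; rewrite /= ?rnorm0 ?ler01 // linear_op0 // rnorm0.
have ubE : ubound E `|K|.
  move=> _ [v /= v1 <-]; apply: le_trans (fK v) _.
  by apply: le_trans (ler_wpM2r (rnorm_ge0 v) (ler_norm K)) _; rewrite ler_piMr.
have hE : has_sup E by split; [exists 0|exists `|K|].
have le_sup r : E r -> r <= sup E by apply: ub_le_sup; case: hE.
have o0 := le_sup _ E0; exists (sup E); split=> //.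
  move=> x; have [x0|x0] := eqVneq (rnorm x) 0.
    by rewrite (rnorm_eq0 x0) linear_op0 // !rnorm0 mulr0.
  have xp : 0 < rnorm x by rewrite lt_neqAle eq_sym x0 rnorm_ge0.
  rewrite -ler_pdivrMr //; apply: le_sup; exists ((rnorm x)^-1%:C *: x).
    by rewrite /= rnormZr gtr0_norm ?invr_gt0 // mulVf.
  by rewrite linear_opZ // rnormZr gtr0_norm ?invr_gt0 // mulrC.
have [sE0|sE0] := eqVneq (sup E) 0.
  by exists 0; rewrite ?rnorm0 ?ler01 // sE0 mulr0 rnorm_ge0.
have op : 0 < sup E by rewrite lt_neqAle eq_sym sE0.
have e3 : 0 < sup E / 3 by rewrite divr_gt0.
by have [_ [v v1 <-] vlt] := sup_adherent e3 hE; exists v => //; lra.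
Qed.

(* Sokal's elementary proof: a sequence moving by [3^-k] at the step [k]
   along directions that almost attain operator norms larger than [4^k]. *)
Lemma uniform_boundedness (U : nat -> X -> X) :
  (forall n, linear_op (U n)) ->
  (forall n, exists K : R, forall x, rnorm (U n x) <= K * rnorm x) ->
  (forall x, exists B : R, forall n, rnorm (U n x) <= B) ->
  exists B : R, forall n x, rnorm (U n x) <= B * rnorm x.
Proof.
move=> lU bU pU; apply: contrapT => nB.
have /choice[nrm nrmP] (n : nat) : exists o : R, [/\ 0 <= o, forall x, rnorm (U n x) <= o * rnorm x &
    exists2 v, rnorm v <= 1 & 2 / 3 * o <= rnorm (U n v)].
  by have [K HK] := bU n; apply: opnorm_exists HK.
have /choice[s sP] (k : nat) : exists n, 4 ^+ k < nrm n.
  apply: contrapT => nk; apply: nB; exists (4 ^+ k) => n x.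
  have [_ H _] := nrmP n; apply: le_trans (H x) _; rewrite ler_wpM2r ?rnorm_ge0 //.
  by rewrite leNgt; apply/negP => lt; apply: nk; exists n.
have /choice[next nextP] (kx : nat * X) : exists x',
    rnorm (x' - kx.2) <= 3 ^- kx.1 /\ 2 / 3 * 3 ^- kx.1 * nrm (s kx.1) <= rnorm (U (s kx.1) x').
  case: kx => k x /=; have [p0 _ [v v1 vo]] := nrmP (s k).
  have t0 : 0 < 3 ^- k :> R by rewrite invr_gt0 exprn_gt0.
  pose w : X := (3 ^- k)%:C *: v.
  have wn : rnorm w <= 3 ^- k by rewrite rnormZr gtr0_norm // ler_piMr // ltW.
  (* The images of x + w and x - w differ by that of 2 w, so one of the two is large. *)
  have big : 2 * (2 / 3 * 3 ^- k * nrm (s k)) <=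
      rnorm (U (s k) (x + w)) + rnorm (U (s k) (x - w)).
    have -> : 2 * (2 / 3 * 3 ^- k * nrm (s k)) = 2 * (3 ^- k * (2 / 3 * nrm (s k))) by ring.
    apply: (@le_trans _ _ (2 * (3 ^- k * rnorm (U (s k) v)))).
      by rewrite ler_pM2l // ler_pM2l.
    have -> : 2 * (3 ^- k * rnorm (U (s k) v)) = rnorm (U (s k) (x + w) - U (s k) (x - w)).
      rewrite -linear_opB //.
      have -> : x + w - (x - w) = (2 * 3 ^- k)%:C *: v by rewrite /w rmorphM /= rmorph_nat; lin.
      by rewrite linear_opZ // rnormZr gtr0_norm ?mulr_gt0 // mulrA.
    exact: rnorm_triB.
  have [le|lt] := lerP (2 / 3 * 3 ^- k * nrm (s k)) (rnorm (U (s k) (x + w))).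
    by exists (x + w); split=> //; rewrite addrC addKr.
  exists (x - w); split; last by lra.
  by rewrite addrC addKr rnormN.
pose xs := fix xs k := if k is k'.+1 then next (k', xs k') else 0.
have d1 k : rnorm (xs k.+1 - xs k) <= 3 ^- k by have [] := nextP (k, xs k).
have d2 k m : rnorm (xs (k + m)%N - xs k) <= 3 / 2 * 3 ^- k * (1 - 3 ^- m).
  elim: m => [|m IH]; first by rewrite addn0 subrr rnorm0 expr0 invr1 subrr mulr0.
  rewrite addnS; apply: le_trans (rnorm_tri (xs (k + m)%N) _ _) _.
  apply: le_trans (lerD (d1 _) IH) _; rewrite exprD exprS.
  have t0 : 0 < 3 ^+ k :> R by rewrite exprn_gt0.
  have u0 : 0 < 3 ^+ m :> R by rewrite exprn_gt0.
  by rewrite le_eqVlt; apply/orP; left; apply/eqP; field; rewrite !gt_eqF.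
have d3 k m : (k <= m)%N -> rnorm (xs m - xs k) <= 3 / 2 * 3 ^- k.
  move=> km; rewrite -(subnKC km); apply: le_trans (d2 _ _) _.
  by rewrite ler_piMr ?mulr_ge0 ?invr_ge0 ?exprn_ge0 // gerBl invr_ge0 exprn_ge0.
have small (e : R) : 0 < e -> exists k, 3 / 2 * 3 ^- k < e.
  move=> e0; have [n Hn] := nat_gt (3 / 2 / e); exists n.
  rewrite ltr_pdivrMr ?exprn_gt0 // [ltRHS]mulrC -ltr_pdivrMr //; apply: lt_le_trans Hn _.
  elim: n => // n IH; rewrite -natr1 exprS; have : 1 <= 3 ^+ n :> R.
    by rewrite exprn_ege1 // ler1n.
  by lra.
have [x xlim] : exists x : X, xs n @[n --> \oo] --> x.
  apply: cauchy_rnorm => e e0; have e2 : 0 < e / 2 by rewrite divr_gt0.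
  have [k Hk] := small _ e2; exists k => m n km kn.
  apply: le_lt_trans (rnorm_tri (xs k) _ _) _; rewrite (rdistC (xs k)).
  by have := d3 _ _ km; have := d3 _ _ kn; lra.
have d4 k : rnorm (x - xs k) <= 3 / 2 * 3 ^- k.
  apply/ler_addgt0Pr => e e0; have [N HN] := (cvg_seq_rnormP _ _).1 xlim e e0.
  apply: le_trans (rnorm_tri (xs (maxn N k)) _ _) _; rewrite addrC.
  apply: lerD; first by apply: d3; apply: leq_maxr.
  by apply: ltW; rewrite rdistC; apply: HN; apply: leq_maxl.
have [B HB] := pU x.
(* At stage k the image has norm at least (2/3) 3^-k [nrm], and all later moves amount to at most
   (1/2) 3^-k, leaving (1/6) 3^-k 4^k. *)
have low k : 6^-1 * (4 / 3) ^+ k <= B.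
  have [_ H _] := nrmP (s k); have [_ H2] := nextP (k, xs k).
  rewrite -/(xs k.+1) /= in H2.
  have := H (x - xs k.+1); rewrite linear_opB // => H3.
  have H4 : nrm (s k) * rnorm (x - xs k.+1) <= nrm (s k) * (3 / 2 * 3 ^- k.+1).
    by rewrite ler_wpM2l ?d4 //; have [] := nrmP (s k).
  have H5 := rnormB (U (s k) (xs k.+1)) (U (s k) x); rewrite rdistC in H5.
  apply: le_trans (HB (s k)).
  have t0 : 0 < 3 ^- k :> R by rewrite invr_gt0 exprn_gt0.
  have E : 3 / 2 * 3 ^- k.+1 = 2^-1 * 3 ^- k :> R.
    by rewrite exprS; field; rewrite expf_neq0.
  rewrite E in H4; rewrite expr_div_n.
  have H6 : 3 ^- k * 4 ^+ k <= 3 ^- k * nrm (s k) by rewrite ler_pM2l // ltW.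
  by lra.
have [n Hn] := nat_gt (18 * B).
suff : n%:R / 3 <= (4 / 3) ^+ n :> R by have := low n; lra.
elim: n {Hn} => [|n IH]; first by rewrite mul0r expr0.
rewrite -natr1 exprS; have : 1 <= (4 / 3 : R) ^+ n.
  by rewrite exprn_ege1 // ler_pdivlMr // mul1r ler_nat.
by lra.
Qed.

End UniformBoundedness.

(** The semigroup on real times, with limits spelled out by real [e] and [d]. Of analyticity,
    [sg_smooth] is kept, whence the density of [DA]. *)
Record semigroup_spec (R : realType) (X : completeNormedModType R[i])
    (S : R -> X -> X) (DA : set X) (A : X -> X) : Prop := {
  sg_lin : forall t, linear_op (S t);
  sg0 : forall x, S 0 x = x;
  sgD : forall t s x, 0 <= t -> 0 <= s -> S (t + s) x = S t (S s x);
  sg_bnd : forall t, 0 <= t -> exists K : R, forall x, rnorm (S t x) <= K * rnorm x;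
  sg_cont : forall x (e : R), 0 < e ->
    exists2 d : R, 0 < d & forall t, 0 <= t <= d -> rnorm (S t x - x) <= e;
  sg_gen : forall x y, (DA x /\ A x = y) <-> (forall e : R, 0 < e ->
    exists2 d : R, 0 < d & forall t, 0 < t <= d ->
      rnorm ((t^-1)%:C *: (S t x - x) - y) <= e);
  sg_smooth : forall t x, 0 < t -> DA (S t x) }.

(** * Orbits of a strongly continuous semigroup *)

Section Semigroup.
Context {R : realType} {X : completeNormedModType R[i]}.
Context {S : R -> X -> X} {DA : set X} {A : X -> X}.
Context (sg : semigroup_spec S DA A).
Local Ltac lin := linear_with (R[i]) X ltac:(first [by ring | by field]).
Let SB := fun t x y => linear_opB x y (sg_lin sg t).
Let SZ := fun t a x => linear_opZ a x (sg_lin sg t).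

(** Otherwise there are t_n -> 0 with operator norms above n, against uniform boundedness: strong
    continuity bounds every orbit near 0. *)
Lemma sg_bounded_near0 : exists2 d : R, 0 < d &
  exists K : R, forall t x, 0 <= t <= d -> rnorm (S t x) <= K * rnorm x.
Proof.
apply: contrapT => H.
have /choice[t tP] (n : nat) : exists t : R, 0 <= t <= n.+1%:R^-1 /\
    exists x, n%:R * rnorm x < rnorm (S t x).
  apply: contrapT => Hn; apply: H; exists (n.+1%:R^-1); first by rewrite invr_gt0.
  exists n%:R => t x t01; rewrite leNgt; apply/negP => lt.
  by apply: Hn; exists t; split=> //; exists x.
have [|n|x|B HB] := @uniform_boundedness R X (fun n => S (t n)).
- by move=> n; apply: (sg_lin sg).
- by apply: (sg_bnd sg); have [/andP[]] := tP n.
- have [d d0 Hd] := sg_cont sg x ltr01; have [N HN] := nat_gt d^-1.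
  have near n : (N <= n)%N -> rnorm (S (t n) x) <= 1 + rnorm x.
    move=> Nn; have [/andP[t0 tn] _] := tP n.
    have := Hd (t n); have := rnormB (S (t n) x) x => Hb Hd'.
    suff : rnorm (S (t n) x - x) <= 1 by lra.
    apply: Hd'; rewrite t0 /=; apply: le_trans tn _.
    rewrite invf_ple ?posrE //; apply: ltW; apply: lt_le_trans HN _.
    by rewrite ler_nat leqW.
  exists (1 + rnorm x + \sum_(i < N) rnorm (S (t i) x)) => n.
  have s0 : 0 <= \sum_(i < N) rnorm (S (t i) x) by apply: sumr_ge0 => i _; apply: rnorm_ge0.
  have [Nn|nN] := leqP N n; first by have := near n Nn; lra.
  have : rnorm (S (t n) x) <= \sum_(i < N) rnorm (S (t i) x).
    rewrite (bigD1 (Ordinal nN)) //= lerDl; apply: sumr_ge0 => i _; exact: rnorm_ge0.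
  by have := rnorm_ge0 x; lra.
have [n Hn] := nat_gt B; have [_ [x]] := tP n; apply/negP; rewrite -leNgt.
by apply: le_trans (HB n x) _; rewrite ler_wpM2r ?rnorm_ge0 // ltW.
Qed.

Lemma sg_bounded (T : R) : exists2 K : R, 1 <= K &
  forall t x, 0 <= t <= T -> rnorm (S t x) <= K * rnorm x.
Proof.
have [d d0 [K HK]] := sg_bounded_near0.
pose K1 := `|K| + 1; have K1p : 1 <= K1 by rewrite lerDr.
have HK1 t x : 0 <= t <= d -> rnorm (S t x) <= K1 * rnorm x.
  move=> td; apply: le_trans (HK t x td) _; rewrite ler_wpM2r ?rnorm_ge0 //.
  by have := ler_norm K; rewrite /K1; lra.
have P n : forall t x, 0 <= t <= n%:R * d -> rnorm (S t x) <= K1 ^+ n * rnorm x.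
  elim: n => [|n IH] t x /andP[t0 tn].
    have -> : t = 0 by apply/le_anti; rewrite t0 -(mul0r d) andbT.
    by rewrite (sg0 sg) mul1r.
  have [td|dt] := lerP t d.
    apply: le_trans (HK1 t x _) _; first by rewrite t0.
    rewrite ler_wpM2r ?rnorm_ge0 // exprS ler_peMr ?exprn_ege1 //.
    exact: le_trans ler01 _.
  have td : 0 <= t - d by rewrite subr_ge0 ltW.
  rewrite -(subrK d t) (sgD sg) ?(ltW d0) //.
  have tn' : 0 <= t - d <= n%:R * d.
    by rewrite td; move: tn; rewrite -natr1 mulrDl mul1r; lra.
  apply: le_trans (IH _ _ tn') _; rewrite exprSr -mulrA ler_wpM2l ?exprn_ge0 //.
    exact: le_trans ler01 _.
  by apply: HK1; rewrite lexx ltW.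
have [n Hn] := nat_gt (T / d); exists (K1 ^+ n); first exact: exprn_ege1.
move=> t x /andP[t0 tT]; apply: P; rewrite t0 /=; apply: le_trans tT _.
by rewrite -ler_pdivrMr // ltW.
Qed.

Lemma gen_lin (a b : R[i]) x y : DA x -> DA y ->
  DA (a *: x + b *: y) /\ A (a *: x + b *: y) = a *: A x + b *: A y.
Proof.
move=> Dx Dy; apply/(sg_gen sg) => e e0.
have ab : 0 < cabs a + cabs b + 1 by rewrite ltr_wpDl ?addr_ge0 ?cabs_ge0.
have e'0 : 0 < e / (cabs a + cabs b + 1) by rewrite divr_gt0.
have [d1 d10 H1] := (sg_gen sg x (A x)).1 (conj Dx erefl) _ e'0.
have [d2 d20 H2] := (sg_gen sg y (A y)).1 (conj Dy erefl) _ e'0.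
exists (Num.min d1 d2); first by rewrite lt_min d10.
move=> t; rewrite le_min => /andP[t0 /andP[td1 td2]].
have {}H1 := H1 t; have {}H2 := H2 t; rewrite t0 td1 td2 in H1 H2.
have -> : (t^-1)%:C *: (S t (a *: x + b *: y) - (a *: x + b *: y)) - (a *: A x + b *: A y) =
   a *: ((t^-1)%:C *: (S t x - x) - A x) + b *: ((t^-1)%:C *: (S t y - y) - A y).
  by rewrite (sg_lin sg); lin.
apply: le_trans (rnormD _ _) _; rewrite !rnormZ.
have := ler_wpM2l (cabs_ge0 a) (H1 isT); have := ler_wpM2l (cabs_ge0 b) (H2 isT).
have : (cabs a + cabs b) * (e / (cabs a + cabs b + 1)) <= e.
  by rewrite mulrCA -[leRHS]mulr1 ler_pM2l // ler_pdivrMr // mul1r; lra.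
by rewrite mulrDl; lra.
Qed.

Lemma gen_comm t x : 0 <= t -> DA x -> DA (S t x) /\ A (S t x) = S t (A x).
Proof.
move=> t0 Dx; apply/(sg_gen sg) => e e0; have [K HK] := sg_bnd sg t0.
have K1 : 0 < `|K| + 1 by rewrite ltr_wpDl.
have e'0 : 0 < e / (`|K| + 1) by rewrite divr_gt0.
have [d d0 Hd] := (sg_gen sg x (A x)).1 (conj Dx erefl) _ e'0.
exists d => // s sd; have /andP[s0 _] := sd.
have -> : (s^-1)%:C *: (S s (S t x) - S t x) - S t (A x) =
    S t ((s^-1)%:C *: (S s x - x) - A x).
  have C : S s (S t x) = S t (S s x) by rewrite -!(sgD sg) ?(ltW s0) // addrC.
  by rewrite SB SZ SB C.
apply: le_trans (HK _) _; apply: le_trans (ler_wpM2r (rnorm_ge0 _) (ler_norm K)) _.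
apply: (@le_trans _ _ (`|K| * (e / (`|K| + 1)))); first by rewrite ler_wpM2l ?Hd.
by rewrite mulrCA -[leRHS]mulr1 ler_pM2l // ler_pdivrMr // mul1r; lra.
Qed.

Lemma telescope_orbit x (d : R) n : 0 <= d ->
  S (n%:R * d) x - x = \sum_(0 <= k < n) S (k%:R * d) (S d x - x).
Proof.
move=> d0; elim: n => [|n IH]; first by rewrite mul0r (sg0 sg) subrr big_geq.
rewrite big_nat_recr //= -IH SB -(sgD sg) ?mulr_ge0 // -natr1 mulrDl mul1r.
by rewrite [RHS]addrC subrKA.
Qed.

(** S T x - x is the integral of S t (A x), expressed here by its Riemann sums. Each increment of
    the telescoping sum is an image of S s x - x, so the error of a single difference quotient, at
    [x], controls all of them. *)
Lemma orbit_riemann x (T e : R) : 0 < T -> 0 < e -> DA x ->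
  exists N, forall n, (N <= n)%N -> (0 < n)%N ->
    rnorm (S T x - x - (T / n%:R)%:C *: \sum_(0 <= k < n) S (k%:R * (T / n%:R)) (A x)) <= e.
Proof.
move=> T0 e0 Dx; have [K K1 HK] := sg_bounded T.
have K0 : 0 < K by apply: lt_le_trans K1.
have e'0 : 0 < e / (T * K) by rewrite divr_gt0 // mulr_gt0.
have [d d0 Hd] := (sg_gen sg x (A x)).1 (conj Dx erefl) _ e'0.
have [N HN] := nat_gt (T / d); exists N => n Nn n0.
have nR : 0 < n%:R :> R by rewrite ltr0n.
pose s := T / n%:R; rewrite -/s; have s0 : 0 < s by rewrite divr_gt0.
have sd : s <= d.
  rewrite /s ler_pdivrMr // mulrC -ler_pdivrMr //; apply: ltW.
  by apply: lt_le_trans HN _; rewrite ler_nat.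
have -> : T = n%:R * s by rewrite /s mulrCA divff ?gt_eqF // mulr1.
rewrite telescope_orbit ?(ltW s0) //.
have -> : \sum_(0 <= k < n) S (k%:R * s) (S s x - x) -
    s%:C *: \sum_(0 <= k < n) S (k%:R * s) (A x) =
    s%:C *: \sum_(0 <= k < n) S (k%:R * s) ((s^-1)%:C *: (S s x - x) - A x).
  rewrite !scaler_sumr -sumrB; apply: eq_bigr => k _.
  have sC : s%:C != 0 :> R[i] by rewrite -cabs_gt0 cabsC gtr0_norm.
  by rewrite [in RHS]SB SZ scalerBr scalerA fmorphV divff // scale1r.
rewrite rnormZr gtr0_norm //.
apply: (@le_trans _ _ (s * \sum_(0 <= k < n) (K * (e / (T * K))))).
  rewrite ler_pM2l //; apply: le_trans (rnorm_sum _ _ _) _.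
  rewrite !big_nat; apply: ler_sum => k /andP[_ kn].
  apply: le_trans (HK _ _ _) _; last first.
    by rewrite ler_pM2l // Hd // s0.
  rewrite mulr_ge0 ?(ltW s0) //= /s mulrCA -[leRHS]mulr1 ler_pM2l // ler_pdivrMr //.
  by rewrite mul1r ler_nat ltnW.
rewrite sumr_const_nat subn0 -mulr_natl /s.
by rewrite le_eqVlt; apply/orP; left; apply/eqP; field; rewrite !gt_eqF.
Qed.

Lemma orbit_increment x (T e : R) : 0 < T -> DA x ->
  (forall t, 0 <= t <= T -> rnorm (S t (A x) - A x) <= e) ->
  rnorm (S T x - x - T%:C *: A x) <= T * e.
Proof.
move=> T0 Dx H; apply/ler_addgt0Pr => h h0; have [N HN] := orbit_riemann T0 h0 Dx.
have n0 : (0 < N.+1)%N by []; have := HN N.+1 (leqnSn N) n0.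
have nR : 0 < N.+1%:R :> R by [].
set s := T / _; set V := s%:C *: _ => H1.
have s0 : 0 < s by rewrite divr_gt0.
have H2 : rnorm (V - T%:C *: A x) <= T * e.
  have -> : V - T%:C *: A x = s%:C *: \sum_(0 <= k < N.+1) (S (k%:R * s) (A x) - A x).
    rewrite sumrB scalerBr sumr_const_nat subn0 -scaler_nat scalerA; congr (_ - _ *: _).
    rewrite -(rmorph_nat (real_complex R)) -rmorphM /= /s; congr (_%:C).
    by field; rewrite gt_eqF.
  rewrite rnormZr gtr0_norm //.
  apply: (@le_trans _ _ (s * \sum_(0 <= k < N.+1) e)).
    rewrite ler_pM2l //; apply: le_trans (rnorm_sum _ _ _) _.
    rewrite !big_nat; apply: ler_sum => k /andP[_ kn]; apply: H.
    rewrite mulr_ge0 ?(ltW s0) //= /s mulrCA -[leRHS]mulr1 ler_pM2l // ler_pdivrMr //.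
    by rewrite mul1r ler_nat ltnW.
  rewrite sumr_const_nat subn0 -mulr_natl /s.
  by rewrite le_eqVlt; apply/orP; left; apply/eqP; field; rewrite gt_eqF.
have -> : S T x - x - T%:C *: A x = (S T x - x - V) + (V - T%:C *: A x) by lin.
by apply: le_trans (rnormD _ _) _; rewrite addrC lerD.
Qed.

(** [orbit_increment] passes to the limit in [u n], whereas the difference quotients in [sg_gen]
    need not converge uniformly in n. *)
Lemma gen_closed (u : nat -> X) x y : (forall n, DA (u n)) ->
  u n @[n --> \oo] --> x -> A (u n) @[n --> \oo] --> y -> DA x /\ A x = y.
Proof.
move=> Du ux Auy; apply/(sg_gen sg) => e e0; have [K K1 HK] := sg_bounded 1.
have e2 : 0 < e / 2 by rewrite divr_gt0.
have [d d0 Hd] := sg_cont sg y e2; exists (Num.min d 1); first by rewrite lt_min d0 ltr01.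
move=> t; rewrite le_min => /andP[t0 /andP[td t1]].
have tE : (t^-1)%:C *: (S t x - x) - y = (t^-1)%:C *: (S t x - x - t%:C *: y).
  have tC : t%:C != 0 :> R[i] by rewrite -cabs_gt0 cabsC gtr0_norm.
  by rewrite [in RHS]scalerBr scalerA fmorphV mulVf // scale1r.
rewrite tE rnormZr gtr0_norm ?invr_gt0 // ler_pdivrMl //.
pose h := t * (e / 2) / (3 * (K + 1)).
have h0 : 0 < h by rewrite !(divr_gt0, mulr_gt0) //; lra.
have [N1 H1] := (cvg_seq_rnormP _ _).1 ux h h0.
have [N2 H2] := (cvg_seq_rnormP _ _).1 Auy h h0.
pose n := maxn N1 N2.
have {}H1 := ltW (H1 n (leq_maxl _ _)); have {}H2 := ltW (H2 n (leq_maxr _ _)).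
have I : rnorm (S t (u n) - u n - t%:C *: A (u n)) <= t * ((K + 1) * h + e / 2).
  apply: orbit_increment => // s /andP[s0 st].
  have -> : S s (A (u n)) - A (u n) = S s (A (u n) - y) + (S s y - y) - (A (u n) - y).
    by rewrite SB; lin.
  apply: le_trans (rnorm_triB _ _) _; apply: le_trans (lerD (rnormD _ _) (lexx _)) _.
  have sK : 0 <= s <= 1 by rewrite s0 (le_trans st).
  have := HK s (A (u n) - y) sK; have : rnorm (S s y - y) <= e / 2.
    by apply: Hd; rewrite s0 (le_trans st).
  have := ler_wpM2l (le_trans ler01 K1) H2; lra.
have -> : S t x - x - t%:C *: y = (S t (u n) - u n - t%:C *: A (u n)) -
    (S t (u n - x) - (u n - x) - t%:C *: (A (u n) - y)).
  by rewrite SB; lin.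
apply: le_trans (rnorm_triB _ _) _; apply: le_trans (lerD (lexx _) (rnorm_triB _ _)) _.
apply: le_trans (lerD I (lerD (rnorm_triB _ _) (lexx _))) _.
rewrite rnormZr gtr0_norm //.
have tK : 0 <= t <= 1 by rewrite (ltW t0).
have B1 := HK t (u n - x) tK; have B2 := ler_wpM2l (le_trans ler01 K1) H1.
have B3 : t * rnorm (A (u n) - y) <= 1 * h by apply: ler_pM; rewrite ?rnorm_ge0 ?(ltW t0).
have K1p : 0 < K + 1 by lra.
have E : (K + 1) * h * 3 = t * (e / 2) by rewrite /h; field; rewrite gt_eqF.
have B4 : t * ((K + 1) * h) <= 1 * ((K + 1) * h).
  by rewrite ler_wpM2r // mulr_ge0 // ltW.
have B5 : h <= (K + 1) * h by rewrite ler_peMl ?(ltW h0) //; lra.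
by lra.
Qed.

Lemma gen_dense x (e : R) : 0 < e -> exists2 z, DA z & rnorm (z - x) <= e.
Proof.
move=> e0; have [d d0 H] := sg_cont sg x e0; exists (S d x); first exact: (sg_smooth sg).
by apply: H; rewrite lexx ltW.
Qed.

(** * Surjectivity of z - A on the right half plane *)

Section Resolvent.
Context {C0 : R}.
Context (C00 : 0 <= C0).
Context (apriori : forall (z : R[i]) y, 0 < complex.Re z -> DA y ->
  rnorm (A y) <= C0 * rnorm (z *: y - A y)).
Let M := 1 + C0.

Definition in_range (z : R[i]) x : Prop := exists2 y, DA y & z *: y - A y = x.

Lemma resolvent_le (z : R[i]) y : 0 < complex.Re z -> DA y ->
  cabs z * rnorm y <= M * rnorm (z *: y - A y).
Proof.
move=> z0 Dy; rewrite -rnormZ; have -> : z *: y = (z *: y - A y) + A y by lin.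
apply: le_trans (rnormD _ _) _; rewrite addrK /M mulrDl mul1r lerD2l.
exact: apriori.
Qed.

Lemma in_range_lin (z a b : R[i]) x y : in_range z x -> in_range z y ->
  in_range z (a *: x + b *: y).
Proof.
move=> [u Du <-] [v Dv <-]; have [D E] := gen_lin a b Du Dv.
by exists (a *: u + b *: v) => //; rewrite E; lin.
Qed.

Lemma in_range_closed (z : R[i]) (v : nat -> X) x : 0 < complex.Re z ->
  (forall n, in_range z (v n)) -> v n @[n --> \oo] --> x -> in_range z x.
Proof.
move=> z0 rv vx.
have zp : 0 < cabs z by apply: lt_le_trans (Re_le_cabs z).
have M0 : 0 < M by rewrite ltr_pwDl.
have /choice[y yP] n : exists y, DA y /\ z *: y - A y = v n.
  by have [y Dy E] := rv n; exists y.
have vC := (cvg_seq_rnormP _ _).1 vx.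
have [l yl] : exists l : X, y n @[n --> \oo] --> l.
  apply: cauchy_rnorm => e e0.
  have e'0 : 0 < cabs z * e / (2 * M) by rewrite divr_gt0 // mulr_gt0.
  have [N HN] := vC _ e'0; exists N => m n Nm Nn.
  have [Dm Em] := yP m; have [Dn En] := yP n.
  have [D E] := gen_lin 1 (-1) Dm Dn.
  have := resolvent_le z0 D; rewrite E.
  have -> : z *: (1 *: y m + -1 *: y n) - (1 *: A (y m) + -1 *: A (y n)) = v m - v n.
    by rewrite -Em -En; lin.
  have -> : 1 *: y m + -1 *: y n = y m - y n by lin.
  have := rnorm_tri x (v m) (v n); rewrite (rdistC x) => T H.
  rewrite -(ltr_pM2l zp); apply: le_lt_trans H _.
  have -> : cabs z * e = M * (2 * (cabs z * e / (2 * M))) by field; rewrite gt_eqF.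
  by rewrite ltr_pM2l //; have := HN m Nm; have := HN n Nn; lra.
have Ay : A (y n) @[n --> \oo] --> z *: l - x.
  have -> : (fun n => A (y n)) = (fun n => z *: y n - v n).
    by apply/funext => n; rewrite -(yP n).2; lin.
  by apply: cvgB => //; apply: cvgZr.
have [D E] := gen_closed (fun n => (yP n).1) yl Ay.
by exists l => //; rewrite E; lin.
Qed.

(** Successive approximation: the error halves at each step, and the range is closed. It serves at
    the starting point, [in_range_large], and in the continuation, [in_range_step]. *)
Lemma in_range_half (z : R[i]) : 0 < complex.Re z ->
  (forall x, exists2 v, in_range z v & rnorm (x - v) <= 2^-1 * rnorm x) ->
  forall x, in_range z x.
Proof.
move=> z0 H x.
have /choice[f fP] w : exists v, in_range z v /\ rnorm (w - v) <= 2^-1 * rnorm w.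
  by have [v rv Hv] := H w; exists v.
pose r := fix r k := if k is k'.+1 then r k' - f (r k') else x.
have rn k : rnorm (r k) <= 2 ^- k * rnorm x.
  elim: k => [|k IH]; first by rewrite expr0 invr1 mul1r.
  apply: le_trans (fP (r k)).2 _; rewrite exprS invfM -mulrA.
  by rewrite ler_wpM2l.
apply: (@in_range_closed z (fun k => x - r k)) => //.
  elim=> [|k IH]; first by rewrite subrr; have := in_range_lin 0 0 (fP x).1 (fP x).1;
    rewrite !scale0r addr0.
  have := in_range_lin 1 1 IH (fP (r k)).1.
  by have -> : 1 *: (x - r k) + 1 *: f (r k) = x - r k.+1 by rewrite /=; lin.
apply/cvg_seq_rnormP => e e0; have [N HN] := nat_gt (rnorm x / e); exists N => n Nn.
have -> : x - r n - x = - r n by lin.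
rewrite rnormN; apply: le_lt_trans (rn n) _.
have p0 : 0 < 2 ^+ n :> R by rewrite exprn_gt0.
rewrite mulrC ltr_pdivrMr // mulrC -ltr_pdivrMr //; apply: lt_le_trans HN _.
apply: (@le_trans _ _ n%:R); first by rewrite ler_nat.
by rewrite -natrX ler_nat ltnW // ltn_expl.
Qed.

(** A rough approximate resolvent is enough for [in_range_half]: the Laplace transform of the
    semigroup up to time 1, with e^(-l t) replaced by the implicit Euler weights (1 + l s)^-(k + 1)
    at step s. *)
Lemma in_range_large : exists2 l : R, 0 < l & forall x, in_range l%:C x.
Proof.
(* With l = 4 K, the term left at time 1 is at most K / (1 + l) <= 1/4 of the norm of z, by
   Bernoulli's inequality. *)
have [K K1 HK] := sg_bounded 1; pose l := 4 * K; have l0 : 0 < l by rewrite /l; lra.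
have K0 : 0 < K by lra.
exists l => //; apply: in_range_half => // x.
have [x0|x0] := eqVneq (rnorm x) 0.
  have D0 : in_range l%:C 0.
    have [z Dz _] := gen_dense x ltr01; have [D E] := gen_lin 0 0 Dz Dz.
    by rewrite !scale0r addr0 in D E; exists 0 => //; rewrite E; lin.
  by exists 0 => //; rewrite subr0 x0 mulr0.
have xp : 0 < rnorm x by rewrite lt_neqAle eq_sym x0 rnorm_ge0.
have x16 : 0 < rnorm x / 16 by rewrite divr_gt0.
have [z Dz zx] := gen_dense x x16.
have e0 : 0 < rnorm x / 16 / K by rewrite divr_gt0.
have [d d0 Hd] := (sg_gen sg z (A z)).1 (conj Dz erefl) _ e0.
have [n Hn] := nat_gt d^-1.
have nR : 0 < n%:R :> R by apply: lt_trans Hn; rewrite invr_gt0.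
pose s := n%:R^-1 : R; have s0 : 0 < s by rewrite invr_gt0.
have sd : s <= d by rewrite /s invf_ple ?posrE // ltW.
have ns : n%:R * s = 1 by rewrite mulfV ?gt_eqF.
pose q := (1 + l * s)^-1; have ls : 0 < 1 + l * s by rewrite ltr_pwDl // mulr_ge0 // ltW.
have q0 : 0 < q by rewrite invr_gt0.
have q1 : q <= 1 by rewrite invf_le1 // lerDl mulr_ge0 // ltW.
have ks k : (k < n)%N -> 0 <= k%:R * s <= 1.
  move=> kn; apply/andP; split; first by rewrite mulr_ge0 // ltW.
  by rewrite -[leRHS]ns ler_pM2r // ler_nat ltnW.
pose err := (s^-1)%:C *: (S s z - z) - A z.
have errn : rnorm err <= rnorm x / 16 / K by apply: Hd; rewrite s0.
pose V := \sum_(0 <= k < n) (q ^+ k.+1 * s)%:C *: S (k%:R * s) z.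
pose E := \sum_(0 <= k < n) (q ^+ k.+1 * s)%:C *: S (k%:R * s) err.
(* A discrete form of (e^(-l t) S t z)' = e^(-l t) S t (A z - l z), exact up to [err]. *)
have tel m : (q ^+ m)%:C *: S (m%:R * s) z - z =
   \sum_(0 <= k < m) (q ^+ k.+1 * s)%:C *: (S (k%:R * s) err +
      S (k%:R * s) (A z) - l%:C *: S (k%:R * s) z).
  elim: m => [|m IH]; first by rewrite big_geq // mul0r (sg0 sg) scale1r subrr.
  have -> : S (m.+1%:R * s) z = S (m%:R * s) (S s z).
    by rewrite -natr1 mulrDl mul1r (sgD sg) ?mulr_ge0 ?(ltW s0).
  rewrite big_nat_recr //= -IH /err SB SZ SB.
  have qE : (q ^+ m)%:C = (q ^+ m.+1)%:C * (1 + l%:C * s%:C) :> R[i].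
    rewrite -rmorphM -(rmorph1 (real_complex R)) -rmorphD -rmorphM /=; congr (_%:C).
    have qq : q * (1 + l * s) = 1 by rewrite mulVf ?gt_eqF.
    by rewrite exprSr -mulrA qq mulr1.
  have sC : s%:C != 0 :> R[i] by rewrite -cabs_gt0 cabsC gtr0_norm.
  have -> : (q ^+ m.+1 * s)%:C = (q ^+ m.+1)%:C * s%:C :> R[i] by rewrite rmorphM.
  have -> : (s^-1)%:C = (s%:C)^-1 :> R[i] by rewrite fmorphV.
  rewrite qE; move: (s%:C : R[i]) sC ((q ^+ m.+1)%:C : R[i]) (l%:C : R[i]) => a a0 b c.
  by lin.
have DV : DA V /\ A V = \sum_(0 <= k < n) (q ^+ k.+1 * s)%:C *: S (k%:R * s) (A z).
  rewrite /V; elim: (index_iota 0 n) => [|k r [D Er]].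
    by rewrite !big_nil; have [] := gen_lin 0 0 Dz Dz; rewrite !scale0r addr0.
  have [D1 E1] : DA (S (k%:R * s) z) /\ A (S (k%:R * s) z) = S (k%:R * s) (A z).
    by apply: gen_comm => //; rewrite mulr_ge0 // ltW.
  have [] := gen_lin (q ^+ k.+1 * s)%:C 1 D1 D.
  by rewrite !big_cons Er E1 !scale1r.
exists (l%:C *: V - A V); first by exists V => //; exact: DV.1.
have -> : x - (l%:C *: V - A V) = (x - z) + (q ^+ n)%:C *: S 1 z - E.
  have := tel n; rewrite ns.
  have -> : \sum_(0 <= k < n) (q ^+ k.+1 * s)%:C *: (S (k%:R * s) err +
      S (k%:R * s) (A z) - l%:C *: S (k%:R * s) z) = E + A V - l%:C *: V.
    rewrite DV.2 /E /V scaler_sumr -big_split -sumrB /=; apply: eq_bigr => k _.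
    by lin.
  move=> tE; have -> : (q ^+ n)%:C *: S 1 z = z + (E + A V - l%:C *: V).
    by rewrite -tE; lin.
  by lin.
have q01 : ((0 : R) <= 1) && ((1 : R) <= 1) by rewrite ler01 lexx.
have qn : q ^+ n * K <= 4^-1.
  have B m : 1 + m%:R * (l * s) <= (1 + l * s) ^+ m.
    elim: m => [|m IH]; first by rewrite mul0r addr0 expr0.
    have lsp : 0 <= l * s by rewrite mulr_ge0 // ltW.
    rewrite exprS -natr1; apply: le_trans (ler_wpM2l (ltW ls) IH).
    have : 0 <= m%:R * (l * s) * (l * s) by rewrite mulr_ge0 // mulr_ge0.
    by lra.
  have := B n; rewrite mulrCA ns mulr1 => B1.
  rewrite /q exprVn mulrC ler_pdivrMr ?exprn_gt0 // mulrC ler_pdivlMr //.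
  by apply: le_trans B1; rewrite /l; lra.
have En : rnorm E <= rnorm x / 16.
  apply: (@le_trans _ _ (\sum_(0 <= k < n) s * (rnorm x / 16))).
    apply: le_trans (rnorm_sum _ _ _) _; rewrite !big_nat; apply: ler_sum => k /andP[_ kn].
    have qk : q ^+ k.+1 <= 1 by rewrite exprn_ile1 // ltW.
    have qk0 : 0 <= q ^+ k.+1 by rewrite exprn_ge0 // ltW.
    rewrite rnormZr ger0_norm ?mulr_ge0 ?(ltW s0) // -mulrA.
    apply: le_trans (ler_piMl _ qk) _; first by rewrite mulr_ge0 ?rnorm_ge0 // ltW.
    rewrite ler_pM2l //; apply: le_trans (HK _ _ (ks k kn)) _.
    by apply: le_trans (ler_wpM2l (ltW K0) errn) _; rewrite mulrC divfK ?gt_eqF.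
  by rewrite sumr_const_nat subn0 -[leLHS]mulr_natl mulrA ns mul1r.
apply: le_trans (rnorm_triB _ _) _; apply: le_trans (lerD (rnormD _ _) En) _.
rewrite (rdistC x z) rnormZr ger0_norm ?exprn_ge0 ?(ltW q0) //.
have H1 : q ^+ n * rnorm (S 1 z) <= 4^-1 * rnorm z.
  apply: (@le_trans _ _ (q ^+ n * (K * rnorm z))).
    by rewrite ler_wpM2l ?exprn_ge0 ?(ltW q0) // HK.
  by rewrite mulrA ler_wpM2r ?rnorm_ge0.
have H2 : rnorm z <= rnorm x + rnorm x / 16.
  by have := rnormB z x; lra.
by lra.
Qed.

Lemma in_range_step (z w : R[i]) : 0 < complex.Re z -> 0 < complex.Re w ->
  cabs (w - z) * (2 * M) <= cabs z ->
  (forall x, in_range z x) -> forall x, in_range w x.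
Proof.
move=> z0 w0 wz Hz; apply: in_range_half => // x; have [y Dy E] := Hz x.
exists (w *: y - A y); first by exists y.
have -> : x - (w *: y - A y) = - ((w - z) *: y) by rewrite -E; lin.
rewrite rnormN rnormZ; have M0 : 0 < M by rewrite ltr_pwDl.
have H1 := resolvent_le z0 Dy; rewrite E in H1.
have H2 := ler_wpM2r (rnorm_ge0 y) wz.
by rewrite -(ler_pM2l M0); lra.
Qed.

(** Along the segment from [l] to z the real part, hence the modulus, is at least c > 0, so finitely
    many equal steps of [in_range_step] suffice. *)
Lemma half_plane_resolventP : half_plane_resolvent DA A M.
Proof.
split=> [a b x y||]; first exact: gen_lin; last exact: resolvent_le.
move=> z x z0; suff : in_range z x by [].
have [l l0 Hl] := in_range_large; pose c := Num.min l (complex.Re z).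
have c0 : 0 < c by rewrite lt_min l0.
have M0 : 0 < M by rewrite ltr_pwDl.
have [n Hn] := nat_gt (cabs (z - l%:C) * (2 * M) / c).
have nR : 0 < n%:R :> R.
  by apply: le_lt_trans Hn; rewrite divr_ge0 ?mulr_ge0 ?cabs_ge0 // ltW.
pose pt k : R[i] := l%:C + (k%:R / n%:R)%:C * (z - l%:C).
have Rept k : (k <= n)%N -> c <= complex.Re (pt k).
  move=> kn; rewrite /pt ReD ReZ ReD ReN /=.
  have t1 : k%:R / n%:R <= 1 :> R by rewrite ler_pdivrMr // mul1r ler_nat.
  have t0 : 0 <= k%:R / n%:R :> R by rewrite divr_ge0 // ltW.
  have [cl cz] : c <= l /\ c <= complex.Re z by rewrite /c !ge_min !lexx orbT.
  move: t0 t1 cl cz; set t := _ / _; set rz := complex.Re z; nra.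
have H k : (k <= n)%N -> forall x, in_range (pt k) x.
  elim: k => [|k IH] kn; first by rewrite /pt mul0r mul0r addr0.
  have Rk := Rept k (ltnW kn); apply: (in_range_step _ _ _ (IH (ltnW kn))).
  - exact: lt_le_trans Rk.
  - exact: lt_le_trans (Rept _ kn).
  have -> : pt k.+1 - pt k = (n%:R^-1)%:C * (z - l%:C).
    rewrite /pt -natr1 mulrDl mul1r rmorphD /=; ring.
  apply: le_trans (le_trans Rk (Re_le_cabs _)).
  rewrite cabsM cabsC ger0_norm ?invr_ge0 ?(ltW nR) // -mulrA mulrC ler_pdivrMr //.
  by rewrite [leRHS]mulrC -ler_pdivrMr // ltW.
have := H n (leqnn n) x; rewrite /pt mulfV ?gt_eqF // mul1r.
by rewrite addrCA subrr addr0.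
Qed.

End Resolvent.

End Semigroup.

(** * Piecewise constant functions *)

(** Over any [zmodType], so that it covers the vector-valued approximations as well as their real
    majorants. *)
Definition pw (R : realType) (V : zmodType) (K : nat) (I : nat -> set R) (c : nat -> V) (t : R) : V :=
  \sum_(n < K) (if t \in I n then c n else 0).

Section Pieces.
Context {R : realType}.
Local Notation mu := (@lebesgue_measure R).
Implicit Types (I : nat -> set R) (K : nat).

Definition pieces I : Prop :=
  [/\ trivIset setT I, forall n, measurable (I n) & forall n, (mu (I n) < +oo)%E].

Lemma pw_in (V : zmodType) K I (c : nat -> V) n t :
  trivIset setT I -> (n < K)%N -> I n t -> pw K I c t = c n.
Proof.
move=> tI nK Int; rewrite /pw (bigD1 (Ordinal nK)) //= mem_set // big1 ?addr0 // => i ni.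
case: ifPn => // /set_mem Iit; case/eqP: ni; apply/val_inj => /=.
by apply: (tI i n) => //; exists t.
Qed.

Lemma pw_out (V : zmodType) K I (c : nat -> V) t :
  (forall n, (n < K)%N -> ~ I n t) -> pw K I c t = 0.
Proof. by move=> H; rewrite /pw big1 // => i _; rewrite memNset //; apply: H. Qed.

Lemma pieces_itv (s : nat -> R) : nondecreasing_seq s ->
  pieces (fun n => `[s n, s n.+1[%classic).
Proof.
move=> sn; split=> [i j _ _ [t [/=]]||n].
- rewrite !in_itv /= => /andP[it ti] /andP[jt tj].
  apply/eqP; rewrite eqn_leq; apply/andP; split; rewrite leqNgt; apply/negP => /sn le.
    by have := lt_le_trans (le_lt_trans it tj) le; rewrite ltxx.
  by have := lt_le_trans (le_lt_trans jt ti) le; rewrite ltxx.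
- by move=> n; apply: measurable_itv.
by rewrite lebesgue_measure_itv /=; case: ifP => //; rewrite ltry.
Qed.

Lemma measure_itvco (a b : R) : a <= b -> mu `[a, b[%classic = (b - a)%:E.
Proof.
move=> ab; rewrite lebesgue_measure_itv /= lte_fin; case: ltrP => // ba.
by have /eqP := le_anti (introT andP (conj ab ba)); rewrite -subr_eq0 => /eqP; rewrite -opprB => /eqP; rewrite oppr_eq0 => /eqP ->.
Qed.

(** Comparison without measurability, from the integral of a nonnegative function as a supremum over
    simple ones; the norms integrated later then need no measurability proof. *)
Lemma le_integralT (f g : R -> \bar R) :
  (forall t, (0 <= f t)%E) -> (forall t, (f t <= g t)%E) ->
  (\int[mu]_t f t <= \int[mu]_t g t)%E.
Proof.
move=> f0 fg; have g0 t : (0 <= g t)%E := le_trans (f0 t) (fg t).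
rewrite !ge0_integralTE //; apply: ereal_sup_le => _ [h /= hf <-].
by exists h => //= t; apply: le_trans (hf t) (fg t).
Qed.

Lemma integral_pw K I (e : nat -> R) : pieces I -> (forall n, 0 <= e n) ->
  (\int[mu]_t (pw K I e t)%:E = (\sum_(n < K) e n * fine (mu (I n)))%:E)%E.
Proof.
move=> [tI mI fI] e0.
have -> : (fun t => (pw K I e t)%:E) =
    (fun t => (\sum_(n < K) ((e n)%:E * (\1_(I n) t)%:E))%E).
  apply/funext => t; rewrite /pw -sumEFin; apply: eq_bigr => n _.
  by rewrite indicE; case: ifP; rewrite ?mule1 ?mule0.
rewrite ge0_integral_sum //.
- rewrite -sumEFin; apply: eq_bigr => n _.
  rewrite ge0_integralZl ?lee_fin //.
  + have -> : (\int[mu]_t (\1_(I n) t)%:E = mu (I n))%E.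
      by rewrite (@integral_indic _ _ R mu setT measurableT (I n) (mI n)) setIT.
    rewrite EFinM fineK // ge0_fin_numE //; exact: fI.
  + by apply/measurable_EFinP; apply: measurable_indic; apply: mI.
- by move=> n; apply: measurable_funeM; apply/measurable_EFinP; apply: measurable_indic; apply: mI.
- by move=> n t _; rewrite mule_ge0 ?lee_fin.
Qed.

End Pieces.

(** * Vector-valued simple functions and Bochner integrals *)

Section SimplePieces.
Context {R : realType} {X : completeNormedModType R[i]}.
Local Notation mu := (@lebesgue_measure R).
Implicit Types (I : nat -> set R) (K : nat) (c : nat -> X).

Let F I c (x : X) n : set R := if c n == x then I n else set0.

Let F_pieces I c x : pieces I -> trivIset setT (F I c x) /\ forall n, measurable (F I c x n).
Proof.
move=> [tI mI _]; split=> [i j _ _|n]; rewrite /F; last by case: ifP.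
by case: ifP => _; case: ifP => _ [t [//=]] it jt; apply: tI => //; exists t.
Qed.

Let pw_preimage K I c x : pieces I -> x != 0 ->
  pw K I c @^-1` [set x] = \big[setU/set0]_(n < K) F I c x n.
Proof.
move=> [tI _ _] x0; apply/seteqP; split=> t /=.
  move=> E; have [n nK Int] : exists2 n, (n < K)%N & I n t.
    apply: contrapT => H; case/eqP: x0; rewrite -E; apply: pw_out => n nK Int.
    by apply: H; exists n.
  rewrite -bigcup_mkord; exists n => //.
  by rewrite /F -E (pw_in c tI nK Int) eqxx.
rewrite -bigcup_mkord => -[n /= nK]; rewrite /F; case: eqP => // cx Int.
by rewrite (pw_in c tI nK Int).
Qed.

Let mu_preimage K I c x : pieces I -> x != 0 ->
  mu (pw K I c @^-1` [set x]) =
  (\sum_(n < K) (if c n == x then fine (mu (I n)) else 0))%:E.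
Proof.
move=> pI x0; rewrite pw_preimage //; have [tF mF] := F_pieces c x pI.
rewrite measure_bigsetU // -sumEFin; apply: eq_bigr => n _; rewrite /F.
case: ifP => _; last by rewrite measure0.
by case: pI => _ _ fI; rewrite fineK // ge0_fin_numE //; apply: fI.
Qed.

Lemma simple_pw K I c : pieces I -> simple (pw K I c).
Proof.
move=> pI; have [tI mI fI] := pI; split.
  apply: (@sub_finite_set _ _ [set` 0 :: [seq c n | n <- iota 0 K]]); last exact: finite_seq.
  move=> _ [t _ <-] /=; have [[n nK Int]|H] := pselect (exists2 n, (n < K)%N & I n t).
    rewrite (pw_in c tI nK Int) inE; apply/orP; right; apply: map_f.
    by rewrite mem_iota.
  rewrite pw_out ?inE ?eqxx // => n nK Int.
  by apply: H; exists n.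
move=> x; split; last by move=> x0; rewrite mu_preimage // ltry.
have [->|x0] := eqVneq x 0; last first.
  by rewrite pw_preimage //; apply: bigsetU_measurable => n _; apply: (F_pieces c x pI).2.
pose G n := if c n == 0 then set0 else I n.
have -> : pw K I c @^-1` [set 0] = ~` (\big[setU/set0]_(n < K) G n).
  apply/seteqP; split=> t /=; rewrite -bigcup_mkord.
    move=> E [n /= nK]; rewrite /G; case: eqP => // c0 Int; apply: c0.
    by rewrite -E (pw_in c tI nK Int).
  move=> H; have [[n nK Int]|H'] := pselect (exists2 n, (n < K)%N & I n t).
    rewrite (pw_in c tI nK Int); apply/eqP/negPn/negP => c0; apply: H.
    by exists n => //=; rewrite /G (negPf c0).
  by rewrite pw_out // => n nK Int; apply: H'; exists n.
apply: measurableC; apply: bigsetU_measurable => n _.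
by rewrite /G; case: ifP.
Qed.

Lemma simple_integral_pw K I c : pieces I ->
  simple_integral (pw K I c) = \sum_(n < K) (fine (mu (I n)))%:C *: c n.
Proof.
move=> pI; have [tI mI fI] := pI; have [fr _] := simple_pw K c pI.
rewrite /simple_integral fsbig_finite //=.
transitivity (\sum_(x <- finmap.enum_fset (fset_set (range (pw K I c))))
    \sum_(n < K) (if c n == x then (fine (mu (I n)))%:C *: c n else 0)).
  apply: eq_bigr => x _; have [->|x0] := eqVneq x 0.
    by rewrite scaler0 big1 // => n _; case: eqP => // ->; rewrite scaler0.
  rewrite mu_preimage //= raddf_sum scaler_suml; apply: eq_bigr => n _.
  by case: eqP => [->|_] //; rewrite scale0r.
rewrite exchange_big /=; apply: eq_bigr => n _.
have [cn|cn] := boolP (c n \in finmap.enum_fset (fset_set (range (pw K I c)))).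
  rewrite (bigD1_seq (c n)) ?finmap.fset_uniq //= eqxx big1 ?addr0 // => x xc.
  by rewrite eq_sym (negPf xc).
(* A value that is not attained belongs to an empty cell. *)
have -> : I n = set0.
  rewrite -subset0 => t Int; case/negP: cn.
  rewrite in_fset_set // mem_set //; exists t => //.
  exact: pw_in.
by rewrite measure0 scale0r big1 // => x _; case: ifP => // _; rewrite scale0r.
Qed.

Lemma strongly_measurable_pw (f : R -> X) :
  (forall e : R, 0 < e -> exists K I c, pieces I /\ forall t, rnorm (f t - pw K I c t) <= e) ->
  strongly_measurable f.
Proof.
move=> H.
have /choice[g gP] (n : nat) : exists g : R -> X, simple g /\
    forall t, rnorm (f t - g t) <= n.+1%:R^-1.
  have n0 : 0 < n.+1%:R^-1 :> R by rewrite invr_gt0.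
  by have [K [I [c [pI Hc]]]] := H _ n0; exists (pw K I c); split=> //; apply: simple_pw.
exists g; split=> [n|]; first by case: (gP n).
apply: aeW => t; apply/cvg_seq_rnormP => e e0; have [N HN] := nat_gt e^-1.
exists N => n Nn; rewrite rdistC; apply: le_lt_trans ((gP n).2 t) _.
rewrite invf_plt ?posrE //; apply: lt_le_trans HN _.
by rewrite ler_nat leqW.
Qed.

(** On a support of length [L], a uniform error e gives an L^1 error of at most e L, so uniform
    approximation is enough. *)
Lemma bochner_pw (f : R -> X) (v : X) (L : R) : 0 <= L ->
  (forall t, ~ (0 <= t <= L) -> f t = 0) ->
  (forall e : R, 0 < e -> exists K I c, [/\ pieces I,
     forall t, rnorm (f t - pw K I c t) <= e,
     forall t, ~ (0 <= t <= L) -> pw K I c t = 0 &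
     rnorm (\sum_(n < K) (fine (mu (I n)))%:C *: c n - v) <= e]) ->
  is_bochner f v.
Proof.
move=> L0 f0 H; split.
  by apply: strongly_measurable_pw => e /H[K [I [c [pI Hc _ _]]]]; exists K, I, c.
have /choice[g gP] (n : nat) : exists g : R -> X, [/\ simple g,
    forall t, rnorm (f t - g t) <= n.+1%:R^-1, forall t, ~ (0 <= t <= L) -> g t = 0 &
    rnorm (simple_integral g - v) <= n.+1%:R^-1].
  have n0 : 0 < n.+1%:R^-1 :> R by rewrite invr_gt0.
  have [K [I [c [pI Hc H0 Hv]]]] := H _ n0; exists (pw K I c); split=> //.
    exact: simple_pw.
  by rewrite simple_integral_pw.
have small (e : R) : 0 < e -> exists N, forall n, (N <= n)%N -> n.+1%:R^-1 < e.
  move=> e0; have [N HN] := nat_gt e^-1; exists N => n Nn.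
  by rewrite invf_plt ?posrE //; apply: lt_le_trans HN _; rewrite ler_nat leqW.
exists g; split=> [n||]; first by case: (gP n).
  have up n : (\int[mu]_t (rnorm (f t - g n t))%:E <= (n.+1%:R^-1 * L)%:E)%E.
    have [_ H1 H2 _] := gP n.
    apply: le_trans (le_integralT (g := (cst (n.+1%:R^-1)%:E) \_ `[0, L]) _ _) _.
    - by move=> t; rewrite lee_fin rnorm_ge0.
    - move=> t; rewrite patchE; case: ifPn => [_|/negP]; first by rewrite lee_fin.
      by rewrite in_setE /= in_itv /= => tn; rewrite f0 ?H2 ?subrr ?rnorm0.
    have mL : measurable (`[0, L]%classic : set R) by apply: measurable_itv.
    have muL : mu (`[0, L]%classic : set R) = L%:E.
      rewrite lebesgue_measure_itv /= lte_fin; case: ltrP => [_|L1]; first by rewrite sube0.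
      by congr (_%:E); apply/le_anti; rewrite L0.
    by rewrite -integral_mkcond (integral_cst mu mL) EFinM -muL; apply: lexx.
  apply: (@squeeze_cvge _ _ _ _ (cst 0%E) _ (fun n => (n.+1%:R^-1 * L)%:E)).
  - apply: nearW => n; rewrite up andbT; apply: integral_ge0 => t _.
    by rewrite lee_fin rnorm_ge0.
  - exact: cvg_cst.
  - apply: cvg_EFin; first exact: nearW.
    rewrite -[0](mul0r L); apply: cvgMl; exact: cvg_harmonic.
apply/cvg_seq_rnormP => e e0; have [N HN] := small e e0; exists N => n Nn.
by have [_ _ _ Hv] := gP n; apply: le_lt_trans Hv _; apply: HN.
Qed.

Lemma Lpnorm_pow (p : R) (f : R -> X) : 0 < p ->
  (Lpnorm p f `^ p = \int[mu]_t (rnorm (f t) `^ p)%:E)%E.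
Proof.
move=> p0; have p1 : p != 0 by rewrite gt_eqF.
rewrite /Lpnorm (poweR_Lnorm _ _ p1); congr integral; apply/funext => t.
by rewrite /= ger0_norm // rnorm_ge0.
Qed.

End SimplePieces.

(** * The discrete a priori estimate *)

Section Ext0.
Context {R : realType} {X : completeNormedModType R[i]}.

Lemma ext0_in (D : set R) (f : R -> X) t : D t -> ext0 D f t = f t.
Proof. by move=> Dt; rewrite /ext0 /patch mem_set. Qed.

Lemma ext0_out (D : set R) (f : R -> X) t : ~ D t -> ext0 D f t = 0.
Proof. by move=> Dt; rewrite /ext0 /patch memNset. Qed.

End Ext0.

Lemma bracket (R : realType) (s : nat -> R) (n : nat) (t : R) : s 0%N <= t < s n ->
  exists2 i, (i < n)%N & s i <= t < s i.+1.
Proof.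
move=> /andP[st]; elim: n => [|n IH]; first by rewrite ltNge st.
have [nt tn|tn _] := lerP (s n) t; first by exists n => //; rewrite nt.
by have [i iN Hi] := IH tn; exists i => //; apply: ltnW.
Qed.

(** * The interpolant of a sequence and its residual *)

Section Interpolant.
Context {R : realType} {X : completeNormedModType R[i]}.
Context {S : R -> X -> X} {DA : set X} {A : X -> X}.
Context (sg : semigroup_spec S DA A).
Context {h : R} {N : nat} {y : nat -> X}.
Context (h0 : 0 < h) (y0 : y 0%N = 0) (Dy : forall n, (n <= N)%N -> DA (y n)).
Local Notation mu := (@lebesgue_measure R).
Local Ltac lin := linear_with (R[i]) X ltac:(first [by ring | by field]).

Let a : R := N%:R * h.
Let a0 : 0 <= a. Proof. by rewrite mulr_ge0 // ltW. Qed.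
Let z : X := A (y N).

Definition slope n : X := (h^-1)%:C *: (y n.+1 - y n).

(** The length of the part of the n-th cell to the left of [t]. With it the integral of the slopes
    up to [t] is one sum without cases. *)
Definition clip n t : R := Num.min (n.+1%:R * h) t - Num.min (n%:R * h) t.

(* The piecewise linear interpolant of [y] on [0, N h], continued by the orbit
   of its last value, along which the inhomogeneity vanishes. *)
Definition interp t : X := \sum_(0 <= n < N) (clip n t)%:C *: slope n +
  (S (Num.max (t - a) 0) (y N) - y N).

Definition dinterp t : X :=
  if t < a then pw N (fun n => `[n%:R * h, n.+1%:R * h[%classic) slope t else S (t - a) z.

Definition residual t : X := dinterp t - A (interp t).

Let nodes_nd : nondecreasing_seq (fun n => n%:R * h : R).
Proof. by move=> m n mn; rewrite ler_pM2r // ler_nat. Qed.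

Let cells : pieces (fun n => `[n%:R * h, n.+1%:R * h[%classic : set R).
Proof. exact: pieces_itv nodes_nd. Qed.

Let hC : h%:C != 0 :> R[i].
Proof. by rewrite -cabs_gt0 cabsC gtr0_norm. Qed.

Let hslope n : h%:C *: slope n = y n.+1 - y n.
Proof. by rewrite /slope scalerA fmorphV mulfV // scale1r. Qed.

Lemma clip_lt n t : n.+1%:R * h <= t -> clip n t = h.
Proof.
move=> nt; have nt' : n%:R * h <= t by apply: le_trans nt; apply: nodes_nd.
by rewrite /clip (min_idPl nt) (min_idPl nt') -natr1; ring.
Qed.

Lemma clip_gt n t : t <= n%:R * h -> clip n t = 0.
Proof.
move=> nt; have nt' : t <= n.+1%:R * h by apply: le_trans nt _; apply: nodes_nd.
by rewrite /clip (min_idPr nt) (min_idPr nt') subrr.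
Qed.

Let sum_full n t : n%:R * h <= t -> \sum_(0 <= k < n) (clip k t)%:C *: slope k = y n.
Proof.
elim: n => [|n IH] nt; first by rewrite big_geq.
rewrite big_nat_recr //= IH; last by apply: le_trans nt; apply: nodes_nd.
by rewrite clip_lt // hslope addrC subrK.
Qed.

Lemma interp_cell n t : (n < N)%N -> n%:R * h <= t <= n.+1%:R * h ->
  interp t = y n + (t - n%:R * h)%:C *: slope n.
Proof.
move=> nN /andP[nt tn]; rewrite /interp (big_cat_nat (n := n)) ?(ltnW nN) //=.
rewrite sum_full // big_ltn // big_nat big1 ?addr0; last first.
  move=> i /andP[ni iN]; rewrite clip_gt ?scale0r //.
  by apply: le_trans tn _; rewrite ler_pM2r // ler_nat.
have ta : t <= a by apply: le_trans tn _; rewrite ler_pM2r // ler_nat.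
have -> : Num.max (t - a) 0 = 0 by apply: max_r; rewrite subr_le0.
by rewrite (sg0 sg) subrr addr0 /clip (min_idPl nt) (min_idPr tn).
Qed.

Lemma interp_orbit t : a <= t -> interp t = S (t - a) (y N).
Proof.
move=> ta; rewrite /interp sum_full //.
have -> : Num.max (t - a) 0 = t - a by apply: max_l; rewrite subr_ge0.
by rewrite addrC subrK.
Qed.

Lemma cellP t : 0 <= t < a -> exists2 n, (n < N)%N & n%:R * h <= t < n.+1%:R * h.
Proof.
by move=> ta; apply: (@bracket _ (fun n => n%:R * h)); rewrite mul0r.
Qed.

Lemma dinterp_cell n t : (n < N)%N -> n%:R * h <= t < n.+1%:R * h -> dinterp t = slope n.
Proof.
move=> nN /andP[nt tn]; have ta : t < a.
  by apply: lt_le_trans tn _; rewrite ler_pM2r // ler_nat.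
rewrite /dinterp ta; case: cells => tI _ _; apply: (pw_in _ tI nN).
by rewrite /= in_itv /= nt tn.
Qed.

Lemma dinterp_orbit t : a <= t -> dinterp t = S (t - a) z.
Proof. by move=> ta; rewrite /dinterp ltNge ta. Qed.

Lemma interp0 : interp 0 = 0.
Proof.
rewrite /interp big_nat big1 => [|i _]; last by rewrite clip_gt ?scale0r // mulr_ge0 // ltW.
have -> : Num.max (0 - a) 0 = 0 by apply: max_r; rewrite sub0r oppr_le0.
by rewrite (sg0 sg) subrr addr0.
Qed.

Let Dslope n : (n < N)%N -> DA (slope n) /\ A (slope n) = (h^-1)%:C *: (A (y n.+1) - A (y n)).
Proof.
move=> nN; have := gen_lin sg (h^-1)%:C (- (h^-1)%:C) (Dy nN) (Dy (ltnW nN)).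
by rewrite /slope scalerBr !scaleNr scalerBr.
Qed.

Lemma A_interp_cell n t : (n < N)%N -> n%:R * h <= t <= n.+1%:R * h ->
  DA (interp t) /\ A (interp t) = A (y n) + (t - n%:R * h)%:C *: A (slope n).
Proof.
move=> nN tn; rewrite (interp_cell nN tn).
have := gen_lin sg 1 (t - n%:R * h)%:C (Dy (ltnW nN)) (Dslope nN).1.
by rewrite !scale1r.
Qed.

Lemma A_interp_orbit t : a <= t -> DA (interp t) /\ A (interp t) = S (t - a) z.
Proof.
move=> ta; rewrite interp_orbit //; apply: (gen_comm sg); last exact: Dy.
by rewrite subr_ge0.
Qed.

Lemma residual_orbit t : a <= t -> residual t = 0.
Proof. by move=> ta; rewrite /residual dinterp_orbit // (A_interp_orbit ta).2 subrr. Qed.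

Lemma residual_cell n t : (n < N)%N -> n%:R * h <= t < n.+1%:R * h ->
  residual t = slope n - A (y n) - (t - n%:R * h)%:C *: A (slope n).
Proof.
move=> nN tn; rewrite /residual (dinterp_cell nN tn).
have /andP[t1 t2] := tn.
rewrite (A_interp_cell nN _).2 ?t1 ?(ltW t2) //.
by lin.
Qed.

(** On a cell the residual is the convex combination of slope - A y_n and slope - A y_(n+1) with
    weights 1 - q and q; this is why [discrete_estimate] asks for both bounds. *)
Lemma residual_le n t (e : R) : (n < N)%N -> n%:R * h <= t < n.+1%:R * h ->
  rnorm (slope n - A (y n)) <= e -> rnorm (slope n - A (y n.+1)) <= e ->
  rnorm (residual t) <= e.
Proof.
move=> nN tn e1 e2; rewrite (residual_cell nN tn); pose q := (t - n%:R * h) / h.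
have /andP[t1 t2] := tn.
have q0 : 0 <= q by rewrite divr_ge0 ?subr_ge0 // ltW.
have q1 : q <= 1.
  by rewrite ler_pdivrMr // mul1r lerBlDl; apply: ltW; move: t2; rewrite -natr1 mulrDl mul1r.
have -> : slope n - A (y n) - (t - n%:R * h)%:C *: A (slope n) =
    (1 - q)%:C *: (slope n - A (y n)) + q%:C *: (slope n - A (y n.+1)).
  have -> : (t - n%:R * h)%:C = q%:C * h%:C :> R[i] by rewrite -rmorphM /= divfK ?gt_eqF.
  rewrite (Dslope nN).2 fmorphV rmorphB rmorph1 /=.
  move: (h%:C : R[i]) hC (q%:C : R[i]) => b b0 c.
  by lin.
apply: le_trans (rnormD _ _) _; rewrite !rnormZr !ger0_norm ?subr_ge0 //.
have := ler_wpM2l q0 e2; have q1' : 0 <= 1 - q by rewrite subr_ge0.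
have := ler_wpM2l q1' e1; lra.
Qed.

Lemma is_deriv_cell n t : (n < N)%N -> n%:R * h < t < n.+1%:R * h ->
  is_deriv interp t (slope n).
Proof.
move=> nN /andP[t1 t2]; apply/cvg_rnormP => e e0.
pose d := Num.min (t - n%:R * h) (n.+1%:R * h - t).
have d0 : 0 < d by rewrite lt_min !subr_gt0 t1.
near=> k; have k0 : k != 0 by near: k; exact: nbhs_dnbhs_neq.
have kd : `|k| < d by near: k; apply: dnbhs0_lt.
have kd1 : `|k| < t - n%:R * h by apply: lt_le_trans kd _; rewrite ge_min lexx.
have kd2 : `|k| < n.+1%:R * h - t by apply: lt_le_trans kd _; rewrite ge_min lexx orbT.
have n1 : - `|k| <= k by rewrite lerNl ler_normr lexx orbT.
have n2 := ler_norm k.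
rewrite !(interp_cell nN); last 2 first.
- by rewrite !ltW.
- by apply/andP; split; lra.
have -> : (k^-1)%:C *: (y n + (t + k - n%:R * h)%:C *: slope n -
   (y n + (t - n%:R * h)%:C *: slope n)) - slope n = 0.
  have -> : (t + k - n%:R * h)%:C = (t - n%:R * h)%:C + k%:C :> R[i].
    by rewrite -rmorphD /=; congr (_%:C); ring.
  have -> : (k^-1)%:C = (k%:C)^-1 :> R[i] by rewrite fmorphV.
  have kC : k%:C != 0 :> R[i] by rewrite -cabs_gt0 cabsC normr_gt0.
  move: (k%:C : R[i]) kC ((t - n%:R * h)%:C : R[i]) => b b0 c.
  by lin.
by rewrite rnorm0.
Unshelve. all: by end_near. Qed.

(** [sg_gen] yields the right derivative. On the left, S (t - s) is factored out and strong
    continuity at [A x] is used in addition. *)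
Lemma is_deriv_orbit x t : 0 < t -> DA x -> is_deriv (fun s => S s x) t (S t (A x)).
Proof.
move=> t0 Dx; apply/cvg_rnormP => e e0.
have [K K1 HK] := sg_bounded sg t; have K0 : 0 < K by lra.
have e1 : 0 < e / 3 / K by rewrite !divr_gt0.
have [d1 d10 H1] := (sg_gen sg x (A x)).1 (conj Dx erefl) _ e1.
have [d2 d20 H2] := sg_cont sg (A x) e1.
pose d := Num.min t (Num.min d1 d2).
have d0 : 0 < d by rewrite !lt_min t0 d10.
have aux s : 0 < s <= d -> rnorm ((s^-1)%:C *: (S s x - x) - A x) <= e / 3 / K /\
    rnorm (S s (A x) - A x) <= e / 3 / K.
  move=> /andP[s0]; rewrite !le_min => /andP[_ /andP[sd1 sd2]].
  by split; [apply: H1; rewrite s0|apply: H2; rewrite (ltW s0)].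
have Ke : K * (e / 3 / K) = e / 3 by rewrite mulrC divfK ?gt_eqF.
near=> k; have k0 : k != 0 by near: k; exact: nbhs_dnbhs_neq.
have kd : `|k| <= d by near: k; apply: dnbhs0_le.
have kt : `|k| <= t by apply: le_trans kd _; rewrite ge_min lexx.
have [kp|kn] := ltrP 0 k.
  rewrite gtr0_norm // in kd kt; have [A1 _] := aux k (introT andP (conj kp kd)).
  rewrite (sgD sg) ?(ltW t0) ?(ltW kp) //.
  have -> : (k^-1)%:C *: (S t (S k x) - S t x) - S t (A x) =
      S t ((k^-1)%:C *: (S k x - x) - A x).
    by rewrite (linear_opB _ _ (sg_lin sg t)) (linear_opZ _ _ (sg_lin sg t))
         (linear_opB _ _ (sg_lin sg t)).
  apply: le_lt_trans (HK _ _ _) _; first by rewrite lexx ltW.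
  by apply: le_lt_trans (ler_wpM2l (ltW K0) A1) _; rewrite Ke; lra.
have kn' : k < 0 by rewrite lt_neqAle k0.
pose s := - k; have s0 : 0 < s by rewrite oppr_gt0.
have sE : k = - s by rewrite opprK.
rewrite sE normrN gtr0_norm // in kd kt *.
have [A1 A2] := aux s (introT andP (conj s0 kd)).
have ts : 0 <= t - s by rewrite subr_ge0.
have E1 v : S t v = S (t - s) (S s v) by rewrite -(sgD sg) ?(ltW s0) // subrK.
have -> : ((- s)^-1)%:C *: (S (t - s) x - S t x) - S t (A x) =
    S (t - s) (((s^-1)%:C *: (S s x - x) - A x) - (S s (A x) - A x)).
  rewrite !E1 !(linear_opB _ _ (sg_lin sg (t - s))) (linear_opZ _ _ (sg_lin sg _)).
  rewrite !(linear_opB _ _ (sg_lin sg (t - s))) invrN rmorphN /=.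
  by lin.
apply: le_lt_trans (HK _ _ _) _; first by rewrite ts gerBl ltW.
apply: le_lt_trans (ler_wpM2l (ltW K0) (le_trans (rnorm_triB _ _) (lerD A1 A2))) _.
by rewrite mulrDr Ke; lra.
Unshelve. all: by end_near. Qed.

Lemma is_deriv_interp t : 0 < t -> (forall n, t != n%:R * h) ->
  is_deriv interp t (dinterp t).
Proof.
move=> t0 tn; have [ta|] := ltrP t a.
  have [n nN /andP[t1 t2]] := cellP (introT andP (conj (ltW t0) ta)).
  rewrite (dinterp_cell nN) ?t1 //; apply: is_deriv_cell => //.
  by rewrite t2 andbT lt_neqAle eq_sym tn.
rewrite le_eqVlt => /orP[/eqP ta|ta]; first by have := tn N; rewrite -ta eqxx.
rewrite dinterp_orbit ?(ltW ta) //.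
have ta0 : 0 < t - a by rewrite subr_gt0.
apply/cvg_rnormP => e e0.
have H : \forall k \near (0 : R)^', rnorm ((k^-1)%:C *:
    (S (t - a + k) (y N) - S (t - a) (y N)) - S (t - a) z) < e.
  by move: (is_deriv_orbit ta0 (Dy (leqnn N))) => /cvg_rnormP; apply.
near=> k.
have kd : `|k| < t - a by near: k; apply: dnbhs0_lt.
have n1 : - `|k| <= k by rewrite lerNl ler_normr lexx orbT.
rewrite !interp_orbit ?(ltW ta) //; last by lra.
have -> : t + k - a = t - a + k by ring.
by near: k.
Unshelve. all: by end_near. Qed.

Lemma bochner_interp t : 0 <= t -> is_bochner (ext0 [set s | 0 <= s <= t] dinterp) (interp t).
Proof.
move=> t0; pose b := Num.min a t; pose w := Num.max (t - a) 0.
have w0 : 0 <= w by rewrite le_max lexx orbT.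
have b0 : 0 <= b by rewrite le_min a0.
have bw : b + w = t.
  have [at_|ta] := lerP a t.
    by rewrite /b /w min_l // max_l ?subr_ge0 // addrC subrK.
  by rewrite /b /w min_r ?(ltW ta) // max_r ?subr_le0 ?(ltW ta) // addr0.
apply: (@bochner_pw _ _ _ _ t) => // [r nr|e e0]; first exact: ext0_out.
have [K K1 HK] := sg_bounded sg w; have K0 : 0 < K by lra.
have eK : 0 < e / K by rewrite divr_gt0.
have [d d0 Hd] := sg_cont sg z eK.
have [m [m0 md Hm]] : exists m, [/\ (0 < m)%N, w / m%:R <= d &
    rnorm (S w (y N) - y N - (w / m%:R)%:C *: \sum_(0 <= k < m) S (k%:R * (w / m%:R)) z) <= e].
  have [wz|wn] := eqVneq w 0.
    exists 1%N; split=> //; first by rewrite wz mul0r ltW.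
    by rewrite wz (sg0 sg) mul0r scale0r subrr subr0 rnorm0 ltW.
  have wp : 0 < w by rewrite lt_neqAle eq_sym wn.
  have [M1 HM1] := orbit_riemann sg wp e0 (Dy (leqnn N)).
  have [M2 HM2] := nat_gt (w / d); exists (maxn M1 M2).+1; split=> //.
    rewrite ler_pdivrMr // mulrC -ler_pdivrMr //; apply: ltW; apply: lt_le_trans HM2 _.
    by rewrite ler_nat leqW // leq_maxr.
  by apply: HM1 => //; rewrite leqW // leq_maxl.
pose u := w / m%:R; rewrite -/u in md Hm.
have mR : 0 < m%:R :> R by rewrite ltr0n.
have u0 : 0 <= u by rewrite divr_ge0 // ltW.
have mu_ : m%:R * u = w by rewrite /u mulrCA divff ?gt_eqF // mulr1.
(* [N] cells cut off at [b], then [m] cells of length [u] up to [t]. The minima make [s] monotone on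
   all indices, and constant past N + m. *)
pose s i : R := Num.min (i%:R * h) b + (minn (i - N) m)%:R * u.
have sN i : (i <= N)%N -> s i = Num.min (i%:R * h) t.
  move=> iN; rewrite /s; have -> : (i - N = 0)%N by apply/eqP; rewrite subn_eq0.
  rewrite min0n mul0r addr0 /b minA; congr Num.min; apply: min_idPl.
  by rewrite ler_pM2r // ler_nat.
have sNk k : (k <= m)%N -> s (N + k)%N = b + k%:R * u.
  move=> km; rewrite /s addKn (minn_idPl km); congr (_ + _); apply: min_idPr.
  by rewrite /b ge_min /a ler_pM2r // ler_nat leq_addr.
have snd : nondecreasing_seq s.
  move=> i j ij; apply: lerD; last first.
    by rewrite ler_wpM2r // ler_nat leq_min geq_minr (leq_trans (geq_minl _ _)) // leq_sub2r.
  rewrite le_min; apply/andP; split; rewrite ge_min ?lexx ?orbT //; apply/orP; left.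
  by rewrite ler_pM2r // ler_nat.
have s00 : s 0%N = 0 by rewrite sN // mul0r; apply: min_idPl.
have s_ge0 i : 0 <= s i by rewrite -s00; apply: snd.
have s_le i : s i <= t.
  have [iN|Ni] := leqP i N; first by rewrite sN // ge_min lexx orbT.
  rewrite -bw /s; apply: lerD; first by rewrite ge_min lexx orbT.
  by rewrite -mu_ ler_wpM2r // ler_nat geq_minr.
have sT : s (N + m)%N = t by rewrite sNk // mu_ bw.
(* Cell 0 is the null set {t}: the domain is the closed interval up to [t], the other cells are half
   open, and the approximation has to be uniform. *)
pose I n : set R := if n is i.+1 then `[s i, s i.+1[%classic else [set t].
pose c n : X := if n is i.+1 then (if (i < N)%N then slope i else S ((i - N)%:R * u) z)
                else dinterp t.
have [tI mI fI] := pieces_itv snd.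
have pI : pieces I.
  split=> [[|i] [|j] _ _ [r [/=]]||]; rewrite ?in_itv /=.
  - by [].
  - by move=> -> /andP[_]; rewrite ltNge s_le.
  - by move=> /andP[_ r2] rt; move: r2; rewrite rt ltNge s_le.
  - move=> r1 r2; congr _.+1; apply: (tI i j) => //; exists r.
    by split; rewrite /= in_itv.
  - by move=> [|i]; [apply: measurable_set1|apply: mI].
  - by move=> [|i]; [rewrite lebesgue_measure_set1 ltry|apply: fI].
have tI' : trivIset setT I by case: pI.
exists (N + m).+1, I, c; split=> // [r|r nr|].
- have [rt|rt] := pselect (0 <= r <= t); last first.
    rewrite ext0_out // pw_out ?subrr ?rnorm0 ?(ltW e0) // => -[|i] _ /=.
      by move=> E; apply: rt; rewrite E t0 lexx.
    rewrite in_itv /= => /andP[r1 r2]; apply: rt.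
    by rewrite (le_trans (s_ge0 i) r1) (le_trans (ltW r2)).
  rewrite ext0_in //.
  have [->|rneq] := eqVneq r t.
    by rewrite (pw_in c tI' (ltn0Sn _) (erefl t : I 0%N t)) subrr rnorm0 ltW.
  have /andP[r0 rle] := rt; have rlt : r < t by rewrite lt_neqAle rneq.
  have [|i iNm /andP[r1 r2]] := @bracket _ s (N + m) r; first by rewrite s00 r0 sT.
  have Ir : I i.+1 r by rewrite /I /= in_itv /= r1.
  rewrite (pw_in c tI' _ Ir) ?ltnS // /c; case: ltnP => iN.
    rewrite (sN i (ltnW iN)) in r1; rewrite (sN i.+1 iN) in r2.
    have r2' : r < i.+1%:R * h by apply: lt_le_trans r2 _; rewrite ge_min lexx.
    have r1' : i%:R * h <= r by move: r1; rewrite ge_min [t <= r]leNgt rlt orbF.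
    by rewrite (dinterp_cell iN) ?r1' // subrr rnorm0 ltW.
  pose k := (i - N)%N; have iE : i = (N + k)%N by rewrite subnKC.
  have km : (k < m)%N by rewrite -(ltn_add2l N) -iE.
  rewrite -/k iE in r1 r2 *; rewrite sNk ?(ltnW km) // in r1.
  rewrite -addnS sNk // in r2.
  have wp : 0 < w.
    rewrite lt_neqAle w0 andbT; apply/negP => /eqP wz.
    by move: r1 r2; rewrite /u -wz !(mul0r, mulr0) => r1; rewrite ltNge r1.
  have ba : b = a.
    rewrite /b; apply: min_idPl; move: wp; rewrite /w lt_max ltxx orbF subr_gt0.
    exact: ltW.
  rewrite ba in r1 r2.
  have ku0 : 0 <= k%:R * u by rewrite mulr_ge0.
  have ar : a <= r by apply: le_trans r1; rewrite lerDl.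
  rewrite dinterp_orbit //.
  pose q := r - a - k%:R * u; have q0 : 0 <= q by rewrite /q; lra.
  have qu : q <= u by move: r2; rewrite /q -natr1 mulrDl mul1r; lra.
  have -> : r - a = k%:R * u + q by rewrite /q; ring.
  rewrite (sgD sg) // -(linear_opB _ _ (sg_lin sg _)).
  apply: le_trans (HK _ _ _) _.
    by rewrite ku0 -mu_ ler_wpM2r // ler_nat ltnW.
  apply: le_trans (ler_wpM2l (ltW K0) (Hd q _)) _; first by rewrite q0 (le_trans qu).
  by rewrite mulrC divfK ?gt_eqF.
- rewrite pw_out // => -[|i] _ /=; first by move=> E; apply: nr; rewrite E t0 lexx.
  rewrite in_itv /= => /andP[r1 r2]; apply: nr.
  by rewrite (le_trans (s_ge0 i) r1) (le_trans (ltW r2)).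
rewrite big_ord_recl /= lebesgue_measure_set1 scale0r add0r.
have -> : \sum_(i < N + m) (fine (mu (I (bump 0 i))))%:C *: c (bump 0 i) =
    \sum_(0 <= i < N) (clip i t)%:C *: slope i +
    u%:C *: \sum_(0 <= k < m) S (k%:R * u) z.
  rewrite -(big_mkord xpredT (fun i => (fine (mu (I (bump 0 i))))%:C *: c (bump 0 i))).
  have E i : (fine (mu (I (bump 0 i))))%:C *: c (bump 0 i) = (s i.+1 - s i)%:C *:
      (if (i < N)%N then slope i else S ((i - N)%:R * u) z).
    by rewrite /= measure_itvco ?snd.
  rewrite (eq_bigr _ (fun i _ => E i)) (big_cat_nat (n := N)) ?leq_addr //; congr (_ + _).
    rewrite !big_nat; apply: eq_bigr => i /andP[_ iN].
    by rewrite iN (sN i.+1 iN) (sN i (ltnW iN)).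
  rewrite -{1}[N]add0n (big_addn 0) addKn scaler_sumr !big_nat; apply: eq_bigr => k /andP[_ km].
  rewrite [(k + N)%N]addnC -addnS (sNk k (ltnW km)) (sNk k.+1 km).
  rewrite addnS ltnNge leq_addr addKn; congr (_%:C *: _).
  by rewrite -natr1; ring.
rewrite /interp -/w -/u.
have -> : \sum_(0 <= i < N) (clip i t)%:C *: slope i + u%:C *: (\sum_(0 <= k < m) S (k%:R * u) z) -
   (\sum_(0 <= n < N) (clip n t)%:C *: slope n + (S w (y N) - y N)) =
   - (S w (y N) - y N - u%:C *: (\sum_(0 <= k < m) S (k%:R * u) z)).
  by lin.
by rewrite rnormN.
Qed.

Lemma strongly_measurable_residual : strongly_measurable (ext0 [set t | 0 <= t] residual).
Proof.
apply: strongly_measurable_pw => e e0.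
pose B := \sum_(n < N) rnorm (A (slope n)).
have B0 : 0 <= B by apply: sumr_ge0 => n _; apply: rnorm_ge0.
have BA n : (n < N)%N -> rnorm (A (slope n)) <= B.
  move=> nN; rewrite /B (bigD1 (Ordinal nN)) //= lerDl.
  by apply: sumr_ge0 => i _; apply: rnorm_ge0.
(* The residual is affine on each cell and vanishes from [a] on, so its values at the nodes of an
   [m]-fold refinement approximate it uniformly. *)
have [m0 Hm] := nat_gt (h * B / e); pose m := m0.+1; pose u := h / m%:R.
have mR : 0 < m%:R :> R by [].
have u0 : 0 < u by rewrite divr_gt0.
have hu : h = m%:R * u by rewrite /u mulrCA divff ?gt_eqF // mulr1.
have uB : u * B <= e.
  rewrite /u mulrAC ler_pdivrMr // [leRHS]mulrC -ler_pdivrMr //; apply: ltW.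
  by apply: lt_le_trans Hm _; rewrite ler_nat.
pose s (j : nat) := j%:R * u.
have snd : nondecreasing_seq s by move=> i j ij; rewrite /s ler_pM2r // ler_nat.
have pI := pieces_itv snd; have [tI _ _] := pI.
exists (N * m)%N, (fun n => `[s n, s n.+1[%classic), (fun j => residual (s j)); split=> // t.
have sa : s (N * m)%N = a by rewrite /s natrM -mulrA -hu.
have s0 j : 0 <= s j by rewrite mulr_ge0 // ltW.
have out : ~ (0 <= t < a) -> pw (N * m) (fun n => `[s n, s n.+1[%classic) (fun j => residual (s j)) t = 0.
  move=> nt; apply: pw_out => j jN /=; rewrite in_itv /= => /andP[t1 t2]; apply: nt.
  rewrite (le_trans (s0 j) t1) (lt_le_trans t2) //.
  by rewrite -sa; apply: snd.
have [t0|tn] := lerP 0 t; last first.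
  have nt : ~ (0 <= t) by apply/negP; rewrite -ltNge.
  rewrite (@ext0_out _ _ [set t | 0 <= t] _ t nt) out; last by move=> /andP[/nt].
  by rewrite subrr rnorm0 ltW.
rewrite ext0_in //.
have [at_|ta] := lerP a t.
  rewrite residual_orbit // out; last by move=> /andP[_]; rewrite ltNge at_.
  by rewrite subrr rnorm0 ltW.
have [|j jN /andP[t1 t2]] := @bracket _ s (N * m) t; first by rewrite sa ta /s mul0r t0.
rewrite (pw_in _ tI jN) /=; last by rewrite in_itv /= t1.
pose n := (j %/ m)%N; have nN : (n < N)%N by rewrite ltn_divLR.
have n1 : n%:R * h <= s j.
  by rewrite hu /s mulrA -natrM ler_pM2r // ler_nat leq_divM.
have n2 : s j.+1 <= n.+1%:R * h.
  by rewrite hu /s mulrA -natrM ler_pM2r // ler_nat -ltn_divLR.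
rewrite (residual_cell nN) ?(le_trans n1 t1) ?(lt_le_trans t2 n2) //.
rewrite (residual_cell nN) ?n1 ?(lt_le_trans _ n2) //; last by apply: le_lt_trans t1 t2.
have -> : slope n - A (y n) - (t - n%:R * h)%:C *: A (slope n) -
   (slope n - A (y n) - (s j - n%:R * h)%:C *: A (slope n)) =
   - ((t - s j)%:C *: A (slope n)).
  have -> : (t - s j)%:C = (t - n%:R * h)%:C - (s j - n%:R * h)%:C :> R[i].
    by rewrite -rmorphB /=; congr (_%:C); ring.
  by lin.
rewrite rnormN rnormZr ger0_norm ?subr_ge0 //; apply: le_trans uB.
apply: ler_pM; rewrite ?rnorm_ge0 ?subr_ge0 ?BA //.
by move: t2; rewrite /s -natr1 mulrDl mul1r; lra.
Qed.

Lemma integral_residual_le (p : R) (e : nat -> R) : 0 < p ->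
  (forall n, 0 <= e n) ->
  (forall n, (n < N)%N -> rnorm (slope n - A (y n)) <= e n /\
                         rnorm (slope n - A (y n.+1)) <= e n) ->
  (\int[mu]_t (rnorm (ext0 [set t | 0 <= t] residual t) `^ p)%:E <=
   (h * \sum_(n < N) e n `^ p)%:E)%E.
Proof.
move=> p0 e0 He; have [tI _ _] := cells.
pose E n := e n `^ p; have E0 n : 0 <= E n by apply: powR_ge0.
apply: le_trans (le_integralT (g := fun t => (pw N (fun n => `[n%:R * h, n.+1%:R * h[%classic) E t)%:E) _ _) _.
- by move=> t; rewrite lee_fin powR_ge0.
- move=> t; rewrite lee_fin.
  have pw0 : 0 <= pw N (fun n => `[n%:R * h, n.+1%:R * h[%classic) E t.
    by apply: sumr_ge0 => n _; case: ifP.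
  have [t0|tn] := lerP 0 t; last first.
    have nt : ~ (0 <= t) by apply/negP; rewrite -ltNge.
    by rewrite (@ext0_out _ _ [set t | 0 <= t] _ t nt) rnorm0 powR0 ?gt_eqF.
  rewrite ext0_in //.
  have [at_|ta] := lerP a t.
    by rewrite residual_orbit // rnorm0 powR0 ?gt_eqF.
  have [|n nN tn] := @cellP t; first by rewrite t0 ta.
  rewrite (pw_in _ tI nN) /=; last by rewrite in_itv.
  have [e1 e2] := He n nN; rewrite ge0_ler_powR ?(ltW p0) ?nnegrE ?rnorm_ge0 //.
  exact: residual_le tn e1 e2.
rewrite (integral_pw _ cells E0) lee_fin mulr_sumr; apply: ler_sum => n _.
rewrite measure_itvco /=; last by apply: nodes_nd.
by rewrite -natr1 mulrDl mul1r addrAC subrr add0r mulrC.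
Qed.

(* On one of the two extreme quarters of a cell, the norm of an affine function
   is at least half of the larger of its end values. *)
Lemma integral_A_interp_ge (p : R) : 0 < p ->
  ((h / 4 * \sum_(n < N) (rnorm (A (y n.+1)) / 2) `^ p)%:E <=
   \int[mu]_t (rnorm (ext0 [set t | 0 <= t] (A \o interp) t) `^ p)%:E)%E.
Proof.
move=> p0; have [tI _ _] := cells.
(* The last quarter if the right end value is the larger one, the first quarter otherwise. There the
   larger value has weight at least 3/4, and 3/4 - 1/4 = 1/2. *)
pose o n : R := n%:R * h + if rnorm (A (y n)) <= rnorm (A (y n.+1)) then 3 * (h / 4) else 0.
pose J n : set R := `[o n, o n + h / 4[%classic.
have JI n t : J n t -> n%:R * h <= t < n.+1%:R * h.
  rewrite /J /= in_itv /= /o -natr1 mulrDl mul1r => /andP[].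
  by case: ifP => _ t1 t2; apply/andP; split; lra.
have pJ : pieces J.
  split=> [i j _ _ [t [Ji Jj]]||n].
  - apply: (tI i j) => //; exists t; split=> /=; rewrite in_itv /=; exact: JI.
  - by move=> n; apply: measurable_itv.
  - by rewrite lebesgue_measure_itv /=; case: ifP => //; rewrite ltry.
pose E n := (rnorm (A (y n.+1)) / 2) `^ p; have E0 n : 0 <= E n by apply: powR_ge0.
apply: le_trans (le_integralT (f := fun t => (pw N J E t)%:E) _ _); last 2 first.
- by move=> t; rewrite lee_fin; apply: sumr_ge0 => n _; case: ifP.
- move=> t; rewrite lee_fin; have [[n nN Jt]|H] := pselect (exists2 n, (n < N)%N & J n t); last first.
    by rewrite pw_out ?powR_ge0 // => n nN Jt; apply: H; exists n.
  have [tJ _ _] := pJ; rewrite (pw_in _ tJ nN Jt).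
  have /andP[t1 t2] := JI n t Jt.
  have t0 : 0 <= t by apply: le_trans t1; rewrite mulr_ge0 // ltW.
  rewrite ext0_in // ge0_ler_powR ?(ltW p0) ?nnegrE ?rnorm_ge0 ?divr_ge0 ?rnorm_ge0 //.
  rewrite /= (A_interp_cell nN _).2 ?t1 ?(ltW t2) // (Dslope nN).2.
  pose q := (t - n%:R * h) / h.
  have qh : t - n%:R * h = q * h by rewrite /q divfK ?gt_eqF.
  have q0 : 0 <= q by rewrite divr_ge0 ?subr_ge0 // ltW.
  have q1 : q <= 1.
    by rewrite ler_pdivrMr // mul1r lerBlDl; apply: ltW; move: t2; rewrite -natr1 mulrDl mul1r.
  have -> : A (y n) + (t - n%:R * h)%:C *: ((h^-1)%:C *: (A (y n.+1) - A (y n))) =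
      (1 - q)%:C *: A (y n) + q%:C *: A (y n.+1).
    rewrite qh rmorphM fmorphV rmorphB rmorph1 /=.
    by move: (h%:C : R[i]) hC (q%:C : R[i]) => b b0 c; lin.
  set x1 := A (y n); set x2 := A (y n.+1).
  have N1 := rnormB (q%:C *: x2) (- ((1 - q)%:C *: x1)).
  have N2 := rnormB ((1 - q)%:C *: x1) (- (q%:C *: x2)).
  rewrite opprK rnormN !rnormZr !ger0_norm ?subr_ge0 // [q%:C *: _ + _]addrC in N1.
  rewrite opprK rnormN !rnormZr !ger0_norm ?subr_ge0 // in N2.
  move: Jt; rewrite /J /= in_itv /= /o -/x1 -/x2.
  have hq : h * (1 / 4) = h / 4 by ring.
  have [le|le] := lerP (rnorm x1) (rnorm x2).
    move=> /andP[u1 u2].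
    have q34 : 3 / 4 <= q.
      by rewrite -(ler_pM2r h0) -qh; lra.
    have := rnorm_ge0 x1; have := rnorm_ge0 x2; nra.
  move=> /andP[u1 u2].
  have q14 : q <= 1 / 4 by rewrite -(ler_pM2r h0) -qh; lra.
  have := rnorm_ge0 x1; have := rnorm_ge0 x2; nra.
rewrite (integral_pw _ pJ E0) lee_fin mulr_sumr; apply: ler_sum => n _.
rewrite measure_itvco /=; last by rewrite lerDl divr_ge0 // ltW.
by rewrite addrAC subrr add0r mulrC.
Qed.

End Interpolant.

Definition discrete_estimate (R : realType) (X : completeNormedModType R[i])
    (DA : set X) (A : X -> X) (p C : R) : Prop :=
  forall (h : R) (N : nat) (y : nat -> X) (e : nat -> R),
    0 < h -> y 0%N = 0 -> (forall n, (n <= N)%N -> DA (y n)) ->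
    (forall n, 0 <= e n) ->
    (forall n, (n < N)%N -> rnorm (slope (h := h) (y := y) n - A (y n)) <= e n /\
                           rnorm (slope (h := h) (y := y) n - A (y n.+1)) <= e n) ->
    \sum_(n < N) rnorm (A (y n.+1)) `^ p <= C * \sum_(n < N) e n `^ p.

Lemma discrete_apriori (R : realType) (X : completeNormedModType R[i])
    (S : R -> X -> X) (DA : set X) (A : X -> X) (p : R) :
  0 < p -> semigroup_spec S DA A -> maximal_regularity p DA A ->
  exists2 C : R, 0 <= C & discrete_estimate DA A p C.
Proof.
(* The factor 4 comes from the quarter cells, the power of 2 from the halved values; [C0] may be
   negative, hence the absolute value. *)
move=> p0 sg [C0 HC]; pose C := `|C0| `^ p; exists (4 * 2 `^ p * C).
  by rewrite !mulr_ge0 ?powR_ge0.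
move=> h N y e h0 y0 Dy e0 He.
pose f := residual (S := S) (A := A) (h := h) (N := N) (y := y).
pose w := interp (S := S) (h := h) (N := N) (y := y).
pose dw := dinterp (S := S) (A := A) (h := h) (N := N) (y := y).
pose P : set R := [set t | 0 <= t].
have I1 := integral_residual_le sg h0 y0 Dy p0 e0 He.
have I2 := integral_A_interp_ge sg h0 y0 Dy p0.
rewrite -!Lpnorm_pow // in I1 I2.
have Lf : (Lpnorm p (ext0 P f) < +oo)%E.
  rewrite ltey; apply/eqP => E; move: I1; rewrite -/f -/P E poweRyr ?gt_eqF //.
have mf : in_Lp p (ext0 P f).
  by split=> //; apply: (strongly_measurable_residual sg h0 y0 Dy).
have sol : strong_solution DA A f w dw.
  split; first exact: (interp0 sg h0).
  - by move=> t t0; apply: (bochner_interp sg h0 Dy).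
  (* At the nodes the interpolant may fail to be differentiable; they form a countable null set. *)
  exists (range (fun n : nat => n%:R * h)).
  have cn : countable (range (fun n : nat => n%:R * h)).
    exact: card_image_le.
  split.
  - exact: countable_measurable.
  - exact: countable_lebesgue_measure0.
  move=> t /= H; apply: contrapT => nt; apply: H => t0.
  have tn n : t != n%:R * h by apply/eqP => tE; apply: nt; exists n.
  split; first exact: (is_deriv_interp sg h0 y0 Dy).
    have [ta|ta] := ltrP t (N%:R * h).
      have [n nN /andP[t1 t2]] := @cellP _ h N t (introT andP (conj (ltW t0) ta)).
      have t12 : n%:R * h <= t <= n.+1%:R * h by rewrite t1 ltW.
      by case: (A_interp_cell sg h0 y0 Dy nN t12).
    by case: (A_interp_orbit sg h0 y0 Dy ta).
  by rewrite /f /residual addrC subrK.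
have [_ /(_ w dw sol) H] := HC f mf.
have Ln g : (0 <= Lpnorm p (g : R -> X))%E by apply: Lnorm_ge0.
have {}H : (Lpnorm p (ext0 P (A \o w)) <= C0%:E * Lpnorm p (ext0 P f))%E.
  by apply: le_trans H; rewrite leeDr.
rewrite -/f -/w -/P in I1 I2.
have := Ln (ext0 P f); have := Ln (ext0 P (A \o w)); move: H I1 I2 Lf.
case: (Lpnorm p (ext0 P f)) => [b| |] //; case: (Lpnorm p (ext0 P (A \o w))) => [a| |] //.
rewrite -EFinM !poweR_EFin !lee_fin => ab I1 I2 _ a0 b0.
have apb : a `^ p <= C * b `^ p.
  rewrite -powRM // ge0_ler_powR ?(ltW p0) ?nnegrE ?mulr_ge0 //.
  by apply: le_trans ab _; rewrite ler_wpM2r // ler_norm.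
have C_ge0 : 0 <= C by apply: powR_ge0.
have := le_trans I2 (le_trans apb (ler_wpM2l C_ge0 I1)).
have -> : \sum_(n < N) rnorm (A (y n.+1)) `^ p =
    2 `^ p * \sum_(n < N) (rnorm (A (y n.+1)) / 2) `^ p.
  rewrite mulr_sumr; apply: eq_bigr => n _.
  by rewrite -powRM ?divr_ge0 ?rnorm_ge0 // mulrCA divff ?mulr1.
set s1 := \sum_(n < N) (_ / 2) `^ p; set s2 := \sum_(n < N) _.
rewrite mulrCA -[h / 4 * s1]mulrA ler_pM2l // ler_pdivrMl // => le.
rewrite -!mulrA mulrCA ler_wpM2l ?powR_ge0 //.
Qed.

(** * The two-step method *)

Section FromAnalytic.
Context {R : realType} {X : completeNormedModType R[i]}.

Lemma linear_continuous_bounded (T : {linear X -> X}) : continuous T ->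
  exists K : R, forall x, rnorm (T x) <= K * rnorm x.
Proof.
move=> /(_ 0) /cvg_rnormP /(_ 1 ltr01) /nbhs_ballP [e e0 He].
have eE : e = (complex.Re e)%:C by apply: ge0_complexE; apply: ltW.
move: (complex.Re e) eE => d eE; have d0 : 0 < d by rewrite -ltcR -eE.
exists (2 / d) => x; have := rnorm_ge0 x; rewrite le_eqVlt => /orP[/eqP x0|x0].
  by rewrite (rnorm_eq0 (esym x0)) linear0 rnorm0 mulr0.
pose c := d / (2 * rnorm x); have c0 : 0 < c by rewrite divr_gt0 // mulr_gt0.
have /He : ball 0 e (c%:C *: x).
  rewrite -ball_normE /= sub0r normrN rnormE eE ltcR rnormZr gtr0_norm //.
  rewrite /c mulrAC ltr_pdivrMr ?mulr_gt0 // ltr_pM2l //; lra.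
rewrite /= linear0 subr0 linearZ /= rnormZr gtr0_norm // => H.
rewrite -ler_pdivrMl ?divr_gt0 // invf_div.
have : c * rnorm (T x) <= 1 by apply: ltW.
rewrite /c mulrAC ler_pdivrMr ?mulr_gt0 // mul1r => H'.
by rewrite mulrAC ler_pdivrMr // [leRHS]mulrC.
Qed.

Lemma nbhs0_real (P : set R[i]^o) : nbhs (0 : R[i]^o) P ->
  exists2 d : R, 0 < d & forall t : R, 0 <= t <= d -> P t%:C.
Proof.
move=> /nbhs_ballP [e e0 He].
have eE : e = (complex.Re e)%:C by apply: ge0_complexE; apply: ltW.
move: (complex.Re e) eE => d eE; have d0 : 0 < d by rewrite -ltcR -eE.
exists (d / 2) => [|t /andP[t0 td]]; first by rewrite divr_gt0.
apply: He; rewrite -ball_normE /= sub0r normrN cabsE cabsC eE ltcR ger0_norm //.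
lra.
Qed.

Lemma cvg_right0P (f : R -> X) (y : X) : f t @[t --> (0 : R)^'+] --> y <->
  forall e : R, 0 < e -> exists2 d : R, 0 < d & forall t, 0 < t <= d -> rnorm (f t - y) <= e.
Proof.
split=> [/cvg_rnormP H e /H /nbhs_ballP [d d0 Hd]|H].
  exists (d / 2) => [|t /andP[t0 td]]; first by rewrite divr_gt0.
  apply: ltW; apply: Hd => //; rewrite -ball_normE /= sub0r normrN gtr0_norm //.
  have d0' : 0 < d := d0; lra.
apply/cvg_rnormP => e e0; have e2 : 0 < e / 2 by rewrite divr_gt0.
have [d d0 Hd] := H _ e2.
near=> t; have t0 : 0 < t by near: t; exact: nbhs_right_gt.
have td : t <= d by near: t; exact: nbhs_right_le.
apply: le_lt_trans (Hd t _) _; first by rewrite t0.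
lra.
Unshelve. all: by end_near. Qed.

Lemma analytic_semigroup_spec (DA : set X) (A : X -> X) :
  generates_analytic DA A -> exists S, semigroup_spec S DA A.
Proof.
move=> [theta [T [/andP[th0 _] [T0 TD Tc Td Ts] gen]]].
have sec (t : R) : 0 < t -> sector theta t%:C.
  move=> t0; exists t, 0; rewrite normr0 cos0 sin0 mulr1 mulr0; split=> //.
have secD (t s : R) x : 0 < t -> 0 < s -> T (t + s)%:C x = T t%:C (T s%:C x).
  by move=> t0 s0; rewrite rmorphD; apply: TD; apply: sec.
exists (fun t x => T t%:C x); split.
- by move=> t a b x y; rewrite linearD !linearZ.
- by move=> x; apply: T0.
- move=> t s x; rewrite le_eqVlt => /orP[/eqP<- _|t0]; first by rewrite add0r T0.
  rewrite le_eqVlt => /orP[/eqP<-|s0]; first by rewrite addr0 T0.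
  exact: secD.
- move=> t; rewrite le_eqVlt => /orP[/eqP<-|t0].
    by exists 1 => x; rewrite T0 mul1r.
  by apply: linear_continuous_bounded; apply: Tc; apply: sec.
- move=> x e e0; have /cvg_rnormP /(_ e e0) /nbhs0_real [d d0 Hd] := Ts x.
  exists d => // t /andP[]; rewrite le_eqVlt => /orP[/eqP<- _|t0 td].
    by rewrite T0 subrr rnorm0 ltW.
  by apply/ltW/Hd; [rewrite (ltW t0)|apply: sec].
- by move=> x y; rewrite gen; apply: cvg_right0P.
(* By the semigroup law, the complex difference quotient along real increments is that of the
   generator at the point T t x, which therefore lies in the domain. *)
- move=> t x t0; have /cvg_ex [l /cvg_rnormP Hl] := Td t%:C (sec t t0) x.
  suff [] : DA (T t%:C x) /\ A (T t%:C x) = l by [].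
  apply/gen/cvg_right0P => e /Hl /nbhs0_real [d d0 Hd].
  exists d => // s /andP[s0 sd]; apply: ltW.
  have := Hd s; rewrite (ltW s0) sd => /(_ isT).
  have sC : s%:C != 0 :> R[i] by rewrite -cabs_gt0 cabsC normr_gt0 gt_eqF.
  move=> /(_ sC) /=; rewrite /shift /= fmorphV.
  have -> : s%:C *: (1 : R[i]^o) + t%:C = (s + t)%:C.
    by rewrite rmorphD /= /GRing.scale /= mulr1.
  by rewrite secD.
Qed.

End FromAnalytic.

Lemma powR_root (R : realType) (p x : R) : 0 < p -> 0 <= x -> (x `^ p) `^ p^-1 = x.
Proof. by move=> p0 x0; rewrite -powRrM mulfV ?gt_eqF // powRr1. Qed.

Lemma powR_exprn (R : realType) (p x : R) n : 0 <= x -> (x ^+ n) `^ p = (x `^ p) ^+ n.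
Proof.
move=> x0; elim: n => [|n IH]; first by rewrite !expr0 powR1.
by rewrite !exprS powRM ?exprn_ge0 // IH.
Qed.

Lemma sum_widen_le (R : realType) (k : nat -> R) (m n : nat) : (forall i, 0 <= k i) ->
  (m <= n)%N -> \sum_(i < m) k i <= \sum_(i < n) k i.
Proof.
by move=> k0 /subnKC <-; rewrite big_split_ord lerDl sumr_ge0.
Qed.

(** * Resolvent bounds from geometric sequences *)

Section Apriori.
Context {R : realType} {X : completeNormedModType R[i]}.
Context {DA : set X} {A : X -> X} {p C : R}.
Context (p0 : 0 < p).
Context (C_ge0 : 0 <= C).
Context (A_lin : forall (a b : R[i]) x y, DA x -> DA y ->
  DA (a *: x + b *: y) /\ A (a *: x + b *: y) = a *: A x + b *: A y).
Context (est : discrete_estimate DA A p C).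
Local Ltac lin := linear_with (R[i]) X ltac:(first [by ring | by field]).

Let C0 := C `^ p^-1.

(* The geometric sequence [(1 + z h)^n y] solves the difference equation
   [(y_(n+1) - y_n) / h = z y_n], so it is an approximate solution with residual
   proportional to [z y - A y]. *)
Lemma apriori_step (z : R[i]) y (h : R) : 0 < complex.Re z -> DA y -> 0 < h ->
  rnorm (A y) <= C0 * (rnorm (z *: y - A y) + cabs z * h * rnorm (A y)).
Proof.
move=> z0 Dy h0; set E := rnorm _ + _.
have E0 : 0 <= E by rewrite addr_ge0 ?mulr_ge0 ?rnorm_ge0 ?cabs_ge0 // ltW.
pose q : R[i] := 1 + z * h%:C; pose Q := cabs q.
have Q1 : 1 <= Q.
  apply: le_trans (Re_le_cabs _); rewrite ReD mulrC ReZ /= lerDl.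
  by rewrite mulr_ge0 // ltW.
have Q0 : 0 <= Q by rewrite (le_trans _ Q1).
pose r := Q `^ p; have r1 : 1 <= r.
  have -> : 1 = 1 `^ p :> R by rewrite powR1.
  by rewrite ge0_ler_powR ?(ltW p0) ?nnegrE.
have r0 : 0 <= r by rewrite (le_trans _ r1).
have DZ (a : R[i]) : DA (a *: y) /\ A (a *: y) = a *: A y.
  by have := A_lin a 0 Dy Dy; rewrite !scale0r !addr0.
(* The sequence has to start at 0. The jump to q y leaves the first residual [K0], which is
   unrelated to [E] but does not depend on the length of the sequence. *)
pose Y (n : nat) : X := if n is m.+1 then q ^+ m.+1 *: y else 0.
have DY n : DA (Y n).
  by case: n => [|n]; [have := (DZ 0).1; rewrite scale0r|apply: (DZ _).1].
have A0 : A 0 = 0 by have := (DZ 0).2; rewrite !scale0r.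
pose sl := slope (h := h) (y := Y).
pose K0 := rnorm (sl 0%N - A (Y 0%N)) + rnorm (sl 0%N - A (Y 1%N)).
pose e n := if n is m.+1 then Q ^+ m.+1 * E else K0.
have e0 n : 0 <= e n.
  case: n => [|n]; first by rewrite addr_ge0 ?rnorm_ge0.
  by rewrite mulr_ge0 ?exprn_ge0.
have hC : h%:C != 0 :> R[i] by rewrite -cabs_gt0 cabsC gtr0_norm.
have He n : rnorm (sl n - A (Y n)) <= e n /\ rnorm (sl n - A (Y n.+1)) <= e n.
  case: n => [|n]; first by rewrite lerDl lerDr !rnorm_ge0.
  have slE : sl n.+1 = (z * q ^+ n.+1) *: y.
    have hE : (h^-1)%:C = (h%:C)^-1 :> R[i] by rewrite fmorphV.
    rewrite /sl /slope /= hE !exprS /q; move: (h%:C : R[i]) hC => b b0.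
    by move: ((1 + z * b) ^+ n : R[i]) => c; lin.
  rewrite slE !(DZ _).2 [q ^+ n.+2]exprS; split.
    have -> : (z * q ^+ n.+1) *: y - q ^+ n.+1 *: A y = q ^+ n.+1 *: (z *: y - A y).
      by move: (q ^+ n.+1) => c; lin.
    rewrite rnormZ cabsX ler_wpM2l ?exprn_ge0 // lerDl.
    by rewrite !mulr_ge0 ?cabs_ge0 ?rnorm_ge0 // ltW.
  have -> : (z * q ^+ n.+1) *: y - (q * q ^+ n.+1) *: A y =
      q ^+ n.+1 *: ((z *: y - A y) - (z * h%:C) *: A y).
    by move: (q ^+ n.+1) => c; rewrite /q; lin.
  rewrite rnormZ cabsX ler_wpM2l ?exprn_ge0 //; apply: le_trans (rnorm_triB _ _) _.
  by rewrite rnormZ cabsM cabsC (gtr0_norm h0).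
have powE n (s : R) : 0 <= s -> (Q ^+ n * s) `^ p = r ^+ n * s `^ p.
  by move=> s0; rewrite powRM ?exprn_ge0 // powR_exprn.
pose a := rnorm (A y) `^ p; have a0 : 0 <= a by apply: powR_ge0.
(* If a > C E^p, the left side would grow at least linearly in [N], since r >= 1; the fixed right
   side excludes this. *)
have main N : \sum_(n < N) r ^+ n.+1 * (a - C * E `^ p) <= C * K0 `^ p.
  have := est h0 (erefl : Y 0%N = 0) (fun n _ => DY n) e0 (fun n (_ : (n < N.+1)%N) => He n).
  rewrite big_ord_recr /= [X in _ <= _ * X]big_ord_recl /= => H.
  under eq_bigr => i _ do rewrite mulrBr.
  rewrite sumrB lerBlDr; move: H; rewrite mulrDr => H.
  have -> : \sum_(i < N) r ^+ i.+1 * (C * E `^ p) = C * \sum_(i < N) (Q ^+ (0 + i).+1 * E) `^ p.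
    by rewrite mulr_sumr; apply: eq_bigr => i _; rewrite powE // mulrCA.
  apply: le_trans H; rewrite -[leLHS]addr0 lerD ?powR_ge0 //.
  apply: ler_sum => i _; rewrite (DZ _).2 rnormZ cabsX powE ?rnorm_ge0 //.
have aE : a <= C * E `^ p.
  rewrite leNgt; apply/negP => lt; rewrite -subr_gt0 in lt.
  have [n Hn] := nat_gt (C * K0 `^ p / (a - C * E `^ p)).
  rewrite ltr_pdivrMr // in Hn; have := le_lt_trans (main n) Hn.
  rewrite ltNge => /negP; apply; rewrite mulr_natl.
  have -> : (a - C * E `^ p) *+ n = \sum_(i < n) (a - C * E `^ p).
    by rewrite sumr_const card_ord.
  by apply: ler_sum => i _; rewrite ler_peMl ?(ltW lt) // exprn_ege1.
have p0' := ltW p0.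
rewrite -[leLHS](powR_root p0) ?rnorm_ge0 // -[E in leRHS](powR_root p0) //.
by rewrite -powRM ?powR_ge0 // ge0_ler_powR ?invr_ge0 ?nnegrE ?mulr_ge0 ?powR_ge0.
Qed.

Lemma apriori_of_discrete (z : R[i]) y : 0 < complex.Re z -> DA y ->
  rnorm (A y) <= C0 * rnorm (z *: y - A y).
Proof.
move=> z0 Dy; apply/ler_addgt0Pr => e e0.
have C00 : 0 <= C0 by apply: powR_ge0.
pose k := C0 * (cabs z * rnorm (A y)).
have k0 : 0 <= k by rewrite !mulr_ge0 ?cabs_ge0 ?rnorm_ge0.
have h0 : 0 < e / (k + 1) by rewrite divr_gt0 // ltr_wpDl.
have := apriori_step z0 Dy h0; rewrite mulrDr => H; apply: le_trans H _.
rewrite lerD2l; have -> : C0 * (cabs z * (e / (k + 1)) * rnorm (A y)) = e * k / (k + 1).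
  by rewrite /k; ring.
by rewrite ler_pdivrMr ?ltr_wpDl // ler_pM2l // lerDl ler01.
Qed.

End Apriori.

(** * Young's inequality for convolutions *)

Section Convolution.
Context {R : realType} {p : R}.
Context (p1 : 1 < p).
Let p0 : 0 < p. Proof. exact: lt_trans p1. Qed.

(** The p-th power lies above its tangent at s. This takes the place of Hoelder's inequality in
    [young_conv]. *)
Lemma powR_tangent (t s : R) : 0 <= t -> 0 <= s ->
  p * (t * s `^ (p - 1)) <= t `^ p + (p - 1) * s `^ p.
Proof.
move=> t0 s0.
have q0 : 0 < p / (p - 1) by rewrite divr_gt0 // subr_gt0.
have pq : p^-1 + (p / (p - 1))^-1 = 1.
  by rewrite invf_div; field; rewrite gt_eqF.
have := conjugate_powR t0 (powR_ge0 s (p - 1)) p0 q0 pq.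
rewrite -powRrM mulrCA divff ?mulr1; last by rewrite subr_eq0 gt_eqF.
rewrite invf_div => H; have := ler_wpM2l (ltW p0) H.
have -> // : p * (t `^ p / p + s `^ p * ((p - 1) / p)) = t `^ p + (p - 1) * s `^ p.
by field; rewrite gt_eqF.
Qed.

Lemma powRD_le (x y : R) : 0 <= x -> 0 <= y -> (x + y) `^ p <= 2 `^ p * (x `^ p + y `^ p).
Proof.
move=> x0 y0.
wlog xy : x y x0 y0 / x <= y.
  by move=> H; have [/H->//|/ltW yx] := lerP x y; rewrite addrC [x `^ p + _]addrC H.
apply: (@le_trans _ _ ((2 * y) `^ p)).
  by rewrite ge0_ler_powR ?(ltW p0) ?nnegrE ?addr_ge0 ?mulr_ge0 //; lra.
by rewrite powRM // ler_wpM2l ?powR_ge0 // lerDr powR_ge0.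
Qed.

Lemma sum_conv (k b : nat -> R) (K : R) (N : nat) : (forall n, 0 <= k n) ->
  (forall n, 0 <= b n) -> \sum_(n < N) k n <= K ->
  \sum_(n < N) \sum_(m < n.+1) k (n - m)%N * b m <= K * \sum_(n < N) b n.
Proof.
move=> k0 b0 kK.
have -> : \sum_(n < N) \sum_(m < n.+1) k (n - m)%N * b m =
    \sum_(n < N) \sum_(m < N | (m < n.+1)%N) k (n - m)%N * b m.
  by apply: eq_bigr => n _; rewrite (big_ord_widen N (fun m => k (n - m)%N * b m)).
rewrite (exchange_big_dep xpredT) //= mulr_sumr; apply: ler_sum => m _.
rewrite -mulr_suml ler_wpM2r //; apply: le_trans kK.
rewrite -(big_mkord (fun n => m < n.+1)%N (fun n => k (n - m)%N)).
rewrite -(big_nat_widenl m 0 N xpredT) // -{1}[nat_of_ord m]add0n big_addn.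
under eq_bigr => i _ do rewrite addnK.
by rewrite big_mkord sum_widen_le // leq_subr.
Qed.

(** With s = S / K, the tangent inequality at s_n is averaged against the kernel. The terms (p - 1)
    K s_n^p go to the left, which leaves K s_n^p bounded by the convolution of k with a^p, and
    [sum_conv] sums over n. *)
Lemma young_conv (k a S : nat -> R) (K : R) (N : nat) : 0 < K -> (forall n, 0 <= k n) ->
  (forall n, 0 <= a n) -> \sum_(n < N) k n <= K ->
  (forall n, 0 <= S n <= \sum_(m < n.+1) k (n - m)%N * a m) ->
  \sum_(n < N) S n `^ p <= K `^ p * \sum_(n < N) a n `^ p.
Proof.
move=> K0 k0 a0 kK HS.
pose s n := S n / K; have s0 n : 0 <= s n.
  by rewrite divr_ge0 ?(ltW K0) //; case/andP: (HS n).
have SE n : S n `^ p = K `^ p * s n `^ p.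
  by rewrite -powRM ?(ltW K0) // mulrCA divff ?mulr1 ?gt_eqF.
under eq_bigr => n _ do rewrite SE.
rewrite -mulr_sumr ler_wpM2l ?powR_ge0 // -(ler_pM2l K0).
apply: le_trans (sum_conv k0 (fun m => powR_ge0 (a m) p) kK).
rewrite mulr_sumr; apply: ler_sum => n _.
have kn : \sum_(m < n.+1) k (n - m)%N <= K.
  apply: le_trans kK; rewrite (reindex_inj rev_ord_inj) /=.
  under eq_bigr => i _ do rewrite subSS (subKn (leq_ord i)).
  exact: sum_widen_le.
have H : p * (S n * s n `^ (p - 1)) <=
   \sum_(m < n.+1) k (n - m)%N * (a m `^ p + (p - 1) * s n `^ p).
  case/andP: (HS n) => _ le.
  apply: (@le_trans _ _ (p * ((\sum_(m < n.+1) k (n - m)%N * a m) * s n `^ (p - 1)))).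
    by rewrite ler_wpM2l ?(ltW p0) // ler_wpM2r ?powR_ge0.
  rewrite mulr_suml mulr_sumr; apply: ler_sum => m _.
  rewrite -mulrA mulrCA ler_wpM2l //; exact: powR_tangent.
have sp : s n * s n `^ (p - 1) = s n `^ p.
  have [->|sn] := eqVneq (s n) 0; first by rewrite mul0r powR0 ?gt_eqF.
  by rewrite -{1}[s n]powRr1 // -powRD ?sn ?implybT //; congr (_ `^ _); lra.
move: H; have -> : S n = K * s n by rewrite /s mulrCA divff ?mulr1 ?gt_eqF.
rewrite -mulrA sp; under eq_bigr => m _ do rewrite mulrDr.
rewrite big_split /= -mulr_suml.
set W := \sum_(m < _) k _ in kn *; set Z := \sum_(m < _) _ * _.
have := powR_ge0 (s n) p; move: (s n `^ p) => t t0.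
have : W * ((p - 1) * t) <= K * ((p - 1) * t).
  by rewrite ler_wpM2r // mulr_ge0 // subr_ge0 ltW.
lra.
Qed.

End Convolution.

(** * The two-step method as a perturbation of Euler's methods *)

Section BDF2Estimate.
Context {R : realType} {X : completeNormedModType R[i]}.
Context {DA : set X} {A : X -> X} {p C M K : R}.
Context (p1 : 1 < p).
Context (M0 : 0 <= M).
Context (C_ge0 : 0 <= C).
Context (res : half_plane_resolvent DA A M).
Context (est : discrete_estimate DA A p C).
Context (K0 : 0 < K).
Context (kernelK : forall N, \sum_(n < N) @kernel_maj R M n <= K).
Local Ltac lin := linear_with (R[i]) X ltac:(first [by ring | by field]).
Let p0 : 0 < p. Proof. exact: lt_trans p1. Qed.

(** z - tau A = tau (z / tau - A), and positive dilations preserve the half plane; hence all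
    constants are uniform in tau. *)
Lemma resolvent_scale (tau : R) : 0 < tau ->
  half_plane_resolvent DA (fun x => tau%:C *: A x) M.
Proof.
move=> tau0; have [l ex le] := res.
have tC : tau%:C != 0 :> R[i] by rewrite -cabs_gt0 cabsC gtr0_norm.
have zE (z : R[i]) : z = tau%:C * ((tau^-1)%:C * z).
  by rewrite mulrA fmorphV mulfV // mul1r.
have z0 (z : R[i]) : 0 < complex.Re z -> 0 < complex.Re ((tau^-1)%:C * z).
  by move=> Rz; rewrite ReZ mulr_gt0 ?invr_gt0.
split=> [a b x y Dx Dy|z x Rz|z y Rz Dy].
- by have [D ->] := l a b x y Dx Dy; split=> //; lin.
- have [y Dy E] := ex _ ((tau^-1)%:C *: x) (z0 z Rz); exists y => //.
  rewrite [in LHS](zE z); transitivity (tau%:C *: ((tau^-1)%:C *: x)); last first.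
    by rewrite scalerA fmorphV mulfV // scale1r.
  by rewrite -E; move: (_ * z) => w; lin.
- rewrite [z in leRHS]zE; have := le _ y (z0 z Rz) Dy.
  have -> : tau%:C * ((tau^-1)%:C * z) *: y - tau%:C *: A y =
     tau%:C *: ((tau^-1)%:C * z *: y - A y) by move: (_ * z) => w; lin.
  rewrite rnormZr cabsM cabsC !gtr0_norm ?invr_gt0 // => H.
  rewrite mulrCA; move: H; rewrite -mulrA mulrC ler_pdivrMr //.
  by rewrite [tau * _]mulrC.
Qed.

(** In the constant, the two powers of 2 come from [powRD_le], for P_n + P_(n+1) and for |F| + d,
    the factor 2 from counting each P twice, and 1 + K^p from the data and the convolution. *)
Lemma bdf2_apriori (tau : R) (N : nat) (F U : nat -> X) : 0 < tau -> F 0%N = 0 ->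
  @bdf R X DA (fun x => tau%:C *: A x) U (fun n => tau%:C *: F n) ->
  \sum_(n < N) rnorm (A (U n.+1)) `^ p <=
    C * (2 `^ p * (2 * (2 `^ p * (1 + K `^ p)))) * \sum_(n < N.+1) rnorm (F n) `^ p.
Proof.
move=> tau0 F0 HU; have rs := resolvent_scale tau0.
have tC : tau%:C != 0 :> R[i] by rewrite -cabs_gt0 cabsC gtr0_norm.
have U0 : U 0%N = 0 by apply: (bdf_uniq0 rs HU); rewrite F0 scaler0.
pose d n := rnorm (diff2 U n) / tau.
have d0 n : 0 <= d n by rewrite divr_ge0 ?rnorm_ge0 // ltW.
pose P n := rnorm (F n) + d n; have P0 n : 0 <= P n by rewrite addr_ge0 ?rnorm_ge0.
have e0 n : 0 <= P n + P n.+1 by rewrite addr_ge0.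
have dE n : d n = rnorm ((tau^-1)%:C *: diff2 U n).
  by rewrite rnormZr gtr0_norm ?invr_gt0 // mulrC.
have tE : (tau^-1)%:C = (tau%:C)^-1 :> R[i] by rewrite fmorphV.
(* The two-step formula is the backward quotient plus half the second difference over tau, which
   compares it with implicit Euler at n + 1 ([E2]). Explicit Euler at n needs in addition the second
   difference at n + 1 ([E1]). *)
have He n : rnorm (slope (h := tau) (y := U) n - A (U n)) <= P n + P n.+1 /\
            rnorm (slope (h := tau) (y := U) n - A (U n.+1)) <= P n + P n.+1.
  have E2 : slope (h := tau) (y := U) n - A (U n.+1) =
      F n.+1 - (2^-1 : R[i]) *: ((tau^-1)%:C *: diff2 U n.+1).
    have [_] := HU n.+1; rewrite /slope /diff2 /= tE.
    move: (tau%:C : R[i]) tC => t t0 E.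
    have -> : F n.+1 = t^-1 *: (t *: F n.+1) by rewrite scalerA mulVf // scale1r.
    by rewrite -E; lin.
  have E1 : slope (h := tau) (y := U) n - A (U n) =
      F n + ((tau^-1)%:C *: diff2 U n.+1 - (2^-1 : R[i]) *: ((tau^-1)%:C *: diff2 U n)).
    have [_] := HU n; rewrite /slope /diff2 /= tE.
    move: (tau%:C : R[i]) tC => t t0 E.
    have -> : F n = t^-1 *: (t *: F n) by rewrite scalerA mulVf // scale1r.
    by rewrite -E; lin.
  have half (x : X) : rnorm ((2^-1 : R[i]) *: x) <= rnorm x.
    have -> : 2^-1 = (2^-1 : R)%:C :> R[i] by rewrite fmorphV rmorph_nat.
    rewrite rnormZr gtr0_norm ?invr_gt0 //; have := rnorm_ge0 x; lra.
  have f1 := rnorm_ge0 (F n); have f2 := rnorm_ge0 (F n.+1).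
  rewrite E1 E2 /P; split.
    have := rnormD (F n) ((tau^-1)%:C *: diff2 U n.+1 - (2^-1 : R[i]) *: ((tau^-1)%:C *: diff2 U n)).
    have := rnorm_triB ((tau^-1)%:C *: diff2 U n.+1) ((2^-1 : R[i]) *: ((tau^-1)%:C *: diff2 U n)).
    have := half ((tau^-1)%:C *: diff2 U n); rewrite -!dE; lra.
  have := rnorm_triB (F n.+1) ((2^-1 : R[i]) *: ((tau^-1)%:C *: diff2 U n.+1)).
  have := half ((tau^-1)%:C *: diff2 U n.+1); have := d0 n; rewrite -!dE; lra.
have H := est tau0 U0 (fun n (_ : (n <= N)%N) => (HU n).1) e0 (fun n (_ : (n < N)%N) => He n).
apply: le_trans H _; rewrite -mulrA ler_wpM2l //.
pose f n := rnorm (F n) `^ p; pose g n := P n `^ p.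
have g0 n : 0 <= g n by apply: powR_ge0.
have Hd : \sum_(n < N.+1) d n `^ p <= K `^ p * \sum_(n < N.+1) f n.
  apply: (young_conv p1 (k := @kernel_maj R M) (a := fun n => rnorm (F n))) => //.
  - by move=> n; apply: kernel_maj_ge0.
  - by move=> n; apply: rnorm_ge0.
  move=> n; rewrite d0 /= /d ler_pdivrMr // mulr_suml.
  apply: le_trans (diff2_conv rs M0 n HU) _; apply: ler_sum => m _.
  by rewrite rnormZr gtr0_norm // [tau * _]mulrC mulrA.
have Hg : \sum_(n < N.+1) g n <= 2 `^ p * (1 + K `^ p) * \sum_(n < N.+1) f n.
  apply: (@le_trans _ _ (\sum_(n < N.+1) 2 `^ p * (f n + d n `^ p))).
    by apply: ler_sum => n _; apply: powRD_le => //; apply: rnorm_ge0.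
  rewrite -mulr_sumr -mulrA ler_wpM2l ?powR_ge0 // big_split /= mulrDl mul1r.
  by rewrite lerD2l.
apply: (@le_trans _ _ (\sum_(n < N) 2 `^ p * (g n + g n.+1))).
  by apply: ler_sum => n _; apply: powRD_le.
rewrite -mulr_sumr -!mulrA ler_wpM2l ?powR_ge0 // big_split /=.
have s1 : \sum_(n < N) g n <= \sum_(n < N.+1) g n by apply: sum_widen_le.
have s2 : \sum_(n < N) g n.+1 <= \sum_(n < N.+1) g n.
  by rewrite [leRHS]big_ord_recl lerDr.
move: Hg; rewrite -mulrA; lra.
Qed.

End BDF2Estimate.

Lemma stage_uniq (R : realType) (X : completeNormedModType R[i]) (DA : set X) (A : X -> X)
    (M : R) (x y : X) : half_plane_resolvent DA A M -> DA x -> DA y ->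
  (3 / 2 : R[i]) *: x - A x = (3 / 2 : R[i]) *: y - A y -> x = y.
Proof.
move=> res Dx Dy E; have [D AE] := DAB res Dx Dy; apply/subr0_eq/rnorm_eq0.
have zE : 3 / 2 = (3 / 2 : R)%:C :> R[i] by rewrite rmorphM fmorphV !rmorph_nat.
have z0 : 0 < complex.Re (3 / 2 : R[i]) by rewrite zE /= divr_gt0.
have [_ _ /(_ _ _ z0 D)] := res.
have -> : (3 / 2 : R[i]) *: (x - y) - A (x - y) = 0.
  rewrite AE; transitivity (((3 / 2 : R[i]) *: x - A x) - ((3 / 2 : R[i]) *: y - A y)).
    by linear_with (R[i]) X ltac:(first [by ring | by field]).
  by rewrite E subrr.
rewrite rnorm0 mulr0 pmulr_rle0; last first.
  by apply: lt_le_trans (Re_le_cabs _).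
by move=> le; apply/le_anti; rewrite le rnorm_ge0.
Qed.

Lemma bdf2_diffE (R : realType) (X : completeNormedModType R[i]) (tau : R) (u : nat -> X) n :
  bdf_diff (bdf2_coef R) 2 tau u n.+2 =
  (tau^-1)%:C *: ((3 / 2 : R[i]) *: u n.+2 - 2 *: u n.+1 + 2^-1 *: u n).
Proof.
rewrite /bdf_diff !big_ord_recl big_ord0 addr0 /= /bdf2_coef /= /bump /=.
rewrite !subSS !subn0 rmorphN !rmorphM !fmorphV !rmorph_nat rmorph1 mul1r.
by rewrite scaleNr addrA.
Qed.

Theorem theorem4p1 (R : realType) (X : completeNormedModType R[i])
    (p : R) (DA : set X) (A : X -> X) :
  UMD X -> 1 < p ->
  generates_analytic DA A ->
  maximal_regularity p DA A ->
  exists C : R, forall (tau : R) (N : nat) (f : nat -> X),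
    0 < tau -> (2 <= N)%N ->
    (exists u : nat -> X, bdf_solution DA A (bdf2_coef R) 2 tau N f u) /\
    forall u : nat -> X, bdf_solution DA A (bdf2_coef R) 2 tau N f u ->
      seq_lpnorm p 2 N (bdf_diff (bdf2_coef R) 2 tau u)
        + seq_lpnorm p 2 N (fun n => A (u n))
      <= C * seq_lpnorm p 2 N f.
Proof.
move=> _ p1 gen mr; have p0 : 0 < p by apply: lt_trans p1.
have [S sg] := analytic_semigroup_spec gen.
have [C C_ge0 est] := discrete_apriori p0 sg mr.
pose C0 := C `^ p^-1; have C00 : 0 <= C0 by apply: powR_ge0.
pose M := 1 + C0; have M0 : 0 <= M by rewrite addr_ge0.
have res : half_plane_resolvent DA A M.
  apply: (half_plane_resolventP sg C00) => z y; apply: apriori_of_discrete => //.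
  by move=> a b x1 x2; apply: (gen_lin sg).
pose K := 144 * M + 6 * @kernel_const R M + 1.
have K0 : 0 < K by rewrite ltr_wpDl // addr_ge0 ?mulr_ge0 ?kernel_const_ge0.
have kernelK n : \sum_(i < n) @kernel_maj R M i <= K.
  by apply: le_trans (sum_kernel_maj M0 n) _; rewrite lerDl.
pose C1 := C * (2 `^ p * (2 * (2 `^ p * (1 + K `^ p)))).
have C1_ge0 : 0 <= C1 by rewrite !mulr_ge0 ?addr_ge0 ?powR_ge0.
(* The first root bounds the difference quotients, which equal A u + f, and the second one the terms
   A u. *)
exists ((2 `^ p * (C1 + 1)) `^ p^-1 + C1 `^ p^-1) => tau N f tau0 N2.
(* The data are extended by 0 so that the scheme runs over all indices from 0; zero data at 0 and 1
   reproduce the starting values. *)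
pose F n := if (2 <= n <= N)%N then f n else 0.
have rs := resolvent_scale res tau0.
have [U HU] := bdf_exists rs (fun n => tau%:C *: F n).
have U0 : U 0%N = 0 by apply: (bdf_uniq0 rs HU); rewrite /= scaler0.
have U1 : U 1%N = 0.
  apply: (@bdf_uniq0 _ _ _ _ _ rs (fun n => U n.+1) (fun n => tau%:C *: F n.+1)).
    move=> n; have [D E] := HU n.+1; split=> //; rewrite -E.
    by case: n {D E} => [|[|n]] /=; rewrite ?U0.
  by rewrite /= scaler0.
have tC : tau%:C != 0 :> R[i] by rewrite -cabs_gt0 cabsC gtr0_norm.
have tE : (tau^-1)%:C = (tau%:C)^-1 :> R[i] by rewrite fmorphV.
have stage u n : bdf_diff (bdf2_coef R) 2 tau u n.+2 = A (u n.+2) + F n.+2 <->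
    (3 / 2 : R[i]) *: u n.+2 - 2 *: u n.+1 + 2^-1 *: u n - tau%:C *: A (u n.+2) = tau%:C *: F n.+2.
  rewrite bdf2_diffE tE; move: (_ + 2^-1 *: u n) => v.
  split=> [E|/eqP]; last first.
    by rewrite subr_eq -scalerDr => /eqP ->; rewrite scalerA mulVf // scale1r addrC.
  have -> : v = tau%:C *: ((tau%:C)^-1 *: v) by rewrite scalerA mulfV // scale1r.
  by rewrite E scalerDr addrAC subrr add0r.
have FE n : (n.+2 <= N)%N -> F n.+2 = f n.+2 by rewrite /F => ->.
have solU : bdf_solution DA A (bdf2_coef R) 2 tau N f U.
  split=> [[|[|n]] //|[|[|n]] // nN]; have [D E] := HU n.+2; split=> //.
  by rewrite -(FE n nN); apply/stage.
split; first by exists U.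
move=> u [u01 Hu].
(* Agreement holds up to [N] only: beyond it u is unconstrained, while U continues with zero
   data. *)
have uU n : (n <= N)%N -> u n = U n.
  elim/ltn_ind: n => -[|[|n]] IH nN; [by rewrite u01|by rewrite u01|].
  have [Du] := Hu n.+2 nN; rewrite -(FE n nN) => /stage Eu; have [DU /= EU] := HU n.+2.
  apply: (stage_uniq rs Du DU).
  rewrite -(IH n.+1) ?(ltnW nN) // -(IH n) ?(ltnW (ltnW nN)) // -Eu in EU.
  apply: (addIr (2^-1 *: u n - 2 *: u n.+1)).
  transitivity ((3 / 2 : R[i]) *: u n.+2 - 2 *: u n.+1 + 2^-1 *: u n - tau%:C *: A (u n.+2)).
    by linear_with (R[i]) X ltac:(first [by ring | by field]).
  by rewrite -EU; linear_with (R[i]) X ltac:(first [by ring | by field]).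
pose Sf := \sum_(2 <= n < N.+1) rnorm (f n) `^ p.
have Sf0 : 0 <= Sf by apply: sumr_ge0 => n _; apply: powR_ge0.
have SFE : \sum_(n < N.+1) rnorm (F n) `^ p = Sf.
  rewrite -(big_mkord xpredT (fun n => rnorm (F n) `^ p)) big_ltn // big_ltn ?ltnS 1?ltnW //.
  rewrite /F /= rnorm0 powR0 ?gt_eqF // !add0r; apply: eq_big_nat => n nN.
  by rewrite -ltnS nN.
have SA : \sum_(2 <= n < N.+1) rnorm (A (u n)) `^ p <= C1 * Sf.
  rewrite -SFE; apply: le_trans (bdf2_apriori p1 M0 C_ge0 res est K0 kernelK N tau0 erefl HU).
  rewrite -(big_mkord xpredT (fun n => rnorm (A (U n.+1)) `^ p)).
  rewrite -(big_add1 _ _ 0 N.+1 xpredT (fun n => rnorm (A (U n)) `^ p)) [leRHS]big_ltn ?ltnS 1?ltnW //.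
  rewrite -[leLHS]add0r lerD ?powR_ge0 //.
  by rewrite !big_nat; apply: ler_sum => n /andP[_ nN]; rewrite uU.
have SB : \sum_(2 <= n < N.+1) rnorm (bdf_diff (bdf2_coef R) 2 tau u n) `^ p <= 2 `^ p * (C1 + 1) * Sf.
  apply: (@le_trans _ _ (\sum_(2 <= n < N.+1) 2 `^ p * (rnorm (A (u n)) `^ p + rnorm (f n) `^ p))).
    rewrite !big_nat; apply: ler_sum => n nN; rewrite (Hu n nN).2.
    apply: le_trans (powRD_le p1 (rnorm_ge0 _) (rnorm_ge0 _)).
    by rewrite ge0_ler_powR ?(ltW p0) ?nnegrE ?addr_ge0 ?rnorm_ge0 ?rnormD.
  by rewrite -mulr_sumr -mulrA ler_wpM2l ?powR_ge0 // big_split /= mulrDl mul1r lerD2r.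
have ip : 0 <= p^-1 by rewrite invr_ge0 ltW.
rewrite /seq_lpnorm -/Sf mulrDl -!powRM ?mulr_ge0 ?addr_ge0 ?powR_ge0 //.
apply: lerD; rewrite ge0_ler_powR ?nnegrE ?mulr_ge0 ?addr_ge0 ?powR_ge0 //.
- by apply: sumr_ge0 => n _; apply: powR_ge0.
- by apply: sumr_ge0 => n _; apply: powR_ge0.
Qed.
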